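(* The limit $u_\infty$ is unique: if $u_{1,\infty}$ and $u_{2,\infty}$ are two subsequential limits, as $p\to\infty$, of the family $(u_p)$, then $u_{1,\infty}=u_{2,\infty}$ in $\overline\Omega$.
   Context: Setting: $\Omega\subset\mathbb{R}^d$ is a bounded smooth domain, $F$ is a Lipschitz function on $\partial\Omega$, and $\Psi:\overline\Omega\to\mathbb{R}$ is a continuous obstacle with $\sup_{\partial\Omega}\Psi<\inf_{\partial\Omega}F$. For $1<p<\infty$, $u_p$ denotes the unique minimizer of $\int_\Omega|Dv|^p\,dx$ among all $v\in W^{1,p}(\Omega)$ with trace $F$ on $\partial\Omega$ and $v\ge\Psi$ in $\Omega$. A subsequential limit $u_\infty$ is a limit of $u_{p_j}$ along a sequence $p_j\to\infty$, the convergence being locally uniform in $\overline\Omega$ and weak in $W^{1,q}(\Omega)$ for every finite $q>1$ (such subsequential limits exist). *)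

(* Defs.v *)
From HB Require Import structures.
From mathcomp Require Import all_boot all_order all_algebra.
From mathcomp Require Import all_classical all_reals all_analysis.

Set Implicit Arguments.
Unset Strict Implicit.
Unset Printing Implicit Defensive.
Import Order.TTheory GRing.Theory Num.Theory.
Import numFieldNormedType.Exports.

Local Open Scope classical_set_scope.
Local Open Scope ring_scope.

(* R^n is 'rV[R]_n.  Its library norm is the sup norm; it is used below only
   where equivalent norms give the same notion (topology, boundedness, Lipschitz
   continuity).  Lengths of gradients and diameters use the Euclidean norm. *)

Definition measure_rV_display : measure_display -> measure_display.
Proof. exact. Qed.

Section measurable_rV.
Context {d} {T : measurableType d} (n : nat).

Let coors : 'I_n -> 'rV[T]_n -> T := fun i x => x ord0 i.

Let rV_set0 : g_sigma_preimage coors set0.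
Proof. exact: sigma_algebra0. Qed.

Let rV_setC A : g_sigma_preimage coors A -> g_sigma_preimage coors (~` A).
Proof. exact: sigma_algebraC. Qed.

Let rV_bigcup (F : _^nat) : (forall i, g_sigma_preimage coors (F i)) ->
  g_sigma_preimage coors (\bigcup_i (F i)).
Proof. exact: sigma_algebra_bigcup. Qed.

(* The product sigma-algebra, as the library has it for n.-tuple T; for T = R
   these are the Borel sets of R^n. *)
HB.instance Definition _ := @isMeasurable.Build (measure_rV_display d)
  'rV[T]_n (g_sigma_preimage coors) rV_set0 rV_setC rV_bigcup.

Lemma measurable_coord_rV (i : 'I_n) :
  measurable_fun [set: 'rV[T]_n] (fun x : 'rV[T]_n => x ord0 i).
Proof.
move=> _ Y mY; rewrite setTI; apply: sub_sigma_algebra => /=.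
rewrite -bigcup_seq/=; exists i => /=; first by rewrite mem_index_enum.
by exists Y => //; rewrite setTI.
Qed.

Lemma measurable_fun_rVP d1 (T1 : measurableType d1) (f : T1 -> 'rV[T]_n) :
  measurable_fun [set: T1] f <->
  forall i, measurable_fun [set: T1] (fun x => f x ord0 i).
Proof.
split=> [mf i|mf].
  exact: (measurableT_comp (measurable_coord_rV i) mf).
suff : g_sigma_preimage (fun i => coors i \o f) `<=` measurable.
  rewrite g_sigma_preimage_comp => h _ A mA.
  by rewrite setTI; apply: h; exists A => //; rewrite setTI.
apply: smallest_sub; first exact: sigma_algebra_measurable.
rewrite -bigcup_seq; apply: bigcup_sub => i _ A [B mB <-].
exact: mf.
Qed.

End measurable_rV.

Section lebesgue_measure_rV.
Context {R : realType}.
Local Open Scope ereal_scope.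

(* n-dimensional Lebesgue measure, as the iterated product of the
   one-dimensional one. *)
Fixpoint lebesgue_rV (n : nat) : set 'rV[R]_n -> \bar R :=
  match n with
  | 0 => \d_(0%R : 'rV[R]_0)
  | m.+1 => fun A => \int[lebesgue_measure]_x
      lebesgue_rV [set v : 'rV[R]_m | A (row_mx (x%:M : 'M[R]_1) v)]
  end.

Let cons_rV n (z : measurableTypeR R * 'rV[R]_n) : 'rV[R]_n.+1 :=
  row_mx (z.1%:M : 'M[R]_1) z.2.

Let uncons_rV n (v : 'rV[R]_n.+1) : measurableTypeR R * 'rV[R]_n :=
  (v ord0 ord0, \row_j v ord0 (lift ord0 j)).

Let cons_rVK n : cancel (@cons_rV n) (@uncons_rV n).
Proof.
move=> [x v]; congr (_, _).
  rewrite /cons_rV/= (_ : ord0 = lshift n (ord0 : 'I_1)); last exact/val_inj.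
  by rewrite (row_mxEl (x%:M : 'M[R]_1) v) mxE eqxx.
apply/rowP => j; rewrite mxE /cons_rV/=.
by rewrite (_ : lift ord0 j = rshift 1 j)
  ?(row_mxEr (x%:M : 'M[R]_1) v)//; exact/val_inj.
Qed.

Let measurable_cons_rV n :
  measurable_fun [set: measurableTypeR R * 'rV[R]_n] (@cons_rV n).
Proof.
apply/measurable_fun_rVP => i; rewrite /cons_rV/=.
have [k|k] := splitP (i : 'I_(1 + n)) => ik.
- have -> : i = lshift n k by exact/val_inj.
  apply: (eq_measurable_fun
      (fst : measurableTypeR R * 'rV[R]_n -> measurableTypeR R)) => [z _|];
    last exact: measurable_fst.
  by rewrite (row_mxEl (z.1%:M : 'M[R]_1) z.2) !ord1 mxE eqxx.
- have -> : i = rshift 1 k by exact/val_inj.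
  apply: (eq_measurable_fun
      (fun z : measurableTypeR R * 'rV[R]_n => z.2 ord0 k)) => [z _|].
    by rewrite (row_mxEr (z.1%:M : 'M[R]_1) z.2).
  exact: (measurableT_comp (measurable_coord_rV k) measurable_snd).
Qed.

Let measurable_uncons_rV n : measurable_fun [set: 'rV[R]_n.+1] (@uncons_rV n).
Proof.
apply/measurable_fun_pair; first exact: measurable_coord_rV.
apply/measurable_fun_rVP => i.
apply: (eq_measurable_fun (fun v : 'rV[R]_n.+1 => v ord0 (lift ord0 i))).
  by move=> v _; rewrite mxE.
exact: measurable_coord_rV.
Qed.

Let product_cons_rV n
    (l : {sigma_finite_measure set (measurableTypeR R) -> \bar R})
    (m : {sigma_finite_measure set 'rV[R]_n -> \bar R}) :
  exists mu : {sigma_finite_measure set 'rV[R]_n.+1 -> \bar R},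
    forall A, mu A = (l \x m) (@cons_rV n @^-1` A).
Proof.
pose m12 := [the {measure set _ -> \bar R} of l \x m].
pose mu0 : {measure set 'rV[R]_n.+1 -> \bar R} :=
  measure_function_pushforward__canonical__measure_function_Measure
    m12 (@measurable_cons_rV n).
have sfmu : sigma_finite setT mu0.
  have /sigma_finiteP[F [TF ndF Foo]] := sigma_finiteT l.
  have /sigma_finiteP[G [TG ndG Goo]] := sigma_finiteT m.
  exists (fun k => @uncons_rV n @^-1` (F k `*` G k)).
    apply/seteqP; split=> // v _.
    have : (\bigcup_k F k) (uncons_rV v).1 by rewrite -TF.
    have : (\bigcup_k G k) (uncons_rV v).2 by rewrite -TG.
    move=> [k2 _ Gv] [k1 _ Fv]; exists (maxn k1 k2) => //; split.
      by move: Fv; exact/subsetPset/ndF/leq_maxl.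
    by move: Gv; exact/subsetPset/ndG/leq_maxr.
  move=> k; have [mF Fk] := Foo k; have [mG Gk] := Goo k; split.
    rewrite -[X in measurable X]setTI; apply: measurable_uncons_rV => //.
    exact: measurableX.
  rewrite /mu0/= /pushforward -comp_preimage.
  rewrite (_ : _ \o _ = id); last by apply/funext => z /=; rewrite cons_rVK.
  by rewrite preimage_id product_measure1E// lte_mul_pinfty// ge0_fin_numE.
pose B := Measure_isSigmaFinite.Build _ _ _ mu0 sfmu.
pose mu : {sigma_finite_measure set 'rV[R]_n.+1 -> \bar R} :=
  HB.pack (mu0 : set _ -> \bar R) (Measure.class mu0) B.
by exists mu.
Qed.

Let lebesgue_rV_ex n :
  exists m : {sigma_finite_measure set 'rV[R]_n -> \bar R},
    (m : set 'rV[R]_n -> \bar R) = @lebesgue_rV n.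
Proof.
elim: n => [|n [m IH]]; first by exists (\d_(0%R : 'rV[R]_0)).
have [mu muE] := product_cons_rV
  [the {sigma_finite_measure set (measurableTypeR R) -> \bar R}
   of @lebesgue_measure R] m.
exists mu; apply/funext => A; rewrite muE /= -IH.
apply: eq_integral => x _ /=; congr (m _).
by apply/seteqP; split=> v /=; rewrite /xsection/= inE.
Qed.

Let lebesgue_rV0 n : @lebesgue_rV n set0 = 0.
Proof. by have [m <-] := lebesgue_rV_ex n; exact: measure0. Qed.

Let lebesgue_rV_ge0 n A : 0 <= @lebesgue_rV n A.
Proof. by have [m <-] := lebesgue_rV_ex n; exact: measure_ge0. Qed.

Let lebesgue_rV_sigma_additive n : semi_sigma_additive (@lebesgue_rV n).
Proof.
by have [m <-] := lebesgue_rV_ex n; exact: measure_semi_sigma_additive.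
Qed.

HB.instance Definition _ n := isMeasure.Build _ _ _ (@lebesgue_rV n)
  (@lebesgue_rV0 n) (@lebesgue_rV_ge0 n) (@lebesgue_rV_sigma_additive n).

Let lebesgue_rV_sigma_finite n : sigma_finite setT (@lebesgue_rV n).
Proof. by have [m <-] := lebesgue_rV_ex n; exact: sigma_finiteT. Qed.

HB.instance Definition _ n := Measure_isSigmaFinite.Build _ _ _
  (@lebesgue_rV n) (@lebesgue_rV_sigma_finite n).


End lebesgue_measure_rV.

Notation "''e_' i" := (delta_mx ord0 i)
  (at level 8, i at level 2, format "''e_' i") : ring_scope.

Section euclidean.
Context {R : realType}.

Definition enorm n (v : 'rV[R]_n) : R := Num.sqrt (\sum_i v ord0 i ^+ 2).

Definition ediam n (A : set 'rV[R]_n) : \bar R :=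
  ereal_sup [set (enorm (z.1 - z.2))%:E | z in A `*` A].

Local Open Scope ereal_scope.

(* s-dimensional Hausdorff measure, without the normalising constant (which
   plays no role in convergence in L^p); with s = n - 1 it is the surface
   measure of the smooth hypersurfaces of R^n.  It is countably additive on
   Borel sets, the only ones used by the integral below.  The empty set is
   treated apart so that ediam A ^+ 0 = 1 counts points when s = 0. *)
Definition hausdorff_gauge n (s : nat) (A : set 'rV[R]_n) : \bar R :=
  if A == set0 then 0 else ediam A ^+ s.

Definition hausdorff_content n (s : nat) (delta : R) (A : set 'rV[R]_n) :
    \bar R :=
  ereal_inf [set \sum_(k <oo) hausdorff_gauge s (U k) |
    U in [set U : (set 'rV[R]_n)^nat |
      (forall k, ediam (U k) <= delta%:E) /\ A `<=` \bigcup_k U k]].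

Definition hausdorff n (s : nat) (A : set 'rV[R]_n) : \bar R :=
  ereal_sup [set hausdorff_content s delta A |
    delta in [set delta : R | (0 < delta)%R]].

End euclidean.

Section smooth.
Context {R : realType}.

Definition boundary (T : topologicalType) (A : set T) : set T :=
  closure A `\` A°.

Fixpoint Ck n (k : nat) (f : 'rV[R]_n -> R) : Prop :=
  match k with
  | 0 => continuous f
  | m.+1 => [/\ continuous f, forall x (i : 'I_n), derivable f x 'e_i &
      forall i : 'I_n, Ck m (fun x => 'D_'e_i f x)]
  end.

Definition smooth n (f : 'rV[R]_n -> R) : Prop := forall k, Ck k f.

Definition grad n (f : 'rV[R]_n -> R) (x : 'rV[R]_n) : 'rV[R]_n :=
  \row_i 'D_'e_i f x.

Definition test_function n (Om : set 'rV[R]_n) (phi : 'rV[R]_n -> R) : Prop :=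
  let supp := closure [set x | phi x != 0] in
  [/\ smooth phi, compact supp & supp `<=` Om].

(* Near each boundary point, up to relabelling and reorienting the coordinate
   axes, the set is the region above the graph of a smooth function; col' i x is
   x with its i-th coordinate removed. *)
Definition smooth_boundary n (Om : set 'rV[R]_n.+1) : Prop :=
  forall x0, boundary Om x0 ->
    exists (r : R) (i : 'I_n.+1) (b : bool) (gamma : 'rV[R]_n -> R),
      [/\ 0 < r, smooth gamma &
        forall x, ball x0 r x ->
          (Om x <-> gamma (col' i x) < (-1) ^+ b * x ord0 i)].

Definition bounded_smooth_domain n (Om : set 'rV[R]_n.+1) : Prop :=
  [/\ open Om, connected Om, Om !=set0, bounded_set Om & smooth_boundary Om].

End smooth.

Section sobolev.
Context {R : realType} (n : nat).
Implicit Types (p q : R) (Om : set 'rV[R]_n.+1) (u v w : 'rV[R]_n.+1 -> R).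
Implicit Types (G H : 'rV[R]_n.+1 -> 'rV[R]_n.+1).

Local Notation leb := (@lebesgue_rV R n.+1).

Definition in_Lp p Om u : Prop :=
  measurable_fun Om u /\ (\int[leb]_(x in Om) (`|u x| `^ p)%:E < +oo)%E.

Definition weak_gradient Om u G : Prop :=
  forall phi, test_function Om phi -> forall i,
    (\int[leb]_(x in Om) (u x * 'D_'e_i phi x)%:E =
     - \int[leb]_(x in Om) (G x ord0 i * phi x)%:E)%E.

(* u is in W^{1,p}(Om) and G is (a representative of) its gradient; Sobolev
   functions are represented by functions, not by classes. *)
Definition sobolev_grad p Om u G : Prop :=
  [/\ in_Lp p Om u, forall i, in_Lp p Om (fun x => G x ord0 i) &
      weak_gradient Om u G].

Definition sobolev p Om u : Prop := exists G, sobolev_grad p Om u G.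

Definition dirichlet_energy p Om G : \bar R :=
  (\int[leb]_(x in Om) (enorm (G x) `^ p)%:E)%E.

Definition sobolev_norm p Om u G : \bar R :=
  ((\int[leb]_(x in Om) (`|u x| `^ p)%:E + dirichlet_energy p Om G)
     `^ p^-1)%E.

(* The trace operator is the continuous extension to W^{1,p}(Om), with values in
   L^p of the boundary for the surface measure, of the restriction
   phi |-> phi|_(boundary Om) of smooth functions on the closure. *)
Definition has_trace p Om u (g : 'rV[R]_n.+1 -> R) : Prop :=
  exists (G : 'rV[R]_n.+1 -> 'rV[R]_n.+1) (phi : nat -> 'rV[R]_n.+1 -> R),
    [/\ sobolev_grad p Om u G,
        forall k, smooth (phi k),
        sobolev_norm p Om (fun x => phi k x - u x)
          (fun x => grad (phi k) x - G x) @[k --> \oo] --> 0%E &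
        (\int[hausdorff n]_(x in boundary Om) (`|phi k x - g x| `^ p)%:E)%E
          @[k --> \oo] --> 0%E].

(* v, with gradient G, competes in the obstacle problem. *)
Definition admissible Om (F Psi : 'rV[R]_n.+1 -> R) p v G : Prop :=
  [/\ sobolev_grad p Om v G, has_trace p Om v F &
      {ae leb, forall x, Om x -> Psi x <= v x}].

Definition obstacle_minimizer Om (F Psi : 'rV[R]_n.+1 -> R) p u : Prop :=
  exists2 G, admissible Om F Psi p u G &
    forall v H, admissible Om F Psi p v H ->
      (dirichlet_energy p Om G <= dirichlet_energy p Om H)%E.

(* Bounded linear functionals on W^{1,q}(Om); only the values on W^{1,q}(Om)
   matter, and boundedness makes them compatible with a.e. equality. *)
Definition sobolev_dual q Om (l : ('rV[R]_n.+1 -> R) -> R) : Prop :=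
  (forall (a : R) u v, sobolev q Om u -> sobolev q Om v ->
    l (fun x => a * u x + v x) = a * l u + l v) /\
  (exists C : R, forall u G, sobolev_grad q Om u G ->
    (`|l u|%:E <= C%:E * sobolev_norm q Om u G)%E).

(* In the sequence u_(p_j), the terms with p_j < q need not lie in W^{1,q}. *)
Definition weak_sobolev_cvg q Om (v_ : nat -> 'rV[R]_n.+1 -> R) v : Prop :=
  [/\ \forall j \near \oo, sobolev q Om (v_ j), sobolev q Om v &
      forall l, sobolev_dual q Om l -> l (v_ j) @[j --> \oo] --> l v].

Definition locally_uniform_cvg (A : set 'rV[R]_n.+1)
    (v_ : nat -> 'rV[R]_n.+1 -> R) v : Prop :=
  forall x, A x -> exists2 N, nbhs x N & {uniform N `&` A, v_ @ \oo --> v}.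

(* w_ j is the representative of the Sobolev function u (p_ j) for which uniform
   convergence on the closure makes sense: for p_ j > n.+1 it is the one that is
   continuous up to the boundary. *)
Definition subsequential_limit Om (u : R -> 'rV[R]_n.+1 -> R) uinf : Prop :=
  exists (p_ : nat -> R) (w_ : nat -> 'rV[R]_n.+1 -> R),
    [/\ forall j, 1 < p_ j,
        p_ j @[j --> \oo] --> +oo,
        (forall j, {ae leb, forall x, Om x -> w_ j x = u (p_ j) x}) /\
        (\forall j \near \oo, {within closure Om, continuous (w_ j)}),
        locally_uniform_cvg (closure Om) w_ uinf &
        forall q, 1 < q -> weak_sobolev_cvg q Om (fun j => u (p_ j)) uinf].

End sobolev.

(* Main.v *)
(* Where u_p lies on one side of a smooth cone C, moving u_p towards C gives a
   competitor, and minimality bounds the L^p norm of Du_p there by that of DC;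
   raising u_p is always admissible, lowering it only away from the obstacle.  As
   p -> oo this becomes a Lipschitz bound for averages of u_p along segments, so
   that a limit enjoys comparison with cones from below everywhere, and from
   above off the contact set.  The trace condition fixes the boundary values of
   the limits.  If two limits satisfied u_1 > u_2 somewhere, then u_1 > u_2 >= Psi
   there, so u_1 enjoys comparison with cones from above where it exceeds u_2, and
   the argument of Armstrong and Smart for infinity-harmonic functions applies. *)
Require Import Defs.
From mathcomp Require Import all_boot all_order all_algebra.
From mathcomp Require Import all_classical all_reals all_analysis.
From mathcomp Require Import measurable_realfun ring lra.
Set Implicit Arguments.
Unset Strict Implicit.
Unset Printing Implicit Defensive.
Import Order.TTheory GRing.Theory Num.Theory.
Import numFieldNormedType.Exports.
Local Open Scope classical_set_scope.
Local Open Scope ring_scope.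

(** * Lebesgue measure on R^n and graph coordinates *)

Section rV_measure.
Context {R : realType}.
Implicit Types n : nat.

(** The move towards the cone is made with [ramp t = t exp(-1/t)], a smooth positive part of slope
    between 0 and 1. On the smooth approximations supplied by the trace condition the chain rule is
    classical, and it passes to the limit; the new gradient is a convex combination of [Du_p] and
    [DC]. The resulting energy bound does not depend on the fraction [s] of the gap that is removed,
    so a lowering can be made small enough to miss the obstacle. Since [Du_p] is only an L^p
    function, slopes are read from averages against a bump with a moving centre; Young's inequality
    at a level [l > b] leaves a remainder of order [l^(1-p) b^p], which vanishes as [p] grows. The
    cone has to dominate the boundary data without gaining slope where it is used; hence its steep
    term outside a ball. That an L^p trace determines pointwise boundary values is checked along the
    fibres of a thin collar: a boundary set of small Hausdorff measure projects to a small set of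
    fibres, and these are discarded. *)

Definition rect n (A : 'I_n -> set R) : set 'rV[R]_n :=
  [set x | forall i, A i (x ord0 i)].

Lemma ball_rV n (x : 'rV[R]_n) (e : R) (y : 'rV[R]_n) : 0 < e ->
  ball x e y <-> forall i, `|x ord0 i - y ord0 i| < e.
Proof.
move=> e0; split=> [[_ h] i|h]; first exact: h.
by split=> // i j; rewrite ord1; exact: h.
Qed.

Lemma coord_le_norm n (x : 'rV[R]_n) i : `|x ord0 i| <= `|x|.
Proof.
by rewrite [leRHS]/Num.Def.normr/= mx_normrE; exact: (le_bigmax _ _ (ord0, i)).
Qed.

Lemma measurable_rect n (A : 'I_n -> set R) :
  (forall i, measurable (A i)) -> measurable (rect A).
Proof.
move=> mA.
rewrite (_ : rect A = \bigcap_(i in [set: 'I_n])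
    ((fun x : 'rV[R]_n => x ord0 i) @^-1` A i)); last first.
  by apply/seteqP; split=> [x h i _|x h i]; [exact: h|exact: (h i I)].
apply: fin_bigcap_measurable => [|i _]; first exact: finite_finset.
by rewrite -[X in measurable X]setTI; exact: measurable_coord_rV.
Qed.

Lemma rat_approx (x e : R) : 0 < e -> exists q : rat, `|ratr q - x| < e.
Proof.
move=> e0; have /rat_in_itvoo[q] : x - e < x + e by rewrite ltrD2l gtrN.
by rewrite in_itv/= -ltr_distl => ?; exists q.
Qed.

(** The sigma-algebra comes from the coordinates and not from the topology: an open set is the union
    of the countably many cubes with rational centre and radius [1/(k+1)] that it contains. *)
Lemma open_measurable_rV n (A : set 'rV[R]_n) : open A -> measurable A.
Proof.
move=> oA; pose F (z : 'rV[rat]_n * nat) : set 'rV[R]_n :=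
  rect (fun i => ball (ratr (z.1 ord0 i) : R) z.2.+1%:R^-1).
pose G z := if pselect (F z `<=` A) then F z else set0.
have -> : A = \bigcup_z G z.
  apply/seteqP; split => [x Ax|x [z _]]; last first.
    by rewrite /G; case: pselect => // FA; exact: FA.
  have /nbhs_ballP[e e0 xeA] := oA _ Ax.
  have [k ke] : exists k : nat, k.+1%:R^-1 < e / 2.
    have /ltr_add_invr[k] : 0 < e / 2 by rewrite divr_gt0.
    by rewrite add0r => ?; exists k.
  have k0 : (0 < k.+1%:R^-1 :> R) by rewrite invr_gt0.
  pose q : 'rV[rat]_n := \row_i xget 0 [set q | `|ratr q - x ord0 i| < k.+1%:R^-1].
  have qx i : `|ratr (q ord0 i) - x ord0 i| < k.+1%:R^-1.
    rewrite mxE; case: xgetP => [_ -> //|h].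
    by have [y /h] := rat_approx (x ord0 i) k0.
  exists (q, k) => //; rewrite /G; case: pselect => // -[] y Fy.
  apply: xeA; apply/ball_rV => // i.
  have := Fy i; have := qx i; rewrite /ball/= => h1 h2.
  rewrite (le_lt_trans (ler_distD (ratr (q ord0 i)) _ _))//.
  by rewrite distrC (splitr e) ltrD// (lt_trans _ ke).
apply: countable_bigcupT_measurable => // z; rewrite /G.
case: pselect => /= [_|_]; last exact: measurable0.
apply: measurable_rect => i.
exact: open_measurable (ball_open _ _).
Qed.

Lemma closed_measurable_rV n (A : set 'rV[R]_n) : closed A -> measurable A.
Proof.
by rewrite -openC => /open_measurable_rV/measurableC; rewrite setCK.
Qed.

Lemma continuous_measurable_rV n (D : set 'rV[R]_n) (f : 'rV[R]_n -> R) :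
  measurable D -> {within D, continuous f} -> measurable_fun D f.
Proof.
move=> mD /continuousP cf; apply: (measurability _ (RGenOpens.measurableE R)).
move=> _ [_ [a [b ->] <-]].
have /cf : open `]a, b[%classic by exact: interval_open.
move=> /(@open_subspaceP _ D)[V oV VD].
rewrite setIC -VD; apply: measurableI => //; exact: open_measurable_rV.
Qed.

Lemma lebesgue_rV_rect n (A : 'I_n -> set R) : (forall i, measurable (A i)) ->
  (lebesgue_rV (rect A) = \prod_(i < n) lebesgue_measure (A i))%E.
Proof.
elim: n A => [|n IH] A mA.
  by rewrite big_ord0 /= diracE mem_set// => -[].
pose A' i := A (lift ord0 i).
transitivity (\int[lebesgue_measure]_x
    ((\1_(A ord0) x)%:E * lebesgue_rV (rect A'))%E)%E.
  apply: eq_integral => x _.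
  have row0 v : (row_mx (x%:M : 'M[R]_1) v : 'rV[R]_n.+1) ord0 ord0 = x.
    rewrite (_ : ord0 = lshift n (ord0 : 'I_1)); last exact/val_inj.
    by rewrite (row_mxEl (x%:M : 'M[R]_1) v) mxE eqxx.
  have rowS v j : (row_mx (x%:M : 'M[R]_1) v : 'rV[R]_n.+1) ord0 (lift ord0 j)
      = v ord0 j.
    by rewrite (_ : lift ord0 j = rshift 1 j)
      ?(row_mxEr (x%:M : 'M[R]_1) v)//; exact/val_inj.
  rewrite indicE; case: (boolP (x \in A ord0)) => [|] xA; rewrite ?mul1e ?mul0e.
    congr lebesgue_rV; apply/seteqP; split => v /= h i.
      by rewrite /A' -rowS; exact: h.
    have [j ->|->] := unliftP ord0 i; first by rewrite rowS; exact: h.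
    by rewrite row0; exact: set_mem xA.
  rewrite (_ : mkset _ = set0); first exact: (measure0 (@lebesgue_rV R n)).
  apply/seteqP; split => // v /= h.
  by move: xA; rewrite notin_setE; apply; have := h ord0; rewrite row0.
rewrite big_ord_recl ge0_integralZr//; last first.
  apply/measurable_EFinP; apply: measurable_indic; exact: mA.
congr (_ * _)%E; last by rewrite IH// => i; exact: mA.
rewrite -[in RHS](setIT (A ord0)).
by apply: (@integral_indic _ (measurableTypeR R) R) => //; exact: mA.
Qed.

(** Boxes are stable under intersection and generate the product sigma-algebra, and the cubes of
    half-side [k] exhaust the space with finite measure; so a measure is determined by its values on
    boxes. *)
Lemma measure_unique_rV n (m1 m2 : {measure set 'rV[R]_n -> \bar R}) :
  (forall A : 'I_n -> set R, (forall i, measurable (A i)) ->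
     m1 (rect A) = m2 (rect A)) ->
  (forall k : nat, (m1 (rect (fun=> `[(- k%:R)%R, k%:R%R]%classic)) < +oo)%E) ->
  forall A, measurable A -> m1 A = m2 A.
Proof.
move=> m12 m1oo A mA.
pose G : set (set 'rV[R]_n) :=
  [set rect B | B in [set B : 'I_n -> set R | forall i, measurable (B i)]].
apply: (measure_unique G (fun k => rect (fun=> `[- k%:R, k%:R]%classic))) => //.
- apply/seteqP; split; last first.
    apply: smallest_sub; first exact: sigma_algebra_measurable.
    by move=> _ [B mB <-]; exact: measurable_rect.
  apply: smallest_sub; first exact: smallest_sigma_algebra.
  rewrite -bigcup_seq; apply: bigcup_sub => i _ _ [B mB <-].
  apply: sub_sigma_algebra.
  exists (fun j => if j == i then B else setT); first by move=> j /=; case: ifP.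
  rewrite setTI; apply/seteqP; split => x /=.
    by move=> /(_ i); rewrite eqxx.
  by move=> h j; case: ifPn => // /eqP ->.
- move=> _ _ [B mB <-] [C mC <-]; exists (fun i => B i `&` C i).
    by move=> i; exact: measurableI.
  apply/seteqP; split => x; first by move=> h; split => i; case: (h i).
  by move=> [h1 h2] i; split; [exact: h1|exact: h2].
- by move=> k; exists (fun=> `[- k%:R, k%:R]%classic).
- apply/seteqP; split => // x _; exists (Num.trunc `|x|).+1 => // i.
  rewrite /= in_itv/= -ler_norml (le_trans (coord_le_norm x i))//.
  exact/ltW/truncnS_gt.
- by move=> B [C mC <-]; exact: m12.
Qed.

Lemma lebesgue_rV_cube_lty n (a b : R) :
  (lebesgue_rV (rect (fun _ : 'I_n => `[a, b]%classic)) < +oo)%E.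
Proof.
rewrite lebesgue_rV_rect//.
rewrite -ge0_fin_numE; last by elim/big_ind : _ => // *; exact: mule_ge0.
elim/big_ind : _ => // [x y|i _]; first exact: fin_numM.
by rewrite lebesgue_measure_itv/=; case: ifPn.
Qed.

Lemma bounded_lebesgue_rV_lty n (A : set 'rV[R]_n) : measurable A ->
  bounded_set A -> (lebesgue_rV A < +oo)%E.
Proof.
move=> mA [M' [_ AM']]; pose M := M' + 1.
have AM x : A x -> `|x| <= M by apply: AM'; rewrite ltrDl.
apply: le_lt_trans (lebesgue_rV_cube_lty n (- M) M).
apply: le_measure; rewrite ?inE//.
  by apply: measurable_rect => i; exact: measurable_itv.
move=> x /AM/= xM i; rewrite /= in_itv/= -ler_norml.
exact: le_trans (coord_le_norm x i) xM.
Qed.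

Lemma open_lebesgue_rV_gt0 n (A : set 'rV[R]_n) : open A -> A !=set0 ->
  (0 < lebesgue_rV A)%E.
Proof.
move=> oA [x Ax]; have /nbhs_ballP[e /= e0 xeA] := oA _ Ax.
pose B i : set R := ball (x ord0 i) e.
have mB i : measurable (B i) by exact: open_measurable (ball_open _ _).
apply: (@lt_le_trans _ _ (lebesgue_rV (rect B))); last first.
  apply: le_measure; rewrite ?inE//; [exact: measurable_rect| |].
    exact: open_measurable_rV.
  by move=> y By; apply: xeA; apply/ball_rV.
rewrite lebesgue_rV_rect//; elim/big_ind : _ => // [y z|i _].
  exact: mule_gt0.
rewrite /B ball_itv lebesgue_measure_itv/= lte_fin ltrD2l gtrN//.
by rewrite -EFinD lte_fin; lra.
Qed.

End rV_measure.
Section graph_chart.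
Context {R : realType}.

(** A reflection is allowed because the graph that describes a boundary may be oriented either
    way. *)
Lemma lebesgue_measure_affine (b : bool) (c : R) (A : set R) : measurable A ->
  lebesgue_measure [set t | A ((-1) ^+ b * (c + t))] = lebesgue_measure A.
Proof.
move=> mA; pose f (t : measurableTypeR R) : measurableTypeR R :=
  (-1) ^+ b * (c + t).
have mf : measurable_fun setT f.
  apply: continuous_measurable_fun => x.
  apply: cvgM; first exact: cvg_cst.
  by apply: cvgD; [exact: cvg_cst|exact: cvg_id].
pose mu := measure_function_pushforward__canonical__measure_function_Measure
    (@lebesgue_measure R) mf.
rewrite (@lebesgue_measure_unique _ mu _ A) => // _ [[a1 a2] _ <-]/=.
rewrite /pushforward /f; case: b f mf @mu => f mf mu.
  (* The reflection turns []a1, a2]] into an interval closed at the other end, of the same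
     length. *)
  rewrite (_ : _ @^-1` _ = `[- a2 - c, - a1 - c[%classic); last first.
    by apply/seteqP; split => x /=; rewrite expr1 !in_itv/= => /andP[h1 h2];
      apply/andP; split; lra.
  rewrite !lebesgue_measure_itv/= !lte_fin.
  rewrite (_ : (- a2 - c < - a1 - c) = (a1 < a2)); last by apply/idP/idP => h; lra.
  by case: ifP => // _; rewrite -!EFinD; congr (_%:E); lra.
rewrite (_ : _ @^-1` _ = `]a1 - c, a2 - c]%classic); last first.
  by apply/seteqP; split => x /=; rewrite expr0 !in_itv/= => /andP[h1 h2];
    apply/andP; split; lra.
rewrite !lebesgue_measure_itv/= !lte_fin.
rewrite (_ : (a1 - c < a2 - c) = (a1 < a2)); last by apply/idP/idP => h; lra.
by case: ifP => // _; rewrite -!EFinD; congr (_%:E); lra.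
Qed.

Variables (n : nat) (i : 'I_n.+1) (b : bool) (gamma : 'rV[R]_n -> R).

(** Graph coordinates: [y] collects all coordinates but the [i]-th, and [t] is the height above the
    graph of [gamma] in the direction chosen by [b]. *)
Definition graph_chart (z : 'rV[R]_n * measurableTypeR R) : 'rV[R]_n.+1 :=
  \row_j (if unlift i j is Some k then z.1 ord0 k
          else (-1) ^+ b * (gamma z.1 + z.2)).

Lemma graph_chart_coord z : graph_chart z ord0 i = (-1) ^+ b * (gamma z.1 + z.2).
Proof. by rewrite mxE unlift_none. Qed.

Lemma graph_chart_lift z k : graph_chart z ord0 (lift i k) = z.1 ord0 k.
Proof. by rewrite mxE liftK. Qed.

Lemma col'_graph_chart z : col' i (graph_chart z) = z.1.
Proof. by apply/rowP => k; rewrite mxE graph_chart_lift. Qed.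

Hypothesis mgamma : measurable_fun setT gamma.

Lemma measurable_graph_chart : measurable_fun setT graph_chart.
Proof.
apply/measurable_fun_rVP => j.
have [k ->|->] := unliftP i j.
  apply: (eq_measurable_fun (fun z : 'rV[R]_n * measurableTypeR R =>
      z.1 ord0 k)) => [z _|]; first by rewrite graph_chart_lift.
  exact: (measurableT_comp (measurable_coord_rV k) measurable_fst).
apply: (eq_measurable_fun (fun z : 'rV[R]_n * measurableTypeR R =>
    (-1) ^+ b * (gamma z.1 + z.2))) => [z _|]; first by rewrite graph_chart_coord.
apply: measurable_funM => //; apply: measurable_funD; last exact: measurable_snd.
exact: (measurableT_comp mgamma measurable_fst).
Qed.

Let lebn : {sigma_finite_measure set 'rV[R]_n -> \bar R} := @lebesgue_rV R n.
Let leb1 : {sigma_finite_measure set (measurableTypeR R) -> \bar R} :=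
  @lebesgue_measure R.

(** The chart is a shear: on the fibre over [y] it acts as a translation, perhaps reflected, and so
    preserves length. Checking boxes is enough. *)
Lemma lebesgue_rV_graph_chart (A : set 'rV[R]_n.+1) : measurable A ->
  lebesgue_rV A = (lebn \x leb1)%E (graph_chart @^-1` A).
Proof.
pose m12 := [the {measure set _ -> \bar R} of (lebn \x leb1)%E].
pose mu := measure_function_pushforward__canonical__measure_function_Measure
    m12 measurable_graph_chart.
apply: (@measure_unique_rV _ _ _ mu) => [{}A mA|k]; last first.
  exact: lebesgue_rV_cube_lty.
rewrite [LHS]lebesgue_rV_rect// (bigD1_ord i)//=.
pose A' k := A (lift i k).
transitivity (\int[lebn]_y
    ((\1_(rect A') y)%:E * lebesgue_measure (A i)))%E; last first.
  apply: eq_integral => y _.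
  rewrite indicE; case: (boolP (y \in rect A')) => yA; rewrite ?mul1e ?mul0e.
    rewrite -(lebesgue_measure_affine b (gamma y))//.
    congr lebesgue_measure; apply/seteqP; split => t /=; rewrite /xsection/= inE.
      move=> h j; have [k ->|->] := unliftP i j.
        by rewrite graph_chart_lift; exact: (set_mem yA).
      by rewrite graph_chart_coord.
    by move=> /(_ i); rewrite graph_chart_coord.
  rewrite /= (_ : xsection _ _ = set0) ?measure0//; apply/seteqP; split => // t.
  rewrite /xsection/= inE => h; move: yA; rewrite notin_setE; apply => k.
  by have := h (lift i k); rewrite graph_chart_lift.
have mA' : measurable (rect A') by apply: measurable_rect => k; exact: mA.
rewrite ge0_integralZr//; last by apply/measurable_EFinP; exact: measurable_indic.
rewrite integral_indic// setIT muleC; congr (_ * _)%E.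
by rewrite /lebn/= lebesgue_rV_rect// => k; exact: mA.
Qed.

Lemma ge0_integral_graph_chart (f : 'rV[R]_n.+1 -> \bar R) :
  measurable_fun setT f -> (forall x, 0 <= f x)%E ->
  (\int[lebesgue_rV (n := n.+1)]_x f x =
   \int[lebn]_y \int[leb1]_t f (graph_chart (y, t)))%E.
Proof.
move=> mf f0; pose m12 := [the {measure set _ -> \bar R} of (lebn \x leb1)%E].
transitivity (\int[pushforward m12 graph_chart]_x f x)%E.
  have := measurable_graph_chart => mg.
  pose mu := measure_function_pushforward__canonical__measure_function_Measure
    m12 mg.
  apply: (@eq_measure_integral _ _ _ _ mu) => A mA _.
  exact: lebesgue_rV_graph_chart.
rewrite ge0_integral_pushforward//; last exact: measurable_graph_chart.
rewrite preimage_setT fubini_tonelli1//; last by move=> z; exact: f0.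
exact: (measurableT_comp mf measurable_graph_chart).
Qed.

Lemma integral_graph_chart (f : 'rV[R]_n.+1 -> \bar R) :
  (lebesgue_rV (n := n.+1)).-integrable setT f ->
  (\int[lebesgue_rV (n := n.+1)]_x f x =
   \int[lebn]_y \int[leb1]_t f (graph_chart (y, t)))%E.
Proof.
move=> /integrableP[mf intf].
pose m12 := [the {measure set _ -> \bar R} of (lebn \x leb1)%E].
have mg := measurable_graph_chart.
have ig : m12.-integrable setT (f \o graph_chart).
  apply/integrableP; split; first exact: (measurableT_comp mf mg).
  move: intf; rewrite ge0_integral_graph_chart//; last first.
    exact: (measurableT_comp (@abse_measurable _ _) mf).
  rewrite (@fubini_tonelli1 _ _ _ _ _ lebn leb1 (abse \o (f \o graph_chart)))//.
    apply: measurableT_comp => //; exact: (measurableT_comp mf mg).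
  by move=> z; exact: abse_ge0.
transitivity (\int[pushforward m12 graph_chart]_x f x)%E.
  pose mu := measure_function_pushforward__canonical__measure_function_Measure
    m12 mg.
  apply: (@eq_measure_integral _ _ _ _ mu) => A mA _.
  exact: lebesgue_rV_graph_chart.
by rewrite integral_pushforward// preimage_setT -integral12_prod_meas1.
Qed.

End graph_chart.

(** * Smooth cut-off functions *)

(** A sign is encoded as any [sg] with [sg * sg = 1], so that one argument covers both raising and
    lowering. *)
Lemma norm_sg {R : realDomainType} (sg z : R) : sg * sg = 1 -> `|sg * z| = `|z|.
Proof.
move=> sg2; apply/eqP; rewrite -(eqrXn2 (n := 2))// -!normrX exprMn expr2 sg2.
by rewrite mul1r.
Qed.

Section flat.
Context {R : realType}.
Implicit Types (t : R) (k : nat).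

(** The functions [t^-k exp(-1/t)], extended by 0, span a space closed under differentiation. Every
    cut-off used below is built from them. *)
Definition flat k t : R := if 0 < t then t^-1 ^+ k * expR (- t^-1) else 0.

Lemma flat_npos k t : t <= 0 -> flat k t = 0.
Proof. by rewrite /flat ltNge => ->. Qed.

Lemma flat_gt0 k t : 0 < t -> 0 < flat k t.
Proof. by rewrite /flat => t0; rewrite t0 mulr_gt0 ?exprn_gt0 ?invr_gt0 ?expR_gt0. Qed.

Lemma flat_ge0 k t : 0 <= flat k t.
Proof. by have [/flat_npos ->//|/flat_gt0/ltW] := leP t 0. Qed.

Lemma flat0_le (s t : R) : s <= t -> flat 0 s <= flat 0 t.
Proof.
move=> st; have [s0|s0] := leP s 0; first by rewrite (flat_npos 0 s0) flat_ge0.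
have t0 := lt_le_trans s0 st.
by rewrite /flat s0 t0 !expr0 !mul1r ler_expR lerN2 lef_pV2.
Qed.

Lemma mulr_flatS k t : t * flat k.+1 t = flat k t.
Proof.
have [t0|t0] := leP t 0; first by rewrite !flat_npos// mulr0.
by rewrite /flat t0 exprS !mulrA divff ?gt_eqF// mul1r.
Qed.

(** One term of the exponential series at [1/t] gives [t^-k <= k! exp(1/t)]. The constants 6 and 4
    in later Lipschitz bounds come from here. *)
Lemma flat_ub k t : flat k t <= k`!%:R.
Proof.
have [t0|t0] := leP t 0; first by rewrite flat_npos.
rewrite /flat t0 expRN ler_pdivrMr ?expR_gt0//.
case: k => [|k].
  by rewrite expr0 fact0 mul1r -expR0 ler_expR invr_ge0 ltW.
have := @expR_ge1Dxn R t^-1 k; rewrite invr_ge0 (ltW t0) => /(_ isT) h.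
rewrite -ler_pdivrMl// mulrC; apply: le_trans h; lra.
Qed.

(** Since [t^2 flat (k+2) t = flat k t], the decay at 0 is at least quadratic; this yields the
    derivative 0 at the origin, where the two formulas meet. *)
Lemma flat_le_sqr k t : flat k t <= (k.+2)`!%:R * t ^+ 2.
Proof.
rewrite -(mulr_flatS k) -(mulr_flatS k.+1) mulrA -expr2 mulrC.
by rewrite ler_wpM2r ?sqr_ge0// flat_ub.
Qed.

Lemma is_derive_le_sqr (f : R -> R) (c : R) :
  (forall t, `|f t| <= c * t ^+ 2) -> is_derive (0 : R) (1 : R) f 0.
Proof.
move=> fc; have f0 : f 0 = 0.
  by apply/eqP; rewrite -normr_le0 (le_trans (fc 0))// expr0n/= mulr0.
suff h : (fun h : R => h^-1 *: (f (h *: 1 + 0) - f 0)) @ 0^' --> (0 : R).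
  by apply: DeriveDef; [exact: cvgP h|exact: (cvg_lim _ h)].
have c0 : 0 <= c by have := fc 1; rewrite expr1n mulr1; exact: le_trans.
apply/cvgrPdist_le => e e0; near=> x.
rewrite sub0r normrN f0 subr0 addr0 /GRing.scale/= mulr1 normrM normfV.
have x0 : x != 0 by near: x; exact: nbhs_dnbhs_neq.
have x0' : 0 < `|x| by rewrite normr_gt0.
rewrite mulrC ler_pdivrMr// (le_trans (fc x))//.
rewrite -[x ^+ 2]real_normK ?num_real// expr2 mulrA ler_wpM2r//.
have : `|x| < e / (c + 1).
  near: x; apply: dnbhs0_lt; rewrite divr_gt0//; lra.
rewrite ltr_pdivlMr; last lra.
rewrite mulrDr mulr1 mulrC; have := normr_ge0 x; lra.
Unshelve. all: by end_near. Qed.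

Lemma is_derive_flat k t :
  is_derive t 1 (flat k) (flat k.+2 t - k%:R * flat k.+1 t).
Proof.
have [t0|t0|->] := ltgtP t 0.
- rewrite !flat_npos ?ltW// mulr0 subr0.
  apply: near_eq_is_derive (is_derive_cst (0 : R) t 1).
  near=> s; rewrite flat_npos// ltW//; near: s; exact: lt_nbhsl.
- have di : is_derive t 1 (fun s : R => s^-1) (- t ^- 2).
    have := @is_deriveV R id t 1 1.
    rewrite gt_eqF// => /(_ isT (is_derive_id _ _)).
    by move=> h; apply: is_derive_eq h _; rewrite /GRing.scale/= mulr1.
  have de : is_derive t 1 (expR \o (fun s : R => - s^-1))
      (expR (- t^-1) * (- (- t ^- 2))).
    apply: is_derive1_comp.
  apply: (@near_eq_is_derive _ _ _
      ((fun s : R => s^-1) ^+ k * (expR \o (fun s : R => - s^-1)))).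
    near=> s; rewrite /flat ifT; last by near: s; exact: lt_nbhsr.
    by rewrite fctE/= exprfctE.
  apply: is_derive_eq; rewrite /flat t0 /GRing.scale/= exprfctE.
  by rewrite -exprVn; case: k => [|k] /=; rewrite ?exprS; ring.
- rewrite !flat_npos// mulr0 subr0.
  apply: (@is_derive_le_sqr _ (k.+2)`!%:R) => s.
  by rewrite ger0_norm ?flat_ge0// flat_le_sqr.
Unshelve. all: by end_near. Qed.

Lemma continuous_flat k : continuous (flat k).
Proof.
move=> t; apply/differentiable_continuous/derivable1_diffP.
by have [] := is_derive_flat k t.
Qed.

(** A smooth substitute for the positive part: it vanishes for [t <= 0], stays below [t] for
    [t >= 0], and its derivative [dramp t = (1 + 1/t) exp(-1/t)] lies in [0, 1]. *)
Definition ramp t : R := t * flat 0 t.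
Definition dramp t : R := flat 0 t + flat 1 t.

Lemma is_derive_ramp t : is_derive t 1 ramp (dramp t).
Proof.
have d0 := is_derive_flat 0 t.
apply: (@is_derive_eq _ _ _ _ _ _ _ _ (is_deriveM (is_derive_id t 1) d0)).
rewrite /GRing.scale/= mul0r subr0 mulr1 mulr_flatS /dramp; lra.
Qed.

Lemma is_derive_dramp t : is_derive t 1 dramp (flat 3 t).
Proof.
have d0 := is_derive_flat 0 t; have d1 := is_derive_flat 1 t.
apply: (@is_derive_eq _ _ _ _ _ _ _ _ (is_deriveD d0 d1)); lra.
Qed.

Lemma dramp_ge0 t : 0 <= dramp t.
Proof. by rewrite addr_ge0// flat_ge0. Qed.

Lemma dramp_npos t : t <= 0 -> dramp t = 0.
Proof. by move=> t0; rewrite /dramp !flat_npos// addr0. Qed.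

(** This is [1 + z <= exp z] at [z = 1/t]. It keeps the weight of [grad C] in [trunc_grad] in
    [0, 1]. *)
Lemma dramp_le1 t : dramp t <= 1.
Proof.
have [/dramp_npos ->//|t0] := leP t 0.
rewrite /dramp /flat t0 expr0 expr1 -mulrDl expRN ler_pdivrMr ?expR_gt0// mul1r.
exact: expR_ge1Dx.
Qed.

(** Quantitative positivity: where the gap is at least [e], an energy weighted by [dramp] controls
    the unweighted one. *)
Lemma dramp_gt0 e t : 0 < e -> e <= t -> expR (- e^-1) <= dramp t.
Proof.
move=> e0 et; have t0 := lt_le_trans e0 et.
rewrite (@le_trans _ _ (flat 0 t))//; last by rewrite lerDl flat_ge0.
by rewrite /flat t0 expr0 mul1r ler_expR lerN2 lef_pV2.
Qed.

Lemma lipschitz_of_derive (f df : R -> R) (c : R) :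
  (forall t, is_derive t 1 f (df t)) -> (forall t, `|df t| <= c) ->
  forall s t, `|f s - f t| <= c * `|s - t|.
Proof.
move=> fdf dfc s t; wlog st : s t / s <= t.
  by move=> h; have [/h//|/ltW/h] := leP s t; rewrite distrC (distrC s).
have [->|sneqt] := eqVneq s t; first by rewrite !subrr normr0 mulr0.
have st' : s < t by rewrite lt_neqAle sneqt.
have [|c' _ E] := MVT st' (fun x _ => fdf x).
  apply: continuous_subspaceT => x.
  by apply/differentiable_continuous/derivable1_diffP; have [] := fdf x.
by rewrite distrC E normrM (distrC s) ler_wpM2r.
Qed.

(** The derivative of [dramp] is [flat 3], bounded by [3! = 6]. *)
Lemma dramp_lipschitz s t : `|dramp s - dramp t| <= 6 * `|s - t|.
Proof.
apply: (lipschitz_of_derive is_derive_dramp) => x.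
by rewrite ger0_norm ?flat_ge0// (le_trans (flat_ub _ _)).
Qed.

Lemma ramp_lipschitz s t : `|ramp s - ramp t| <= `|s - t|.
Proof.
rewrite -[leRHS]mul1r; apply: (lipschitz_of_derive is_derive_ramp) => x.
by rewrite ger0_norm ?dramp_ge0// dramp_le1.
Qed.

Lemma ramp_npos t : t <= 0 -> ramp t = 0.
Proof. by move=> t0; rewrite /ramp flat_npos// mulr0. Qed.

Lemma ramp_ge0 t : 0 <= ramp t.
Proof. by have [/ramp_npos ->//|/ltW t0] := leP t 0; rewrite mulr_ge0 ?flat_ge0. Qed.

Lemma ramp_le t : 0 <= t -> ramp t <= t.
Proof. by move=> t0; rewrite ler_piMr// (le_trans (flat_ub 0 t)). Qed.

Lemma continuous_ramp : continuous ramp.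
Proof.
move=> t; apply/differentiable_continuous/derivable1_diffP.
by have [] := is_derive_ramp t.
Qed.

Lemma continuous_dramp : continuous dramp.
Proof.
move=> t; apply/differentiable_continuous/derivable1_diffP.
by have [] := is_derive_dramp t.
Qed.

End flat.
Lemma continuous_dist_leP {R : realType} {T : topologicalType} (f : T -> R) :
  (forall (x : T) (e : R), 0 < e -> \forall y \near x, `|f x - f y| <= e) -> continuous f.
Proof. by move=> h x; apply/cvgrPdist_le => e e0; exact: h. Qed.

(** * The Euclidean norm *)

Section enorm.
Context {R : realType} {n : nat}.
Implicit Types u v : 'rV[R]_n.

Lemma enorm_ge0 v : 0 <= enorm v.
Proof. exact: sqrtr_ge0. Qed.

Lemma sqr_enorm v : enorm v ^+ 2 = \sum_i v ord0 i ^+ 2.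
Proof. by rewrite sqr_sqrtr// sumr_ge0// => i _; exact: sqr_ge0. Qed.

Lemma coord_le_enorm v i : `|v ord0 i| <= enorm v.
Proof.
rewrite -(ler_pXn2r (n := 2))// ?nnegrE ?enorm_ge0// sqr_enorm.
rewrite real_normK ?num_real// (bigD1 i)//= lerDl sumr_ge0// => j _.
exact: sqr_ge0.
Qed.

Lemma norm_le_enorm v : `|v| <= enorm v.
Proof.
rewrite [leLHS]/Num.Def.normr/= mx_normrE.
by apply/bigmax_leP; split=> [|[i j] _ /=]; rewrite ?enorm_ge0// ord1 coord_le_enorm.
Qed.

Lemma enorm_le_norm v : enorm v <= n%:R * `|v|.
Proof.
rewrite -(ler_pXn2r (n := 2))// ?nnegrE ?enorm_ge0 ?mulr_ge0//.
rewrite sqr_enorm exprMn.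
apply: (@le_trans _ _ (\sum_(i < n) `|v| ^+ 2)).
  apply: ler_sum => i _; rewrite -(real_normK (num_real (v ord0 i))).
  by rewrite ler_pXn2r ?nnegrE// coord_le_norm.
rewrite sumr_const card_ord -[leLHS]mulr_natl ler_wpM2r ?sqr_ge0//.
by rewrite -natrX ler_nat; case: n => // m; rewrite leq_pmulr.
Qed.

Lemma enorm0 : enorm (0 : 'rV[R]_n) = 0.
Proof.
by apply/eqP; rewrite eq_le enorm_ge0 (le_trans (enorm_le_norm _))// normr0 mulr0.
Qed.

Lemma enormZ (c : R) v : enorm (c *: v) = `|c| * enorm v.
Proof.
apply/eqP; rewrite -(eqrXn2 (n := 2))// ?mulr_ge0 ?enorm_ge0//.
rewrite exprMn !sqr_enorm mulr_sumr; apply/eqP; apply: eq_bigr => i _.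
by rewrite mxE exprMn real_normK ?num_real.
Qed.

Lemma enormN v : enorm (- v) = enorm v.
Proof. by rewrite -scaleN1r enormZ normrN1 mul1r. Qed.

Lemma enormB u v : enorm (u - v) = enorm (v - u).
Proof. by rewrite -enormN opprB. Qed.

Lemma cauchy_schwarz u v :
  `|\sum_i u ord0 i * v ord0 i| <= enorm u * enorm v.
Proof.
have [u0|u0] := eqVneq (enorm u) 0.
  rewrite big1 ?normr0 ?mulr_ge0 ?enorm_ge0// => i _.
  have := coord_le_enorm u i; rewrite u0 normr_le0 => /eqP ->; exact: mul0r.
have [v0|v0] := eqVneq (enorm v) 0.
  rewrite big1 ?normr0 ?mulr_ge0 ?enorm_ge0// => i _.
  have := coord_le_enorm v i; rewrite v0 normr_le0 => /eqP ->; exact: mulr0.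
have {u0}u0 : 0 < enorm u by rewrite lt_neqAle eq_sym u0 enorm_ge0.
have {v0}v0 : 0 < enorm v by rewrite lt_neqAle eq_sym v0 enorm_ge0.
set a := enorm u in u0 *; set b := enorm v in v0 *.
apply: (le_trans (ler_norm_sum _ _ _)).
(* Termwise arithmetic-geometric inequality, with weights [b/a] and [a/b] that give both vectors the
   same length. *)
apply: (@le_trans _ _
    (\sum_i (b / a / 2 * u ord0 i ^+ 2 + a / b / 2 * v ord0 i ^+ 2))).
  apply: ler_sum => i _; rewrite normrM.
  rewrite -(real_normK (num_real (u ord0 i))) -(real_normK (num_real (v ord0 i))).
  set x := `|u ord0 i|; set y := `|v ord0 i|.
  rewrite -subr_ge0 (_ : _ - _ = (b * x - a * y) ^+ 2 / (2 * a * b)).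
    by rewrite divr_ge0 ?sqr_ge0// !mulr_ge0// ltW.
  by field; rewrite !gt_eqF.
rewrite big_split/= -!mulr_sumr -!sqr_enorm -/a -/b le_eqVlt; apply/orP; left.
by apply/eqP; field; rewrite !gt_eqF.
Qed.

Lemma ler_enormD u v : enorm (u + v) <= enorm u + enorm v.
Proof.
rewrite -(ler_pXn2r (n := 2))// ?nnegrE ?addr_ge0 ?enorm_ge0//.
rewrite sqr_enorm sqrrD !sqr_enorm.
rewrite (_ : \sum_i _ = \sum_i u ord0 i ^+ 2
    + (\sum_i u ord0 i * v ord0 i) *+ 2 + \sum_i v ord0 i ^+ 2); last first.
  by rewrite -sumrMnl -!big_split/=; apply: eq_bigr => i _; rewrite mxE sqrrD.
rewrite lerD2r lerD2l lerMn2r/=.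
exact: le_trans (ler_norm _) (cauchy_schwarz _ _).
Qed.

Lemma ler_enorm_dist u v : `|enorm u - enorm v| <= enorm (u - v).
Proof.
have h := ler_enormD (u - v) v; have h' := ler_enormD (v - u) u.
move: h h'; rewrite !subrK (enormB v u) ler_norml => h h'; lra.
Qed.

Lemma continuous_dist (x : 'rV[R]_n) :
  continuous (fun y : 'rV[R]_n => enorm (y - x)).
Proof.
apply: continuous_dist_leP => y e e0.
apply/nbhs_ballP; exists (e / (n%:R + 1)); first by rewrite /= divr_gt0.
move=> z; rewrite -ball_normE/= ltr_pdivlMr// => yz.
apply: le_trans (ler_enorm_dist _ _) _; apply: le_trans (enorm_le_norm _) _.
have -> : y - x - (z - x) = y - z by rewrite opprB addrA subrK.
by have := normr_ge0 (y - z); lra.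
Qed.

Definition eball (x : 'rV[R]_n) (r : R) : set 'rV[R]_n :=
  [set y | enorm (y - x) <= r].

Lemma eball_closed x r : closed (eball x r).
Proof.
apply: (@preimage_closed _ _ (fun y : 'rV[R]_n => enorm (y - x)) [set t | t <= r]).
  by move=> y _; exact: continuous_dist.
exact: closed_le.
Qed.

Lemma eball_bounded x r : bounded_set (eball x r).
Proof.
exists (`|x| + r); split; first by rewrite num_real.
move=> M rM y /= yr; rewrite -(subrK x y) (le_trans (ler_normD _ _))//.
by rewrite addrC (le_trans _ (ltW rM))// lerD2l (le_trans (norm_le_enorm _)).
Qed.

Lemma eball_compact x r : compact (eball x r).
Proof. apply: bounded_closed_compact; [exact: eball_bounded|exact: eball_closed]. Qed.

Lemma eball_center x r : 0 <= r -> eball x r x.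
Proof. by rewrite /eball/= subrr enorm0. Qed.

Lemma convex_enorm_powR (p s : R) u v : 1 <= p -> 0 <= s <= 1 ->
  enorm ((1 - s) *: u + s *: v) `^ p <=
  (1 - s) * enorm u `^ p + s * enorm v `^ p.
Proof.
move=> p1 /andP[s0 s1].
have p0 : 0 <= p by rewrite (le_trans ler01).
apply: (@le_trans _ _ (((1 - s) * enorm u + s * enorm v) `^ p)).
  apply: ge0_ler_powR; rewrite ?nnegrE ?enorm_ge0//.
    by rewrite addr_ge0 ?mulr_ge0 ?enorm_ge0 ?subr_ge0.
  rewrite (le_trans (ler_enormD _ _))// !enormZ ger0_norm ?subr_ge0//.
  by rewrite (ger0_norm s0).
have s01 : 0 <= 1 - s <= 1 by apply/andP; split; lra.
have := @convex_powR R p p1 (Itv01 (andP s01).1 (andP s01).2) (enorm u) (enorm v).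
have e0 (w : 'rV[R]_n) : enorm w \in `[0, +oo[%classic 
  by apply: mem_set; rewrite /= in_itv/= andbT; exact: enorm_ge0.
move=> /(_ (e0 u) (e0 v)).
have Es : 1 - (1 - s) = s by lra.
rewrite !convRE/= /unstable.onem Es => h.
by apply: (le_trans _ h); rewrite -[X in _ + X * enorm v]Es; exact: lexx.
Qed.

End enorm.

(** * Closure properties of smooth functions *)

Section smooth_closure.
Context {R : realType} {n : nat}.
Implicit Types (f g : 'rV[R]_n -> R) (x v : 'rV[R]_n).

Lemma is_derive_line f x v b :
  is_derive x v f b <-> is_derive (0 : R) (1 : R) (fun h => f (h *: v + x)) b.
Proof.
have E : (fun h : R => h^-1 *: (f (h *: v + x) - f x)) =
    (fun h : R => h^-1 *: (f ((h *: 1 + 0) *: v + x) - f (0 *: v + x))).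
  by apply/funext => h; rewrite addr0 scale0r add0r [_%:A]mulr1.
split=> -[df <-]; apply: DeriveDef.
- exact: (derivable1P f x v).1.
- by rewrite /derive /= [in RHS]E.
- exact: (derivable1P f x v).2.
- by rewrite /derive /= [in LHS]E.
Qed.

Lemma is_derive_comp_line (h : R -> R) f x v a b :
  is_derive (f x) 1 h a -> is_derive x v f b ->
  is_derive x v (fun y => h (f y)) (a * b).
Proof.
move=> ha /is_derive_line fb; apply/is_derive_line.
apply: (@is_derive1_comp _ h (fun t => f (t *: v + x))).
by rewrite scale0r add0r.
Qed.

Lemma is_derive_coord x v i : is_derive x v (fun y => y ord0 i) (v ord0 i).
Proof.
apply/is_derive_line.
have -> : (fun h : R => (h *: v + x) ord0 i) =
    (fun h => h * v ord0 i + x ord0 i) by apply/funext => h; rewrite !mxE.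
apply: is_derive_eq; rewrite /GRing.scale/=; lra.
Qed.

(** A class of functions stable under partial derivatives. Since it contains all smooth functions
    and consists of continuous ones, a single induction on the order of differentiation shows that
    its members are smooth, and every closure property follows from a constructor. *)
Inductive smooth_expr : ('rV[R]_n -> R) -> Prop :=
| Smooth_base f : smooth f -> smooth_expr f
| Smooth_cst c : smooth_expr (fun=> c)
| Smooth_coord i : smooth_expr (fun x => x ord0 i)
| Smooth_add f g : smooth_expr f -> smooth_expr g ->
    smooth_expr (fun x => f x + g x)
| Smooth_mul f g : smooth_expr f -> smooth_expr g ->
    smooth_expr (fun x => f x * g x)
| Smooth_flat k f : smooth_expr f -> smooth_expr (fun x => flat k (f x))
| Smooth_powR a f : (forall x, 0 < f x) -> smooth_expr f ->
    smooth_expr (fun x => f x `^ a).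

Lemma smooth_expr_continuous f : smooth_expr f -> continuous f.
Proof.
elim=> {f} [f sf|c|i|f g _ cf _ cg|f g _ cf _ cg|k f _ cf|a f f0 _ cf] x.
- exact: (sf 0%N).
- exact: cst_continuous.
- exact: coord_continuous.
- exact: (continuousD (cf x) (cg x)).
- exact: (continuousM (cf x) (cg x)).
- exact: (continuous_comp (cf x) (@continuous_flat _ k _)).
- have cp : {for f x, continuous (@powR R ^~ a)}.
    apply/differentiable_continuous/derivable1_diffP.
    by have [] := is_derive1_powR a (f0 x).
  exact: (continuous_comp (cf x) cp).
Qed.

Lemma smooth_expr_derive f : smooth_expr f -> exists df : 'I_n -> 'rV[R]_n -> R,
  forall i, smooth_expr (df i) /\ forall x, is_derive x 'e_i f (df i x).
Proof.
elim=> {f} [f sf|c|j|f g sf [df hf] sg [dg hg]|f g sf [df hf] sg [dg hg]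
    |k f sf [df hf]|a f f0 sf [df hf]].
- exists (fun i x => 'D_'e_i f x) => i; split.
    by apply: Smooth_base => k; have [_ _ /(_ i)] := sf k.+1.
  by move=> x; apply: derivableP; have [_ /(_ x i)] := sf 1%N.
- by exists (fun _ _ => 0) => i; split; [exact: Smooth_cst|move=> x; exact: is_derive_cst].
- exists (fun i _ => ('e_i : 'rV[R]_n) ord0 j) => i; split; first exact: Smooth_cst.
  by move=> x; exact: is_derive_coord.
- exists (fun i x => df i x + dg i x) => i.
  have [sdf dfE] := hf i; have [sdg dgE] := hg i; split; first exact: Smooth_add.
  by move=> x; exact: is_deriveD.
- exists (fun i x => f x * dg i x + g x * df i x) => i.
  have [sdf dfE] := hf i; have [sdg dgE] := hg i; split.
    by apply: Smooth_add; exact: Smooth_mul.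
  by move=> x; exact: is_deriveM.
- exists (fun i x => (flat k.+2 (f x) + (- k%:R) * flat k.+1 (f x)) * df i x) => i.
  have [sdf dfE] := hf i; split.
    apply: Smooth_mul => //; apply: Smooth_add; first exact: Smooth_flat.
    by apply: Smooth_mul; [exact: Smooth_cst|exact: Smooth_flat].
  move=> x; apply: is_derive_comp_line => //.
  by rewrite mulNr; exact: is_derive_flat.
- exists (fun i x => (a * f x `^ (a - 1)) * df i x) => i.
  have [sdf dfE] := hf i; split.
    apply: Smooth_mul => //; apply: Smooth_mul; first exact: Smooth_cst.
    exact: Smooth_powR.
  by move=> x; exact: (is_derive_comp_line (is_derive1_powR a (f0 x)) (dfE x)).
Qed.

Lemma smooth_of_expr f : smooth_expr f -> smooth f.
Proof.
move=> sf k; elim: k f sf => [|k IH] f sf; first exact: smooth_expr_continuous.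
have [df hf] := smooth_expr_derive sf; split.
- exact: smooth_expr_continuous.
- by move=> x i; have [_ /(_ x)[]] := hf i.
- move=> i; have [sdf dfE] := hf i.
  rewrite (_ : (fun x => _) = df i); first exact: IH.
  by apply/funext => x; have [_ ->] := dfE x.
Qed.

Lemma smooth_derive f i : smooth f -> smooth (fun x => 'D_'e_i f x).
Proof. by move=> sf k; have [_ _ /(_ i)] := sf k.+1. Qed.

Lemma smooth_is_derive f x i : smooth f -> is_derive x 'e_i f ('D_'e_i f x).
Proof. by move=> sf; apply: derivableP; have [_ /(_ x i)] := sf 1%N. Qed.

Lemma smooth_continuous f : smooth f -> continuous f.
Proof. by move=> sf; exact: (sf 0%N). Qed.

Lemma smooth_cst (c : R) : smooth (fun _ : 'rV[R]_n => c).
Proof. by apply: smooth_of_expr; exact: Smooth_cst. Qed.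

Lemma smoothD f g : smooth f -> smooth g -> smooth (fun x => f x + g x).
Proof.
by move=> sf sg; apply: smooth_of_expr; apply: Smooth_add; exact: Smooth_base.
Qed.

Lemma smoothM f g : smooth f -> smooth g -> smooth (fun x => f x * g x).
Proof.
by move=> sf sg; apply: smooth_of_expr; apply: Smooth_mul; exact: Smooth_base.
Qed.

Lemma smoothZ (c : R) f : smooth f -> smooth (fun x => c * f x).
Proof. by move=> sf; apply: smoothM => //; exact: smooth_cst. Qed.

Lemma smoothB f g : smooth f -> smooth g -> smooth (fun x => f x - g x).
Proof.
move=> sf sg; rewrite (_ : (fun _ => _) = (fun x => f x + (-1) * g x)).
  by apply: smoothD => //; exact: smoothZ.
by apply/funext => x; rewrite mulN1r.
Qed.

Lemma smooth_sum (I : Type) (r : seq I) (F : I -> 'rV[R]_n -> R) :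
  (forall i, smooth (F i)) -> smooth (fun x => \sum_(i <- r) F i x).
Proof.
move=> sF; elim: r => [|i r IH].
  rewrite (_ : (fun _ => _) = (fun=> 0)); first exact: smooth_cst.
  by apply/funext => x; rewrite big_nil.
rewrite (_ : (fun _ => _) = (fun x => F i x + \sum_(j <- r) F j x)).
  exact: smoothD.
by apply/funext => x; rewrite big_cons.
Qed.

Lemma smooth_flat k f : smooth f -> smooth (fun x => flat k (f x)).
Proof. by move=> sf; apply: smooth_of_expr; apply: Smooth_flat; exact: Smooth_base. Qed.

Lemma smooth_powR (a : R) f : (forall x, 0 < f x) -> smooth f ->
  smooth (fun x => f x `^ a).
Proof.
by move=> f0 sf; apply: smooth_of_expr; apply: Smooth_powR => //; exact: Smooth_base.
Qed.

Lemma smooth_ramp f : smooth f -> smooth (fun x => ramp (f x)).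
Proof. by move=> sf; apply: smoothM => //; exact: smooth_flat. Qed.

Lemma smooth_dramp f : smooth f -> smooth (fun x => dramp (f x)).
Proof. by move=> sf; apply: smoothD; exact: smooth_flat. Qed.

Lemma sqr_enormB x y :
  enorm (x - y) ^+ 2 = \sum_i (x ord0 i - y ord0 i) ^+ 2.
Proof. by rewrite sqr_enorm; apply: eq_bigr => i _; rewrite !mxE. Qed.

Lemma smooth_sqr_enorm y : smooth (fun x => enorm (x - y) ^+ 2).
Proof.
under eq_fun do rewrite sqr_enormB.
apply: smooth_sum => i; apply: smoothM; apply: smoothB.
- by apply: smooth_of_expr; exact: Smooth_coord.
- exact: smooth_cst.
- by apply: smooth_of_expr; exact: Smooth_coord.
- exact: smooth_cst.
Qed.

Lemma is_derive_sqr_enorm y x v : is_derive x v (fun z => enorm (z - y) ^+ 2)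
  (2 * \sum_i (x ord0 i - y ord0 i) * v ord0 i).
Proof.
under eq_fun do rewrite sqr_enormB.
rewrite (_ : (fun _ => _) =
  \sum_i (fun z : 'rV[R]_n => (z ord0 i - y ord0 i) ^+ 2)); last first.
  by apply/funext => z; rewrite fct_sumE.
rewrite mulr_sumr; apply: is_derive_sum => i.
have h : is_derive x v (fun z : 'rV[R]_n => z ord0 i - y ord0 i) (v ord0 i).
  have := is_deriveB (is_derive_coord x v i) (is_derive_cst (y ord0 i) x v).
  by rewrite subr0.
have := is_deriveM h h; rewrite (_ : _ *: _ + _ = 2 * ((x ord0 i - y ord0 i) * v ord0 i)).
  by apply.
by rewrite /GRing.scale/=; lra.
Qed.

End smooth_closure.

(** * Integration by parts *)

Section integration_by_parts.
Context {R : realType}.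

Lemma is_derive_continuous (F f : R -> R) :
  (forall t : R, is_derive t 1 F (f t)) -> continuous F.
Proof.
move=> Ff t; apply/differentiable_continuous/derivable1_diffP.
by have [] := Ff t.
Qed.

Lemma integral_derive_compact (F f : R -> R) (M : R) : 0 <= M ->
  (forall t : R, is_derive t 1 F (f t)) -> continuous f ->
  (forall t : R, M < `|t| -> F t = 0) -> (forall t : R, M < `|t| -> f t = 0) ->
  (\int[lebesgue_measure]_t (f t)%:E = 0)%E.
Proof.
move=> M0 Ff cf F0 f0.
have cF := is_derive_continuous Ff.
pose D : set R := `[- (M + 1), M + 1]%classic.
transitivity (\int[lebesgue_measure]_(t in D) (f t)%:E)%E.
  rewrite [RHS]integral_mkcond; apply: eq_integral => t _; rewrite patchE.
  case: ifPn => //; rewrite notin_setE /D/= in_itv/= -ler_norml => /negP.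
  by rewrite -ltNge => h; rewrite f0//; lra.
rewrite (@continuous_FTC2 _ f F)//.
- have nM : M < `|M + 1| by rewrite ger0_norm; lra.
  by rewrite !F0 ?normrN// subee.
- lra.
- exact: continuous_subspaceT.
- split.
  + by move=> t _; have [] := Ff t.
  + by apply: cvg_at_right_filter; exact: cF.
  + by apply: cvg_at_left_filter; exact: cF.
- by move=> t _; rewrite derive1E; have [_ ->] := Ff t.
Qed.

Context {n : nat}.
Implicit Types f g : 'rV[R]_n.+1 -> R.
Local Notation leb := (@lebesgue_rV R n.+1).

Lemma cube_compact (m : nat) (M : R) :
  compact (rect (fun _ : 'I_m => `[- M, M]%classic)).
Proof. by apply: rV_compact => _; exact: segment_compact. Qed.

Lemma measurable_cube (m : nat) (a b : R) :
  measurable (rect (fun _ : 'I_m => `[a, b]%classic)).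
Proof. by apply: measurable_rect => i; exact: measurable_itv. Qed.

Lemma cubePn (m : nat) (M : R) (x : 'rV[R]_m) :
  ~ rect (fun _ : 'I_m => `[- M, M]%classic) x -> M < `|x|.
Proof.
move=> /existsNP[i]/=; rewrite in_itv/= -ler_norml => /negP; rewrite -ltNge => h.
exact: lt_le_trans h (coord_le_norm x i).
Qed.

Lemma compact_continuous_bounded (A : set 'rV[R]_n.+1) f : compact A ->
  {within A, continuous f} -> exists2 M : R, 0 < M & forall x, A x -> `|f x| <= M.
Proof.
move=> cA cf.
have /compact_bounded[M [_ hM]] : compact (f @` A) by exact: continuous_compact.
exists (`|M| + 1); first by rewrite ltr_wpDl.
by move=> x Ax; apply: (hM (`|M| + 1)); [rewrite (le_lt_trans (ler_norm _)) ?ltrDl|exists x].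
Qed.

Lemma continuous_measurableT f : continuous f -> measurable_fun setT f.
Proof.
by move=> cf; apply: continuous_measurable_rV => //; exact: continuous_subspaceT.
Qed.

Lemma integrable_compact_support f M : continuous f ->
  (forall x, M < `|x| -> f x = 0) -> leb.-integrable setT (EFin \o f).
Proof.
move=> cf f0; set D := rect (fun _ : 'I_n.+1 => `[- M, M]%classic).
have mD : measurable D by exact: measurable_cube.
suff h : leb.-integrable D (EFin \o f).
  move/(integrable_mkcond _ mD): h; rewrite restrict_EFin.
  rewrite (_ : f \_ D = f)//; apply/funext => x; rewrite patchE.
  by case: ifPn => //; rewrite notin_setE => /cubePn/f0.
apply: measurable_bounded_integrable => //.
- exact: lebesgue_rV_cube_lty.
- by apply: measurable_funTS; exact: continuous_measurableT.
- have [K _ fK] := compact_continuous_bounded (@cube_compact _ M) (continuous_subspaceT cf).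
  exists K; split; first by rewrite num_real.
  by move=> k Kk x /= Dx; rewrite (le_trans (fK _ Dx))// ltW.
Qed.

Lemma derive_out_support f M : (forall x, M < `|x| -> f x = 0) ->
  forall x i, M < `|x| -> 'D_'e_i f x = 0.
Proof.
move=> f0 x i Mx; rewrite -(derive_cst (0 : R) x ('e_i : 'rV[R]_n.+1)).
apply: near_eq_derive; apply/nbhs_ballP.
exists (`|x| - M); first by rewrite /= subr_gt0.
move=> y; rewrite -ball_normE/= => xy; apply: f0.
have := ler_distD y x 0; rewrite !subr0 => h; lra.
Qed.

Lemma integral_derive_rV g M i : smooth g -> (forall x, M < `|x| -> g x = 0) ->
  (\int[leb]_x ('D_'e_i g x)%:E = 0)%E.
Proof.
move=> sg g0; have Dg0 := derive_out_support g0.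
have cD : continuous (fun x => 'D_'e_i g x).
  exact: (smooth_continuous (smooth_derive i sg)).
(* With [gamma = 0] and no reflection, the graph chart is the Fubini splitting whose inner integral
   runs over the [i]-th coordinate. *)
pose gam (_ : 'rV[R]_n) : R := 0.
rewrite (@integral_graph_chart _ _ i false gam)//; last first.
- exact: (integrable_compact_support cD (fun x => @Dg0 x i)).
- exact: measurable_cst.
apply: integral0_eq => y _.
pose c (t : R) := graph_chart i false gam (y, t).
have cE t : c t = t *: 'e_i + c 0.
  apply/rowP => j; rewrite mxE.
  have [k ->|->] := unliftP i j.
    by rewrite !mxE liftK/= eq_sym (negPf (neq_lift _ _)) ?andbF
      mulr0 add0r.
  by rewrite !mxE unlift_none !eqxx/= /gam !add0r mulr0 mulr1 addr0
    expr0 mul1r.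
have ct t : `|t| <= `|c t|.
  apply: le_trans (coord_le_norm _ i); rewrite graph_chart_coord/=.
  by rewrite expr0 mul1r /gam add0r.
have cc : continuous c.
  rewrite (_ : c = fun t => t *: 'e_i + c 0); last exact/funext.
  move=> s; apply: cvgD; last exact: cvg_cst.
  by apply: cvgZr_tmp; exact: cvg_id.
apply: (@integral_derive_compact (g \o c) _ `|M|) => //.
- move=> t; have /is_derive_line := smooth_is_derive (c t) i sg => h.
  have -> : g \o c = (fun s => g (s *: 'e_i + c t)) \o (fun s => s + (- t)).
    apply/funext => s /=; congr g; rewrite cE [in RHS]cE addrA -scalerDl.
    by rewrite subrK.
  rewrite -[X in is_derive _ _ _ X]mulr1; apply: is_derive1_comp.
  + by rewrite subrr.
  + exact: (is_derive_shift t 1 (- t)).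
- by move=> t; exact: (continuous_comp (cc t) (cD _)).
- move=> t Mt; apply: g0; apply: lt_le_trans (ct t).
  exact: le_lt_trans (ler_norm M) Mt.
- move=> t Mt; apply: Dg0; apply: lt_le_trans (ct t).
  exact: le_lt_trans (ler_norm M) Mt.
Qed.

End integration_by_parts.

(** * L^p functions and weak gradients *)

Lemma measurable_norm_EFin d (T : measurableType d) (R : realType) (D : set T)
  (f : T -> R) : measurable_fun D f -> measurable_fun D (fun x => `|f x|%:E).
Proof. by move=> mf; apply/measurable_EFinP; exact: measurableT_comp. Qed.

(** The p-th power of the L^p norm. It tends to 0 exactly when the norm does, and no root has to be
    carried along. *)
Definition pint {R : realType} {n : nat} (Om : set 'rV[R]_n.+1) (p : R)
    (f : 'rV[R]_n.+1 -> R) : \bar R :=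
  (\int[@lebesgue_rV R n.+1]_(x in Om) (`|f x| `^ p)%:E)%E.

Section Lp_estimates.
Context {R : realType} {n : nat}.
Variables (Om : set 'rV[R]_n.+1) (p : R).
Hypotheses (mOm : measurable Om) (fOm : (@lebesgue_rV R n.+1 Om < +oo)%E).
Hypothesis p1 : 1 < p.
Implicit Types f g h : 'rV[R]_n.+1 -> R.
Local Notation leb := (@lebesgue_rV R n.+1).
Local Notation pint := (pint Om p).

Let p0 : 0 <= p. Proof. by rewrite (le_trans ler01)// ltW. Qed.

(** The sum is bounded by twice its larger term. The crude constant is harmless, since it serves
    only to prove finiteness or convergence to 0. *)
Lemma ler_powRD2 (c x y z : R) : 0 <= c -> 0 <= x -> 0 <= y -> 0 <= z ->
  z <= c * (x + y) -> z `^ p <= (2 * c) `^ p * (x `^ p + y `^ p).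
Proof.
move=> c0; wlog xy : x y / x <= y.
  move=> h x0 y0 z0 zc; have [xy|/ltW yx] := leP x y; first exact: h.
  by rewrite addrC; apply: h => //; rewrite addrC.
move=> x0 y0 z0 zc; apply: (@le_trans _ _ ((2 * c * y) `^ p)).
  apply: ge0_ler_powR; rewrite ?nnegrE ?mulr_ge0//.
  apply: (le_trans zc); have : c * (x + y) <= c * (y + y).
      by rewrite ler_wpM2l// lerD2r.
    lra.
by rewrite powRM ?mulr_ge0// ler_wpM2l ?powR_ge0// lerDr powR_ge0.
Qed.

Lemma measurable_pow_norm f : measurable_fun Om f ->
  measurable_fun Om (fun x => (`|f x| `^ p)%:E).
Proof.
move=> mf; apply/measurable_EFinP.
apply: (measurableT_comp (measurable_powR p)).
exact: (measurableT_comp (@normr_measurable _ _)).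
Qed.

Lemma pint_ge0 f : (0 <= pint f)%E.
Proof. by apply: integral_ge0 => x _; rewrite lee_fin powR_ge0. Qed.

Lemma pint_le2 (c : R) f g h : 0 <= c -> measurable_fun Om f ->
  measurable_fun Om g -> measurable_fun Om h ->
  (forall x, Om x -> `|h x| <= c * (`|f x| + `|g x|)) ->
  (pint h <= ((2 * c) `^ p)%:E * (pint f + pint g))%E.
Proof.
move=> c0 mf mg mh hfg.
rewrite -ge0_integralD//; last 2 first.
- exact: measurable_pow_norm.
- exact: measurable_pow_norm.
rewrite -ge0_integralZl//.
- apply: ge0_le_integral => //.
  + exact: measurable_pow_norm.
  + apply: measurable_funeM; apply: emeasurable_funD; exact: measurable_pow_norm.
  + by move=> x Ox; rewrite -EFinD -EFinM lee_fin ler_powRD2// hfg.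
- by apply: emeasurable_funD; exact: measurable_pow_norm.
- by move=> x _; rewrite adde_ge0// lee_fin powR_ge0.
- by rewrite lee_fin powR_ge0.
Qed.

Lemma pint_cst0 : pint (fun=> 0) = 0%E.
Proof.
apply: integral0_eq => x _ /=; rewrite normr0 powR0// gt_eqF//.
exact: lt_trans p1.
Qed.

Lemma pint_le (c : R) f h : 0 <= c -> measurable_fun Om f ->
  measurable_fun Om h -> (forall x, Om x -> `|h x| <= c * `|f x|) ->
  (pint h <= ((2 * c) `^ p)%:E * pint f)%E.
Proof.
move=> c0 mf mh hf; have := @pint_le2 c f (fun=> 0) h c0 mf.
rewrite pint_cst0 adde0; apply => // x Ox; rewrite normr0 addr0; exact: hf.
Qed.

Lemma in_Lp_measurable f : in_Lp p Om f -> measurable_fun Om f.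
Proof. by case. Qed.

Lemma in_Lp_le2 (c : R) f g h : 0 <= c -> in_Lp p Om f -> in_Lp p Om g ->
  measurable_fun Om h ->
  (forall x, Om x -> `|h x| <= c * (`|f x| + `|g x|)) -> in_Lp p Om h.
Proof.
move=> c0 [mf If] [mg Ig] mh hfg; split; first exact: mh.
apply: le_lt_trans (pint_le2 c0 mf mg mh hfg) _.
apply: lte_mul_pinfty; [by rewrite lee_fin powR_ge0|exact: fin_numE|].
exact: (lte_add_pinfty If Ig).
Qed.

Lemma in_Lp0 : in_Lp p Om (fun=> 0).
Proof. split; first exact: measurable_cst.
by have := pint_cst0; rewrite /pint => ->; exact: ltry. Qed.

Lemma in_Lp_le (c : R) f h : 0 <= c -> in_Lp p Om f -> measurable_fun Om h ->
  (forall x, Om x -> `|h x| <= c * `|f x|) -> in_Lp p Om h.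
Proof.
move=> c0 Lf mh hf; apply: (in_Lp_le2 c0 Lf in_Lp0) => // x Ox.
by rewrite normr0 addr0 hf.
Qed.

Lemma in_LpD f g : in_Lp p Om f -> in_Lp p Om g -> in_Lp p Om (fun x => f x + g x).
Proof.
move=> Lf Lg; apply: (@in_Lp_le2 1 f g) => //.
  by apply: measurable_funD; exact: in_Lp_measurable.
by move=> x _; rewrite mul1r ler_normD.
Qed.

Lemma in_LpB f g : in_Lp p Om f -> in_Lp p Om g -> in_Lp p Om (fun x => f x - g x).
Proof.
move=> Lf Lg; apply: (@in_Lp_le2 1 f g) => //.
  by apply: measurable_funB; exact: in_Lp_measurable.
by move=> x _; rewrite mul1r ler_normB.
Qed.

Lemma in_LpM (c : R) f h : in_Lp p Om f -> measurable_fun Om h ->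
  (forall x, Om x -> `|h x| <= c) -> in_Lp p Om (fun x => h x * f x).
Proof.
move=> Lf mh hc; apply: (@in_Lp_le `|c| f) => //.
  by apply: measurable_funM => //; exact: in_Lp_measurable.
move=> x Ox; rewrite normrM ler_wpM2r// (le_trans (hc _ Ox))//; exact: ler_norm.
Qed.

Lemma in_Lp_bounded (c : R) f : measurable_fun Om f ->
  (forall x, Om x -> `|f x| <= c) -> in_Lp p Om f.
Proof.
move=> mf fc; split; first exact: mf.
apply: (@le_lt_trans _ _ (\int[leb]_(x in Om) (cst (`|c| `^ p)%:E x))%E).
  apply: ge0_le_integral => //.
  - exact: measurable_pow_norm.
  - move=> x Ox; rewrite lee_fin ge0_ler_powR ?nnegrE//.
    by rewrite (le_trans (fc _ Ox))// ler_norm.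
by rewrite integral_cst// lte_mul_pinfty// lee_fin powR_ge0.
Qed.

Lemma in_Lp_continuous f : bounded_set Om -> continuous f -> in_Lp p Om f.
Proof.
move=> [M [_ OM]] cf.
have [K _ fK] := compact_continuous_bounded (@cube_compact _ n.+1 (M + 1))
  (continuous_subspaceT cf).
apply: (@in_Lp_bounded K).
  by apply: measurable_funTS; exact: continuous_measurableT.
move=> x Ox; apply: fK => i /=; rewrite in_itv/= -ler_norml.
by apply: le_trans (coord_le_norm x i) _; apply: OM => //; rewrite ltrDl.
Qed.

(* Young's inequality with a free parameter in place of Hoelder's. *)
Lemma young (l x : R) : 0 < l -> 0 <= x -> x <= l + l `^ (1 - p) * x `^ p.
Proof.
move=> l0 x0; have [xl|/ltW lx] := leP x l.
  by rewrite (le_trans xl)// lerDl mulr_ge0 ?powR_ge0.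
apply: (@le_trans _ _ (l `^ (1 - p) * x `^ p)); last by rewrite lerDr ltW.
have x0' : 0 < x by exact: lt_le_trans lx.
rewrite [leLHS](_ : x = x `^ (1 - p) * x `^ p); last first.
  by rewrite -powRD ?subrK ?powRr1// (gt_eqF x0') implybT.
have E : 1 - p = - (p - 1) by rewrite opprB.
rewrite ler_wpM2r ?powR_ge0// E !powRN.
rewrite lef_pV2 ?posrE ?powR_gt0// ge0_ler_powR ?nnegrE ?(ltW l0)//.
by rewrite subr_ge0 ltW.
Qed.

Lemma integral_norm_le (l : R) f : 0 < l -> measurable_fun Om f ->
  (\int[leb]_(x in Om) `|f x|%:E <=
   l%:E * leb Om + (l `^ (1 - p))%:E * pint f)%E.
Proof.
move=> l0 mf.
have -> : (l%:E * leb Om = \int[leb]_(x in Om) cst l%:E x)%E.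
  by rewrite integral_cst.
rewrite -ge0_integralZl//; last 2 first.
- exact: measurable_pow_norm.
- by rewrite lee_fin powR_ge0.
rewrite -ge0_integralD//.
- apply: ge0_le_integral => //.
  + exact: measurable_norm_EFin.
  + apply: emeasurable_funD => //.
    by apply: measurable_funeM; exact: measurable_pow_norm.
  + by move=> x _; rewrite -EFinM -EFinD lee_fin young.
- by move=> x _; rewrite lee_fin ltW.
- by move=> x _; rewrite -EFinM lee_fin mulr_ge0 ?powR_ge0.
- by apply: measurable_funeM; exact: measurable_pow_norm.
Qed.

Lemma in_Lp_integrable f : in_Lp p Om f -> leb.-integrable Om (EFin \o f).
Proof.
move=> [mf If]; apply/integrableP; split; first exact/measurable_EFinP.
apply: le_lt_trans (integral_norm_le ltr01 mf) _.
rewrite powR1 !mul1e; exact: lte_add_pinfty.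
Qed.

Lemma cvge0_le (c : R) (a b : nat -> \bar R) :
  (forall k, (0 <= a k)%E) -> (forall k, (a k <= c%:E * b k)%E) ->
  b k @[k --> \oo] --> 0%E -> a k @[k --> \oo] --> 0%E.
Proof.
move=> a0 ab b0; apply: (@squeeze_cvge _ _ _ _ (fun=> 0%E) a (fun k => c%:E * b k)%E).
- by apply: nearW => k; rewrite a0 ab.
- exact: cvg_cst.
- by rewrite -(mule0 c%:E); exact: cvgeZl.
Qed.

Lemma cvge0P (a : nat -> \bar R) : (forall k, (0 <= a k)%E) ->
  (a k @[k --> \oo] --> 0%E <->
   forall e : R, 0 < e -> \forall k \near \oo, (a k <= e%:E)%E).
Proof.
move=> a0; split=> [/fine_cvgP[afin /cvgrPdist_le ae] e e0|ae].
  have {}ae := ae _ e0; near=> k.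
  have ak : a k \is a fin_num by near: k; exact: afin.
  rewrite -(fineK ak) lee_fin.
  have : `|0 - (fine \o a) k| <= e by near: k; exact: ae.
  by rewrite sub0r normrN/= ger0_norm// fine_ge0.
apply/fine_cvgP; split.
  apply: filterS (ae _ ltr01) => k ak.
  by rewrite ge0_fin_numE// (le_lt_trans ak)// ltry.
apply/cvgrPdist_le => e e0; apply: filterS (ae _ e0) => k ak.
rewrite sub0r normrN/= ger0_norm ?fine_ge0// -lee_fin fineK//.
by rewrite ge0_fin_numE// (le_lt_trans ak)// ltry.
Unshelve. all: by end_near. Qed.

Lemma measurable_tail (c : R) (g : 'rV[R]_n.+1 -> R) : measurable_fun Om g ->
  measurable_fun Om (fun x => (if c < g x then g x else 0)%:E).
Proof.
move=> mg; apply/measurable_EFinP; apply: measurable_fun_if => //.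
- by apply: measurable_fun_ltr => //; exact: measurable_cst.
- by apply: measurable_funS mg => //; exact: subIsetl.
Qed.

Lemma integral_tail (g : 'rV[R]_n.+1 -> R) : measurable_fun Om g ->
  (forall x, 0 <= g x) -> (\int[leb]_(x in Om) (g x)%:E < +oo)%E ->
  (\int[leb]_(x in Om) (if k%:R < g x then g x else 0)%:E)%E @[k --> \oo] --> 0%E.
Proof.
move=> mg g0 Ig.
have mk (k : nat) : measurable_fun Om (fun x => (if k%:R < g x then g x else 0)%:E).
  exact: measurable_tail.
have [] := @dominated_convergence _ _ _ leb Om mOm
  (fun k x => (if k%:R < g x then g x else 0)%:E) (cst 0%E) (EFin \o g).
- exact: mk.
- exact: measurable_cst.
- apply: aeW => x _; apply/cvg_ballP => e e0.
  exists (Num.trunc (g x)).+1 => // k /= kx.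
  rewrite ifF; first exact: ballxx.
  apply/negbTE; rewrite -leNgt (le_trans (ltW (truncnS_gt _)))//.
  by rewrite ler_nat.
- apply/integrableP; split; first exact/measurable_EFinP.
  by under eq_integral do rewrite /= ger0_norm//.
- apply: aeW => x k _ /=; rewrite lee_fin ger0_norm; last by case: ifP.
  by case: ifP.
- by move=> _ _; rewrite integral_cst// mul0e.
Qed.

(** Truncation of [|f|^p] at a level [m]: below it the factor [th k] is controlled by [d k], above
    it [|th k| <= 1] leaves the tail of an integrable function. No pointwise convergent subsequence
    has to be extracted. *)
Lemma pint_mul_cvg0 (L : R) (f : 'rV[R]_n.+1 -> R)
    (th d : nat -> 'rV[R]_n.+1 -> R) : in_Lp p Om f -> 0 <= L ->
  (forall k, measurable_fun Om (th k)) -> (forall k, measurable_fun Om (d k)) ->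
  (forall k x, Om x -> `|th k x| <= 1) ->
  (forall k x, Om x -> `|th k x| <= L * `|d k x|) ->
  (pint (d k)) @[k --> \oo] --> 0%E ->
  (pint (fun x => th k x * f x)) @[k --> \oo] --> 0%E.
Proof.
move=> [mf If] L0 mth md th1 thL d0.
pose g x := `|f x| `^ p.
have mg : measurable_fun Om g by apply/measurable_EFinP; exact: measurable_pow_norm.
have g0 x : 0 <= g x by exact: powR_ge0.
have tail := integral_tail mg g0 If.
have bd k (m : nat) : (pint (fun x => (th k x * f x)%R) <=
    (m%:R * L `^ p)%:E * pint (d k) +
    \int[leb]_(x in Om) (if m%:R < g x then g x else 0)%:E)%E.
  rewrite -ge0_integralZl//; last 2 first.
  - exact: measurable_pow_norm.
  - by rewrite lee_fin mulr_ge0 ?powR_ge0.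
  have mk : measurable_fun Om (fun x => (if m%:R < g x then g x else 0)%:E).
    exact: measurable_tail.
  rewrite -ge0_integralD//; last 3 first.
  - by move=> x _; rewrite -EFinM lee_fin !mulr_ge0 ?powR_ge0.
  - by apply: measurable_funeM; exact: measurable_pow_norm.
  - by move=> x _; rewrite lee_fin; case: ifP.
  apply: ge0_le_integral => //.
  - by apply: measurable_pow_norm; exact: measurable_funM.
  - apply: emeasurable_funD => //.
    by apply: measurable_funeM; exact: measurable_pow_norm.
  - move=> x Ox; rewrite -EFinM -EFinD lee_fin normrM powRM// -/(g x).
    case: ifPn => [_|]; last rewrite -leNgt => gm.
      apply: (@le_trans _ _ (1 * g x)).
        rewrite ler_wpM2r// (@le_trans _ _ (1 `^ p))//; last by rewrite powR1.
        by apply: ge0_ler_powR; rewrite ?nnegrE ?th1.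
      by rewrite mul1r lerDr !mulr_ge0 ?powR_ge0.
    rewrite addr0 [leLHS]mulrC -mulrA; apply: ler_pM; rewrite ?powR_ge0//.
    rewrite -powRM//; apply: ge0_ler_powR; rewrite ?nnegrE ?mulr_ge0//.
    exact: thL.
apply/cvge0P => [k|e e0]; first exact: pint_ge0.
have e2 : 0 < e / 2 by rewrite divr_gt0.
have t0 (m : nat) :
    (0 <= \int[leb]_(x in Om) (if m%:R < g x then g x else 0)%:E)%E.
  by apply: integral_ge0 => x _; rewrite lee_fin; case: ifP.
(* The level [m] is fixed first, from the tail alone; only then is [k] taken large, depending on
   [m]. *)
have [m _ /(_ m (leqnn m))/= tm] := (cvge0P t0).1 tail _ e2.
pose c := m%:R * L `^ p + 1.
have c0 : 0 < c by rewrite ltr_wpDl// mulr_ge0 ?powR_ge0.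
have dk := (cvge0P (fun k => pint_ge0 (d k))).1 d0 _ (divr_gt0 e2 c0).
apply: filterS dk => k dk; apply: le_trans (bd k m) _.
rewrite (splitr e) EFinD; apply: leeD => //.
apply: (@le_trans _ _ (c%:E * (e / 2 / c)%:E)%E).
  apply: lee_pmul => //; rewrite ?lee_fin ?mulr_ge0 ?powR_ge0//.
  - exact: pint_ge0.
  - by rewrite /c lerDl.
by rewrite -EFinM lee_fin mulrC divfK// gt_eqF.
Qed.

Lemma in_LpP f : in_Lp p Om f <-> measurable_fun Om f /\ (pint f < +oo)%E.
Proof. by []. Qed.

End Lp_estimates.

Opaque in_Lp pint lebesgue_rV.
Section weak_gradients.
Context {R : realType} {n : nat}.
Variables (Om : set 'rV[R]_n.+1) (p : R).
Hypotheses (oOm : open Om) (bOm : bounded_set Om) (p1 : 1 < p).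
Implicit Types (f u v phi : 'rV[R]_n.+1 -> R).
Implicit Types G H : 'rV[R]_n.+1 -> 'rV[R]_n.+1.
Local Notation leb := (@lebesgue_rV R n.+1).
Local Notation pint := (pint Om p).

Let mOm : measurable Om. Proof. exact: open_measurable_rV. Qed.
Let fOm : (leb Om < +oo)%E. Proof. exact: bounded_lebesgue_rV_lty. Qed.

Lemma test_function_support phi : test_function Om phi ->
  exists M, forall x, M < `|x| -> phi x = 0.
Proof.
move=> [_ /compact_bounded[M [_ hM]] _]; exists (M + 1) => x Mx.
apply: contrapT => /eqP phix; have M1 : M < M + 1 by rewrite ltrDl.
have := hM _ M1 x (@subset_closure _ [set y | phi y != 0] x phix).
by rewrite /= leNgt Mx.
Qed.

Lemma test_function_out phi x : test_function Om phi -> ~ Om x ->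
  phi x = 0 /\ forall i, 'D_'e_i phi x = 0.
Proof.
move=> [sphi _ suppOm] Ox.
have nx : \forall y \near x, phi y = 0.
  have : (~` closure [set x | phi x != 0]) x by move=> /suppOm.
  have : open (~` closure [set x | phi x != 0]) by apply: closed_openC; exact: closed_closure.
  move=> /[apply]; apply: filterS => y /= h; apply: contrapT => /eqP phiy.
  exact/h/subset_closure.
split; first exact: nbhs_singleton nx.
move=> i; rewrite -(derive_cst (0 : R) x ('e_i : 'rV[R]_n.+1)).
exact: near_eq_derive nx.
Qed.

Lemma bounded_of_support f M : continuous f -> (forall x, M < `|x| -> f x = 0) ->
  exists2 K, 0 < K & forall x, `|f x| <= K.
Proof.
move=> cf f0.
have [K K0 fK] := compact_continuous_bounded (@cube_compact _ n.+1 M)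
  (continuous_subspaceT cf).
exists K => // x; have [/fK//|/cubePn/f0 ->] := pselect (rect (fun=> `[- M, M]%classic) x).
by rewrite normr0 ltW.
Qed.

Lemma test_function_bounded phi i : test_function Om phi ->
  exists2 K, 0 < K & forall x, `|phi x| <= K /\ `|'D_'e_i phi x| <= K.
Proof.
move=> tphi; have [M phi0] := test_function_support tphi; have [sphi _ _] := tphi.
have [K1 K10 h1] := bounded_of_support (smooth_continuous sphi) phi0.
have [K2 K20 h2] := bounded_of_support
  (smooth_continuous (smooth_derive i sphi))
  (fun x => derive_out_support phi0 i (x := x)).
exists (K1 + K2); first exact: addr_gt0.
move=> x; split.
  by rewrite (le_trans (h1 x))// lerDl ltW.
by rewrite (le_trans (h2 x))// lerDr ltW.
Qed.

Lemma smooth_measurable f : smooth f -> measurable_fun Om f.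
Proof.
by move=> sf; apply: measurable_funTS; exact: continuous_measurableT (smooth_continuous sf).
Qed.

Lemma in_Lp_smooth f : smooth f -> in_Lp p Om f.
Proof. by move=> sf; apply: in_Lp_continuous => //; exact: smooth_continuous. Qed.

Lemma in_Lp_test phi f : test_function Om phi -> in_Lp p Om f ->
  in_Lp p Om (fun x => f x * phi x) /\
  forall i, in_Lp p Om (fun x => f x * 'D_'e_i phi x).
Proof.
move=> tphi Lf; have [sphi _ _] := tphi; split=> [|i].
  under eq_fun do rewrite mulrC.
  have [K K0 hK] := test_function_bounded ord0 tphi.
  apply: (@in_LpM _ _ _ _ mOm p1 K) => //; first exact: smooth_measurable.
  by move=> x _; case: (hK x).
under eq_fun do rewrite mulrC.
have [K K0 hK] := test_function_bounded i tphi.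
apply: (@in_LpM _ _ _ _ mOm p1 K) => //.
  exact: smooth_measurable (smooth_derive i sphi).
by move=> x _; case: (hK x).
Qed.

(** The failure of integration by parts as one real number, linear in the pair [(u, G)]; its
    vanishing for all test functions characterises weak gradients without subtracting extended
    reals. *)
Definition weak_defect u G phi i : R :=
  \int[leb]_(x in Om) (u x * 'D_'e_i phi x + G x ord0 i * phi x).

Lemma integrable_defect u G phi i : in_Lp p Om u ->
  (forall i, in_Lp p Om (fun x => G x ord0 i)) -> test_function Om phi ->
  leb.-integrable Om (EFin \o (fun x => u x * 'D_'e_i phi x + G x ord0 i * phi x)).
Proof.
move=> Lu LG tphi; apply: (in_Lp_integrable mOm fOm p1).
exact: (in_LpD mOm p1 ((in_Lp_test tphi Lu).2 i) (in_Lp_test tphi (LG i)).1).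
Qed.

Lemma weak_gradientE u G : in_Lp p Om u ->
  (forall i, in_Lp p Om (fun x => G x ord0 i)) ->
  weak_gradient Om u G <->
  forall phi, test_function Om phi -> forall i, weak_defect u G phi i = 0.
Proof.
move=> Lu LG.
have E phi i : test_function Om phi ->
    (\int[leb]_(x in Om) (u x * 'D_'e_i phi x)%:E =
     - \int[leb]_(x in Om) (G x ord0 i * phi x)%:E)%E <->
    weak_defect u G phi i = 0.
  move=> tphi.
  have I1 := in_Lp_integrable mOm fOm p1 ((in_Lp_test tphi Lu).2 i).
  have I2 := in_Lp_integrable mOm fOm p1 (in_Lp_test tphi (LG i)).1.
  rewrite /weak_defect RintegralD// /Rintegral.
  set a := (\int[leb]_(x in Om) (u x * _)%:E)%E.
  set b := (\int[leb]_(x in Om) (G x ord0 i * _)%:E)%E.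
  have fa : a \is a fin_num := integrable_fin_num mOm I1.
  have fb : b \is a fin_num := integrable_fin_num mOm I2.
  case: a fa => [a||]//; case: b fb => [b||]//= _ _.
  by split=> [[->]|/eqP]; rewrite ?addNr// addr_eq0 => /eqP ->.
by split=> h phi tphi i; apply/E => //; exact: h.
Qed.

(** The defect is the integral of the [i]-th derivative of [f * phi], a smooth function of compact
    support. *)
Lemma weak_gradient_smooth f : smooth f -> weak_gradient Om f (grad f).
Proof.
move=> sf; have Lf := in_Lp_smooth sf.
have LG i : in_Lp p Om (fun x => grad f x ord0 i).
  by under eq_fun do rewrite mxE; exact: in_Lp_smooth (smooth_derive i sf).
apply/(weak_gradientE Lf LG) => phi tphi i; have [sphi _ _] := tphi.
have [M phi0] := test_function_support tphi.
have g0 x : M < `|x| -> f x * phi x = 0 by move=> /phi0 ->; rewrite mulr0.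
rewrite /weak_defect /Rintegral -[RHS]/(fine 0%E).
rewrite -(integral_derive_rV i (smoothM sf sphi) g0).
congr fine; rewrite integral_mkcond; apply: eq_integral => x _.
rewrite patchE mxE.
have dE : 'D_'e_i (fun x => f x * phi x) x = f x * 'D_'e_i phi x + 'D_'e_i f x * phi x.
  have := is_deriveM (smooth_is_derive x i sf) (smooth_is_derive x i sphi).
  by move=> [_ ->]; rewrite /GRing.scale/= [_ * 'D_'e_i f x]mulrC.
rewrite dE; case: ifPn => //; rewrite notin_setE => /(test_function_out tphi)[-> ->].
by rewrite !mulr0 addr0.
Qed.

Lemma Rintegral_normE f : in_Lp p Om f ->
  (\int[leb]_(x in Om) `|f x|%:E)%E = (\int[leb]_(x in Om) `|f x|)%:E.
Proof.
move=> Lf; rewrite /Rintegral fineK//; apply: integrable_fin_num => //.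
exact: integrable_norm (in_Lp_integrable mOm fOm p1 Lf).
Qed.

Lemma Rintegral_norm_le (l : R) f : 0 < l -> in_Lp p Om f ->
  \int[leb]_(x in Om) `|f x| <=
  l * fine (leb Om) + l `^ (1 - p) * fine (pint f).
Proof.
move=> l0 Lf; have [mf If] := (in_LpP Om p f).1 Lf.
have fO : leb Om \is a fin_num by rewrite ge0_fin_numE.
have fI : pint f \is a fin_num by rewrite ge0_fin_numE ?pint_ge0.
have := integral_norm_le mOm p1 l0 mf.
by rewrite -(fineK fO) -(fineK fI) -!EFinM -EFinD Rintegral_normE// lee_fin.
Qed.

Lemma Rintegral_norm_cvg0 (d : nat -> 'rV[R]_n.+1 -> R) :
  (forall k, in_Lp p Om (d k)) -> pint (d k) @[k --> \oo] --> 0%E ->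
  forall e : R, 0 < e -> \forall k \near \oo, \int[leb]_(x in Om) `|d k x| <= e.
Proof.
move=> Ld d0 e e0.
pose V := fine (leb Om); have V0 : 0 <= V by exact: fine_ge0.
pose l := e / 2 / (V + 1).
have l0 : 0 < l by rewrite !divr_gt0// ltr_wpDl.
have lp0 : 0 < l `^ (1 - p) by rewrite powR_gt0.
have e1 : 0 < e / 2 / l `^ (1 - p) by rewrite !divr_gt0.
have := (cvge0P (fun k => pint_ge0 Om p (d k))).1 d0 _ e1.
apply: filterS => k dk.
apply: le_trans (Rintegral_norm_le l0 (Ld k)) _.
have fI : pint (d k) \is a fin_num.
  by rewrite ge0_fin_numE ?pint_ge0// (le_lt_trans dk)// ltry.
move: dk; rewrite -(fineK fI) lee_fin ler_pdivlMr// => dk.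
rewrite [e](splitr e); apply: lerD; last by rewrite mulrC.
rewrite -/V /l mulrAC ler_pdivrMr ?ltr_wpDl//.
by rewrite ler_wpM2l ?lerDl// ltW// divr_gt0.
Qed.

Lemma weak_defect_le u G phi i K : in_Lp p Om u ->
  (forall i, in_Lp p Om (fun x => G x ord0 i)) -> test_function Om phi ->
  (forall x, `|phi x| <= K /\ `|'D_'e_i phi x| <= K) ->
  `|weak_defect u G phi i| <= K * (\int[leb]_(x in Om) `|u x| +
     \int[leb]_(x in Om) `|G x ord0 i|).
Proof.
move=> Lu LG tphi hK.
have Id := integrable_defect i Lu LG tphi.
have Iu := integrable_norm (in_Lp_integrable mOm fOm p1 Lu).
have IG := integrable_norm (in_Lp_integrable mOm fOm p1 (LG i)).
have IuG := integrableD mOm Iu IG.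
apply: le_trans (le_normr_Rintegral mOm Id) _.
rewrite -(RintegralD mOm Iu IG) -(RintegralZl K mOm IuG).
apply: (le_Rintegral mOm (integrable_norm Id) (integrableZl mOm K IuG)) => x _.
have [h1 h2] := hK x.
rewrite mulrDr (le_trans (ler_normD _ _))// !normrM.
by apply: lerD; rewrite [leRHS]mulrC ler_wpM2l.
Qed.

Lemma weak_defectB u G v H phi i : in_Lp p Om u ->
  (forall i, in_Lp p Om (fun x => G x ord0 i)) -> in_Lp p Om v ->
  (forall i, in_Lp p Om (fun x => H x ord0 i)) -> test_function Om phi ->
  weak_defect (fun x => u x - v x) (fun x => G x - H x) phi i =
  weak_defect u G phi i - weak_defect v H phi i.
Proof.
move=> Lu LG Lv LH tphi.
have I1 := integrable_defect i Lu LG tphi.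
have I2 := integrable_defect i Lv LH tphi.
rewrite /weak_defect -(RintegralB mOm I1 I2).
by apply: eq_Rintegral => x _; rewrite !mxE; ring.
Qed.

(** On a set of finite measure L^p convergence implies L^1 convergence, and a test function and its
    derivatives are bounded, so the defect passes to the limit. *)
Lemma weak_gradient_lim (v_ : nat -> 'rV[R]_n.+1 -> R)
    (H_ : nat -> 'rV[R]_n.+1 -> 'rV[R]_n.+1) v H :
  (forall k, in_Lp p Om (v_ k)) ->
  (forall k i, in_Lp p Om (fun x => H_ k x ord0 i)) ->
  in_Lp p Om v -> (forall i, in_Lp p Om (fun x => H x ord0 i)) ->
  (forall k, weak_gradient Om (v_ k) (H_ k)) ->
  pint (fun x => v_ k x - v x) @[k --> \oo] --> 0%E ->
  (forall i, pint (fun x => (H_ k x - H x) ord0 i) @[k --> \oo] --> 0%E) ->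
  weak_gradient Om v H.
Proof.
move=> Lv_ LH_ Lv LH wg vk Hk; apply/(weak_gradientE Lv LH) => phi tphi i.
have [K K0 hK] := test_function_bounded i tphi.
have dv k : in_Lp p Om (fun x => v_ k x - v x) := in_LpB mOm p1 (Lv_ k) Lv.
have dH k j : in_Lp p Om (fun x => (H_ k x - H x) ord0 j).
  by under eq_fun do rewrite !mxE; exact: (in_LpB mOm p1 (LH_ k j) (LH j)).
apply/eqP; rewrite -normr_le0; apply/ler_addgt0Pl => e e0; rewrite addr0.
have e1 : 0 < e / 2 / K by rewrite !divr_gt0.
have c1 := Rintegral_norm_cvg0 dv vk e1.
have c2 := Rintegral_norm_cvg0 (fun k => dH k i) (Hk i) e1.
have : \forall k \near \oo, `|weak_defect v H phi i| <= e.
  apply: filterS2 c1 c2 => k b1 b2.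
  have wk := (weak_gradientE (Lv_ k) (LH_ k)).1 (wg k) phi tphi i.
  have := weak_defect_le (dv k) (dH k) tphi hK.
  rewrite (weak_defectB i (Lv_ k) (LH_ k) Lv LH tphi) wk sub0r normrN.
  move/le_trans; apply.
  rewrite mulrC -ler_pdivlMr// [in leRHS](splitr e) mulrDl.
  exact: lerD.
by move=> [k _ /(_ k (leqnn k))].
Qed.

End weak_gradients.
(* The integral against a set function that need not be a measure, such as an
   outer measure. *)
Section raw_integral.
Context d (T : measurableType d) (R : realType) (mu : set T -> \bar R).
Hypothesis mu0 : mu set0 = 0%E.
Local Open Scope ereal_scope.
Import HBNNSimple.

Let sintegral_raw0 (h : T -> R) : (forall x, h x = 0%R) -> sintegral mu h = 0.
Proof.
move=> h0; rewrite /sintegral fsbig1// => r _.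
have [->|r0] := eqVneq r 0%R; first by rewrite mul0e.
rewrite preimage10 ?mu0 ?mule0// => -[x _].
by rewrite h0 => /eqP; rewrite eq_sym (negPf r0).
Qed.

Let ge0_integral_rawE (D : set T) (f : T -> \bar R) :
  (forall x, D x -> 0 <= f x) ->
  \int[mu]_(x in D) f x = ereal_sup [set sintegral mu h |
    h in [set h : {nnsfun T >-> R} | forall x, (h x)%:E <= (f \_ D) x]].
Proof.
move=> f0; have fD0 x : 0 <= (f \_ D) x.
  by rewrite patchE; case: ifPn => // /set_mem; exact: f0.
rewrite /integral.
have -> : (f \_ D)^\- = cst 0.
  apply/funext => x; rewrite funenegE; apply/max_idPr.
  by rewrite leeNl oppe0; exact: fD0.
have -> : (f \_ D)^\+ = f \_ D.
  by apply/funext => x; rewrite funeposE; apply/max_idPl; exact: fD0.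
rewrite [X in _ - X](_ : _ = 0) ?sube0//.
apply/eqP; rewrite eq_le; apply/andP; split.
  apply/ge_ereal_sup => /= _ [h h0 <-]; rewrite sintegral_raw0// => x.
  by apply/eqP; rewrite eq_le -lee_fin h0/=.
by apply: ereal_sup_ubound; exists nnsfun0 => //; exact: sintegral_raw0.
Qed.

Lemma integral_raw_ge0 (D : set T) (f : T -> \bar R) :
  (forall x, D x -> 0 <= f x) -> 0 <= \int[mu]_(x in D) f x.
Proof.
move=> f0; rewrite ge0_integral_rawE//; apply: ereal_sup_ubound.
exists nnsfun0 => /=; last exact: sintegral_raw0.
by move=> x; rewrite patchE; case: ifPn => // /set_mem; exact: f0.
Qed.

Lemma le_integral_raw (D : set T) (f g : T -> \bar R) :
  (forall x, D x -> 0 <= f x) -> (forall x, D x -> f x <= g x) ->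
  \int[mu]_(x in D) f x <= \int[mu]_(x in D) g x.
Proof.
move=> f0 fg; rewrite !ge0_integral_rawE//; last first.
  by move=> x Dx; exact: le_trans (f0 x Dx) (fg x Dx).
apply: ereal_sup_le => _ [h /= hf <-].
exists h => //= x; apply: le_trans (hf x) _.
by rewrite !patchE; case: ifPn => // /set_mem; exact: fg.
Qed.

(** The integral is a supremum over simple functions below [f], and [c] times the indicator of [E]
    is one of them; additivity of [mu] does not enter. *)
Lemma markov_raw (D E : set T) (c : R) (f : T -> \bar R) :
  measurable E -> E `<=` D -> (0 < c)%R -> (forall x, D x -> 0 <= f x) ->
  (forall x, E x -> c%:E <= f x) -> c%:E * mu E <= \int[mu]_(x in D) f x.
Proof.
move=> mE ED c0 f0 fc; rewrite ge0_integral_rawE//.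
apply: ereal_sup_ubound; exists (scale_nnsfun (indic_nnsfun R mE) (ltW c0)) => /=.
  move=> x; rewrite patchE /=.
  have [xE|xE] := boolP (x \in E).
    rewrite mindicE xE mulr1 mem_set; last exact/ED/set_mem.
    exact/fc/set_mem.
  rewrite mindicE (negPf xE) mulr0; case: ifPn => // /set_mem; exact: f0.
pose g := (cst c \* mindic R mE)%R.
have gE x : g x = if x \in E then c else 0%R.
  by rewrite /g/= mindicE; case: (x \in E); rewrite ?mulr1 ?mulr0.
rewrite -[LHS]/(sintegral mu g) /sintegral -(@fsbig_widen _ _ _ _ [set c])//.
  rewrite fsbig_set1; congr (_ * mu _); apply/seteqP; split => x /=.
    rewrite gE; case: ifPn => [/set_mem//|_ /eqP].
    by rewrite lt_eqF.
  by move=> Ex; rewrite gE mem_set.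
move=> r [_ /= rc].
have [->|r0] := eqVneq r 0%R; first by rewrite mul0e.
rewrite preimage10 ?mu0 ?mule0// => -[x _]; rewrite gE.
by case: ifPn => _ E0; [exact: rc|move/eqP: r0; exact].
Qed.

End raw_integral.

Lemma cvge0_poweR {R : realType} (a : nat -> \bar R) (q : R) : 0 < q ->
  (forall k, (0 <= a k)%E) ->
  (a k `^ q)%E @[k --> \oo] --> 0%E <-> a k @[k --> \oo] --> 0%E.
Proof.
move=> q0 a0.
have aq0 k : (0 <= a k `^ q)%E by exact: poweR_ge0.
have h (r : R) (x y : \bar R) : 0 < r -> (0 <= x)%E -> (x <= y)%E -> (x `^ r <= y `^ r)%E.
  move=> r0 x0 xy; apply: gt0_ler_poweR => //; first exact: ltW.
  - by rewrite in_itv/= x0 leey.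
  - by rewrite in_itv/= (le_trans x0)// leey.
split=> [/(cvge0P aq0) ae|/(cvge0P a0) ae].
  apply/(cvge0P a0) => e e0; have := ae _ (powR_gt0 q e0).
  apply: filterS => k ak; rewrite -(poweRe1 (a0 k)) -(divff (lt0r_neq0 q0)).
  rewrite poweRrM (le_trans (h q^-1 _ _ _ (poweR_ge0 _ _) ak)) ?invr_gt0//.
  by rewrite poweR_EFin -powRrM divff ?gt_eqF// powRr1// ltW.
apply/(cvge0P aq0) => e e0; have := ae _ (powR_gt0 q^-1 e0).
apply: filterS => k ak; apply: le_trans (h q _ _ q0 (a0 k) ak) _.
by rewrite poweR_EFin -powRrM mulVf ?gt_eqF// powRr1// ltW.
Qed.

(** * Elementary facts on Hausdorff measure *)

Section hausdorff_measure.
Context {R : realType} {n : nat}.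
Local Open Scope ereal_scope.
Implicit Types A : set 'rV[R]_n.

Lemma ediam_ge0 A : A !=set0 -> 0 <= ediam A.
Proof.
move=> [x Ax]; apply: ereal_sup_ubound; exists (x, x) => //=.
by rewrite subrr enorm0.
Qed.

Lemma hausdorff_gauge_ge0 (s : nat) A : 0 <= hausdorff_gauge s A.
Proof.
rewrite /hausdorff_gauge; case: ifPn => // /set0P A0.
by rewrite expe_ge0// ediam_ge0.
Qed.

Lemma hausdorff_content_ge0 (s : nat) (delta : R) A :
  0 <= hausdorff_content s delta A.
Proof.
apply: le_ereal_inf_tmp => _ [U _ <-].
by apply: nneseries_ge0 => k _ _; exact: hausdorff_gauge_ge0.
Qed.

Lemma hausdorff_set0 (s : nat) : hausdorff s (set0 : set 'rV[R]_n) = 0.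
Proof.
have H0 (delta : R) : (0 < delta)%R ->
    hausdorff_content s delta (set0 : set 'rV[R]_n) = 0.
  move=> d0; apply/eqP; rewrite eq_le hausdorff_content_ge0 andbT.
  apply: ereal_inf_lbound; exists (fun=> set0).
    (* The empty set has diameter [-oo], hence is admissible in a cover at any scale, and its gauge
       is 0 by convention. *)
    split=> // k; rewrite /ediam (_ : [set _ | _ in _] = set0) ?ereal_sup0 ?leNye//.
    by apply/seteqP; split => // r [z []].
  by apply: eseries0 => k _ _; rewrite /hausdorff_gauge eqxx.
rewrite /hausdorff (_ : [set _ | _ in _] = [set 0]) ?ereal_sup1//.
apply/seteqP; split => [_ [d /= d0 <-]|_ ->]; first by rewrite /= H0.
by exists 1%R => /=; rewrite ?H0.
Qed.

End hausdorff_measure.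

(** * Energy comparison with a truncation *)

Lemma cvge0D {R : realType} (a b : nat -> \bar R) :
  a k @[k --> \oo] --> 0%E -> b k @[k --> \oo] --> 0%E ->
  (a k + b k)%E @[k --> \oo] --> 0%E.
Proof. by move=> ha hb; rewrite -(adde0 0%E); apply: cvgeD. Qed.

Section truncation.
Context {R : realType} {n : nat}.
Implicit Types (u phi C : 'rV[R]_n.+1 -> R) (G : 'rV[R]_n.+1 -> 'rV[R]_n.+1).

(* For sg = 1 (resp. -1), u is moved towards C on the set where it lies above
   (resp. below) C, by a smooth function of the gap. *)
Definition trunc C (sg s : R) u (x : 'rV[R]_n.+1) : R :=
  u x - sg * (s * ramp (sg * (u x - C x))).

Definition trunc_grad C (sg s : R) u G (x : 'rV[R]_n.+1) : 'rV[R]_n.+1 :=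
  (1 - s * dramp (sg * (u x - C x))) *: G x +
  (s * dramp (sg * (u x - C x))) *: grad C x.

Variables (C : 'rV[R]_n.+1 -> R) (sg s : R).
Hypotheses (sC : smooth C) (sg2 : sg * sg = 1) (s01 : 0 <= s <= 1).

Lemma smooth_trunc phi : smooth phi -> smooth (trunc C sg s phi).
Proof.
move=> sphi; apply: smoothB => //; apply: smoothZ; apply: smoothZ.
by apply: smooth_ramp; apply: smoothZ; exact: smoothB.
Qed.

Lemma grad_trunc phi x : smooth phi ->
  grad (trunc C sg s phi) x = trunc_grad C sg s phi (grad phi) x.
Proof.
move=> sphi; apply/rowP => i; rewrite !mxE.
have d0 := smooth_is_derive x i sphi.
have d1 := is_deriveB d0 (smooth_is_derive x i sC).
have d2 := is_deriveM (is_derive_cst sg x 'e_i) d1.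
have d3 := is_derive_comp_line (is_derive_ramp _) d2.
have d4 := is_deriveM (is_derive_cst (sg * s) x 'e_i) d3.
have [_] := is_deriveB d0 d4.
rewrite (_ : _ - _ = trunc C sg s phi); last first.
  by apply/funext => y; rewrite /trunc mulrA.
move=> ->; rewrite /GRing.scale/=.
rewrite -[(cst sg * (phi - C)) x]/(sg * (phi x - C x)).
set t := dramp _; set a := 'D__ phi x; set c := 'D__ C x.
transitivity (a - sg * sg * (s * t * (a - c))); first by ring.
by rewrite sg2; ring.
Qed.

Lemma trunc_lipschitz u phi x :
  `|trunc C sg s u x - trunc C sg s phi x| <= 2 * `|u x - phi x|.
Proof.
have [s0 s1] := andP s01.
rewrite /trunc (_ : _ - _ = (u x - phi x) -
  sg * (s * (ramp (sg * (u x - C x)) - ramp (sg * (phi x - C x))))); last by ring.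
rewrite (le_trans (ler_normB _ _))// mulrDl mul1r lerD2l norm_sg// normrM.
rewrite ger0_norm// (le_trans (ler_piMl _ s1))//.
apply: le_trans (ramp_lipschitz _ _) _.
by rewrite -mulrBr norm_sg// opprB addrA subrK.
Qed.

(** The value [c] lies on the far side of [C], and [ramp t <= t] keeps the truncation from
    overshooting [C]; so the move only brings [u] closer to [c]. With [c] a boundary value this
    preserves traces, and with [c = C x] it gives integrability. *)
Lemma trunc_le u (c : R) x : 0 <= sg * (C x - c) ->
  `|trunc C sg s u x - c| <= `|u x - c|.
Proof.
have [s0 s1] := andP s01.
move=> Cc; rewrite /trunc; set t := sg * (u x - C x).
have [t0|t0] := leP t 0; first by rewrite ramp_npos// !mulr0 subr0.
have st : 0 <= s * ramp t <= t.
  rewrite mulr_ge0 ?ramp_ge0//= (le_trans (_ : _ <= 1 * t))//; last by rewrite mul1r.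
  by apply: ler_pM => //; [exact: ramp_ge0|apply: ramp_le; exact: ltW].
have [r0 rt] := andP st; set r := s * ramp t in r0 rt *.
rewrite -[leLHS](norm_sg _ sg2) -[leRHS](norm_sg _ sg2).
have -> : sg * (u x - sg * r - c) = t - r + sg * (C x - c).
  by rewrite /t -[X in _ = _ - X + _]mul1r -sg2; ring.
have -> : sg * (u x - c) = t + sg * (C x - c) by rewrite /t; ring.
rewrite !ger0_norm; lra.
Qed.

Variables (Om : set 'rV[R]_n.+1) (p : R).
Hypotheses (oOm : open Om) (bOm : bounded_set Om) (p1 : 1 < p).
Local Notation leb := (@lebesgue_rV R n.+1).
Local Notation pint := (pint Om p).

Let mOm : measurable Om. Proof. exact: open_measurable_rV. Qed.
Let fOm : (leb Om < +oo)%E. Proof. exact: bounded_lebesgue_rV_lty. Qed.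
Let mC : measurable_fun Om C. Proof. exact: smooth_measurable. Qed.

Lemma measurable_gap u : measurable_fun Om u ->
  measurable_fun Om (fun x => sg * (u x - C x)).
Proof. by move=> mu; apply: measurable_funM => //; exact: measurable_funB. Qed.

Lemma measurable_dramp_gap u : measurable_fun Om u ->
  measurable_fun Om (fun x => dramp (sg * (u x - C x))).
Proof.
move=> mu; apply: (measurableT_comp _ (measurable_gap mu)).
by apply: continuous_measurable_fun; exact: continuous_dramp.
Qed.

Lemma measurable_trunc u : measurable_fun Om u -> measurable_fun Om (trunc C sg s u).
Proof.
move=> mu; apply: measurable_funB => //; apply: measurable_funM => //.
apply: measurable_funM => //; apply: (measurableT_comp _ (measurable_gap mu)).
by apply: continuous_measurable_fun; exact: continuous_ramp.
Qed.

Lemma in_Lp_trunc u : in_Lp p Om u -> in_Lp p Om (trunc C sg s u).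
Proof.
move=> Lu; have [mu _] := (in_LpP Om p u).1 Lu.
have LC := in_Lp_smooth oOm bOm p1 sC.
apply: (in_Lp_le2 mOm p1 (ler0n _ 2) Lu LC (measurable_trunc mu)) => x _.
have Cx : 0 <= sg * (C x - C x) by rewrite subrr mulr0.
have h := trunc_le u Cx; have h2 := ler_normB (u x) (C x).
have := ler_normD (trunc C sg s u x - C x) (C x); rewrite subrK => h3.
have := normr_ge0 (u x); lra.
Qed.

Lemma sdramp01 (t : R) : 0 <= s * dramp t <= 1.
Proof.
have [s0 s1] := andP s01.
by rewrite mulr_ge0 ?dramp_ge0//= mulr_ile1// ?dramp_ge0 ?dramp_le1.
Qed.

Lemma in_Lp_trunc_grad u G : measurable_fun Om u ->
  (forall i, in_Lp p Om (fun x => G x ord0 i)) ->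
  forall i, in_Lp p Om (fun x => trunc_grad C sg s u G x ord0 i).
Proof.
move=> mu LG i.
have mth : measurable_fun Om (fun x => s * dramp (sg * (u x - C x))).
  by apply: measurable_funM => //; exact: measurable_dramp_gap.
under eq_fun do rewrite !mxE.
apply: (in_LpD mOm p1).
  apply: (in_LpM mOm p1 (c := 1) (LG i)); first exact: measurable_funB.
  by move=> x _; have := sdramp01 (sg * (u x - C x)); rewrite ler_norml; lra.
apply: (in_LpM mOm p1 (c := 1) (in_Lp_smooth oOm bOm p1 (smooth_derive i sC))) => //.
by move=> x _; have := sdramp01 (sg * (u x - C x)); rewrite ler_norml; lra.
Qed.

Lemma in_Lp_sum (I : Type) (r : seq I) (F : I -> 'rV[R]_n.+1 -> R) :
  (forall i, in_Lp p Om (F i)) -> in_Lp p Om (fun x => \sum_(i <- r) F i x).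
Proof.
move=> LF; elim: r => [|i r IH].
  by under eq_fun do rewrite big_nil; exact: in_Lp0.
by under eq_fun do rewrite big_cons; exact: (in_LpD mOm p1 (LF i) IH).
Qed.

Lemma measurable_enorm G : (forall i, measurable_fun Om (fun x => G x ord0 i)) ->
  measurable_fun Om (fun x => enorm (G x)).
Proof.
move=> mG; apply: (@measurableT_comp _ _ _ _ _ _ (@Num.sqrt R)).
  by apply: continuous_measurable_fun; exact: sqrt_continuous.
by apply: measurable_sum => i; exact: measurable_funX.
Qed.

Lemma in_Lp_enorm G : (forall i, in_Lp p Om (fun x => G x ord0 i)) ->
  in_Lp p Om (fun x => enorm (G x)).
Proof.
move=> LG; have mG i := in_Lp_measurable (LG i).
have LS : in_Lp p Om (fun x => \sum_i `|G x ord0 i|).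
  apply: in_Lp_sum => i; apply: (in_Lp_le mOm p1 ler01 (LG i)).
    by apply: measurableT_comp => //; exact: mG.
  by move=> x _; rewrite normr_id mul1r.
apply: (in_Lp_le mOm p1 (ler0n _ n.+1) LS (measurable_enorm mG)) => x _.
rewrite ger0_norm ?enorm_ge0// (le_trans (enorm_le_norm _))// ler_wpM2l//.
rewrite ger0_norm; last by apply: sumr_ge0.
rewrite [leLHS]/Num.Def.normr/= mx_normrE.
apply/bigmax_leP; split=> [|[a i] _ /=]; first exact: sumr_ge0.
by rewrite ord1 (bigD1 i)//= lerDl sumr_ge0.
Qed.

Lemma dirichlet_energyE G :
  dirichlet_energy p Om G = pint (fun x => enorm (G x)).
Proof.
rewrite /dirichlet_energy; apply: eq_integral => x _ /=.
by rewrite ger0_norm// enorm_ge0.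
Qed.

Lemma sobolev_norm_cvg0P (v : nat -> 'rV[R]_n.+1 -> R)
    (H : nat -> 'rV[R]_n.+1 -> 'rV[R]_n.+1) :
  sobolev_norm p Om (v k) (H k) @[k --> \oo] --> 0%E <->
  pint (v k) @[k --> \oo] --> 0%E /\
  pint (fun x => enorm (H k x)) @[k --> \oo] --> 0%E.
Proof.
have p0 : 0 < p^-1 by rewrite invr_gt0 (lt_trans ltr01).
pose a k := (pint (v k) + pint (fun x => enorm (H k x)))%E.
have a0 k : (0 <= a k)%E by rewrite adde_ge0// pint_ge0.
have -> : (fun k => sobolev_norm p Om (v k) (H k)) = (fun k => a k `^ p^-1)%E.
  by apply/funext => k; rewrite /sobolev_norm dirichlet_energyE.
rewrite (cvge0_poweR p0 a0); split=> [h|[h1 h2]].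
  split.
    apply: (@cvge0_le R 1 _ a) => [k|k|//]; first exact: pint_ge0.
    by rewrite mul1e leeDl// pint_ge0.
  apply: (@cvge0_le R 1 _ a) => [k|k|//]; first exact: pint_ge0.
  by rewrite mul1e leeDr// pint_ge0.
exact: cvge0D h1 h2.
Qed.

Variables (u : 'rV[R]_n.+1 -> R) (G' : 'rV[R]_n.+1 -> 'rV[R]_n.+1).
Variable phi : nat -> 'rV[R]_n.+1 -> R.
Hypotheses (uG' : sobolev_grad p Om u G') (sphi : forall k, smooth (phi k)).
Hypothesis phiu : pint (fun x => phi k x - u x) @[k --> \oo] --> 0%E.
Hypothesis gphiu : pint (fun x => enorm (grad (phi k) x - G' x)) @[k --> \oo] --> 0%E.

Let Lu : in_Lp p Om u. Proof. by have [L _ _] := uG'; exact: L. Qed.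
Let mu : measurable_fun Om u. Proof. exact: in_Lp_measurable Lu. Qed.
Let LG' i : in_Lp p Om (fun x => G' x ord0 i).
Proof. by have [_ L _] := uG'; exact: L. Qed.
Let Lphi k : in_Lp p Om (phi k).
Proof. exact: (in_Lp_smooth oOm bOm p1 (sphi k)). Qed.
Let mphi k : measurable_fun Om (phi k).
Proof. exact: smooth_measurable (sphi k). Qed.
Let Lgphi k i : in_Lp p Om (fun x => grad (phi k) x ord0 i).
Proof.
under eq_fun do rewrite mxE.
exact: (in_Lp_smooth oOm bOm p1 (smooth_derive i (sphi k))).
Qed.

Let th k x := s * dramp (sg * (phi k x - C x)).
Let th0 x := s * dramp (sg * (u x - C x)).

Let mthB k : measurable_fun Om (fun x => th0 x - th k x).
Proof.
apply: measurable_funB; apply: measurable_funM => //; exact: measurable_dramp_gap.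
Qed.

Let thB_le1 k x : `|th0 x - th k x| <= 1.
Proof.
rewrite /th0 /th; have := sdramp01 (sg * (u x - C x)).
have := sdramp01 (sg * (phi k x - C x)); rewrite ler_norml; lra.
Qed.

Let thB_le k x : `|th0 x - th k x| <= 6 * `|phi k x - u x|.
Proof.
have [s0 s1] := andP s01.
rewrite /th0 /th -mulrBr normrM ger0_norm//.
apply: (@le_trans _ _ (1 * `|dramp (sg * (u x - C x)) - dramp (sg * (phi k x - C x))|)).
  by rewrite ler_wpM2r.
rewrite mul1r (le_trans (dramp_lipschitz _ _))// ler_wpM2l//.
by rewrite -mulrBr norm_sg// opprB addrA subrK distrC.
Qed.

Let mB k : measurable_fun Om (fun x => phi k x - u x).
Proof. exact: measurable_funB. Qed.

Let pint_thB (f : 'rV[R]_n.+1 -> R) : in_Lp p Om f ->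
  pint (fun x => (th0 x - th k x) * f x) @[k --> \oo] --> 0%E.
Proof.
move=> Lf; apply: (pint_mul_cvg0 mOm p1 Lf (ler0n _ 6) mthB mB _ _ phiu).
- by move=> k x _; exact: thB_le1.
- by move=> k x _; exact: thB_le.
Qed.

Lemma pint_trunc_cvg :
  pint (fun x => trunc C sg s (phi k) x - trunc C sg s u x) @[k --> \oo] --> 0%E.
Proof.
apply: (cvge0_le _ _ phiu) => k; first exact: pint_ge0.
apply: (pint_le mOm p1 (ler0n _ 2) (mB k)).
  by apply: measurable_funB; exact: measurable_trunc.
by move=> x _; exact: trunc_lipschitz.
Qed.

(** The difference is [(1 - th k) (grad phi_k - G') + (th0 - th k) (G' - grad C)]. The first term is
    small by hypothesis; the second is a fixed L^p function times a factor bounded by 1 and by a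
    multiple of [|phi_k - u|]. *)
Lemma pint_trunc_grad_cvg :
  pint (fun x => enorm (grad (trunc C sg s (phi k)) x - trunc_grad C sg s u G' x))
    @[k --> \oo] --> 0%E.
Proof.
have LGC i : in_Lp p Om (fun x => (G' x - grad C x) ord0 i).
  under eq_fun do rewrite !mxE.
  exact: (in_LpB mOm p1 (LG' i) (in_Lp_smooth oOm bOm p1 (smooth_derive i sC))).
have c1 := pint_thB (in_Lp_enorm LGC).
have Ld k i : in_Lp p Om (fun x => (grad (phi k) x - G' x) ord0 i).
  under eq_fun do rewrite mxE [X in _ + X]mxE.
  exact: (in_LpB mOm p1 (Lgphi k i) (LG' i)).
have m1 k : measurable_fun Om (fun x => enorm (grad (phi k) x - G' x)).
  by apply: measurable_enorm => i; exact: in_Lp_measurable (Ld k i).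
have m2 k : measurable_fun Om (fun x => (th0 x - th k x) * enorm (G' x - grad C x)).
  apply: measurable_funM => //.
  by apply: measurable_enorm => i; exact: in_Lp_measurable (LGC i).
have c12 := cvge0D gphiu c1.
apply: (cvge0_le _ _ c12) => k; first exact: pint_ge0.
apply: (pint_le2 mOm p1 ler01 (m1 k) (m2 k)).
  apply: measurable_enorm => i; under eq_fun do rewrite mxE [X in _ + X]mxE.
  apply: measurable_funB.
    under eq_fun do rewrite grad_trunc//.
    exact: (in_Lp_measurable (in_Lp_trunc_grad (mphi k) (Lgphi k) i)).
  exact: (in_Lp_measurable (in_Lp_trunc_grad mu LG' i)).
move=> x _; rewrite mul1r grad_trunc// ger0_norm ?enorm_ge0//.
rewrite [`|enorm _|]ger0_norm ?enorm_ge0//.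
rewrite (_ : _ - _ = (1 - th k x) *: (grad (phi k) x - G' x) +
    (th0 x - th k x) *: (G' x - grad C x)); last first.
  by apply/rowP => i; rewrite !mxE -/(th k x) -/(th0 x); ring.
rewrite (le_trans (ler_enormD _ _))// !enormZ; apply: lerD.
  apply: ler_piMl; rewrite ?enorm_ge0//.
  by have := sdramp01 (sg * (phi k x - C x)); rewrite -/(th k x) ler_norml; lra.
by rewrite [leRHS]normrM (ger0_norm (enorm_ge0 _)).
Qed.

(** The gradient [G] may be another representative than the limit [G'] of the [grad phi_k], and no
    uniqueness of weak gradients is invoked. Instead [(1 - th k) (G - G')] is added to the gradient
    of the truncated [phi_k]. The sum is still a weak gradient, because [1 - th k] times a test
    function is a test function and [G], [G'] give equal integrals against it. *)
Lemma sobolev_grad_trunc G : sobolev_grad p Om u G ->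
  sobolev_grad p Om (trunc C sg s u) (trunc_grad C sg s u G).
Proof.
move=> [_ LG wG].
have Lv := in_Lp_trunc Lu; have LH := in_Lp_trunc_grad mu LG.
split=> //.
pose H k x := grad (trunc C sg s (phi k)) x + (1 - th k x) *: (G x - G' x).
have LGG i : in_Lp p Om (fun x => (G x - G' x) ord0 i).
  by under eq_fun do rewrite !mxE; exact: (in_LpB mOm p1 (LG i) (LG' i)).
have s1th k : smooth (fun x => 1 - th k x).
  apply: smoothB; first exact: smooth_cst.
  apply: smoothZ; apply: smooth_dramp; apply: smoothZ; exact: smoothB.
have LHk k i : in_Lp p Om (fun x => H k x ord0 i).
  under eq_fun do rewrite /H mxE [X in X + _]mxE [X in _ + X]mxE.
  apply: (in_LpD mOm p1).
    exact: (in_Lp_smooth oOm bOm p1 (smooth_derive i (smooth_trunc (sphi k)))).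
  apply: (in_LpM mOm p1 (c := 1) (LGG i)); first exact: smooth_measurable.
  move=> x _; have := sdramp01 (sg * (phi k x - C x)).
  by rewrite -/(th k x) ler_norml; lra.
have Lvk k := in_Lp_trunc (Lphi k).
apply: (weak_gradient_lim oOm bOm p1 Lvk LHk Lv LH).
- move=> k; apply/(weak_gradientE oOm bOm p1 (Lvk k) (LHk k)) => f tf i.
  have tf' : test_function Om (fun x => (1 - th k x) * f x).
    have [sf cf fO] := tf.
    have sub : closure [set x | (1 - th k x) * f x != 0] `<=` closure [set x | f x != 0].
      apply: closure_subset => x /=; apply: contra_neq => ->.
      by rewrite mulr0.
    split; first exact: smoothM.
      by apply: subclosed_compact cf sub; exact: closed_closure.
    by move=> x /sub/fO.
  pose Z x := (1 - th k x) *: (G' x - G x).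
  have LGG' j : in_Lp p Om (fun x => (G' x - G x) ord0 j).
    under eq_fun do rewrite mxE [X in _ + X]mxE.
    exact: (in_LpB mOm p1 (LG' j) (LG j)).
  have LZ j : in_Lp p Om (fun x => Z x ord0 j).
    under eq_fun do rewrite /Z mxE.
    apply: (in_LpM mOm p1 (c := 1) (LGG' j)); first exact: smooth_measurable (s1th k).
    move=> x _; have := sdramp01 (sg * (phi k x - C x)).
    by rewrite -/(th k x) ler_norml; lra.
  have Lgv j : in_Lp p Om (fun x => grad (trunc C sg s (phi k)) x ord0 j).
    under eq_fun do rewrite mxE.
    exact: (in_Lp_smooth oOm bOm p1 (smooth_derive j (smooth_trunc (sphi k)))).
  have -> : trunc C sg s (phi k) = (fun x => trunc C sg s (phi k) x - 0).
    by apply/funext => x; rewrite subr0.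
  have -> : H k = (fun x => grad (trunc C sg s (phi k)) x - Z x).
    by apply/funext => x; congr (_ + _); rewrite -[G x - G' x]opprB scalerN.
  rewrite (weak_defectB oOm bOm p1 i (Lvk k) Lgv (in_Lp0 Om p1) LZ tf).
  have wv := weak_gradient_smooth oOm bOm p1 (smooth_trunc (sphi k)).
  rewrite ((weak_gradientE oOm bOm p1 (Lvk k) Lgv).1 wv f tf i) sub0r.
  have wG'' : weak_gradient Om u G' by have [_ _ w] := uG'; exact: w.
  have := weak_defectB oOm bOm p1 i Lu LG' Lu LG tf'.
  rewrite ((weak_gradientE oOm bOm p1 Lu LG').1 wG'' _ tf' i).
  rewrite ((weak_gradientE oOm bOm p1 Lu LG).1 wG _ tf' i) subr0 => E.
  apply/eqP; rewrite oppr_eq0; apply/eqP; rewrite -[RHS]E /weak_defect.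
  by apply: eq_Rintegral => x _; rewrite /Z [in LHS]mxE; ring.
- exact: pint_trunc_cvg.
- move=> i.
  have c1 := pint_thB (LGG i).
  have c12 := cvge0D pint_trunc_grad_cvg c1.
  have L1 k j : in_Lp p Om (fun x =>
      (grad (trunc C sg s (phi k)) x - trunc_grad C sg s u G' x) ord0 j).
    under eq_fun do rewrite mxE [X in _ + X]mxE.
    apply: (in_LpB mOm p1 _ (in_Lp_trunc_grad mu LG' j)).
    under eq_fun do rewrite mxE.
    exact: (in_Lp_smooth oOm bOm p1 (smooth_derive j (smooth_trunc (sphi k)))).
  apply: (cvge0_le _ _ c12) => k; first exact: pint_ge0.
  apply: (pint_le2 mOm p1 ler01).
  + apply: measurable_enorm => j; exact: in_Lp_measurable (L1 k j).
  + by apply: measurable_funM => //; exact: in_Lp_measurable (LGG i).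
  + under eq_fun do rewrite mxE [X in _ + X]mxE.
    apply: measurable_funB; first exact: in_Lp_measurable (LHk k i).
    exact: in_Lp_measurable (LH i).
  move=> x _; rewrite mul1r.
  rewrite (_ : _ - _ = (grad (trunc C sg s (phi k)) x - trunc_grad C sg s u G' x)
     + (th0 x - th k x) *: (G x - G' x)); last first.
    rewrite /H /trunc_grad -/(th0 x); apply/rowP => j.
    by rewrite ![in LHS]mxE ![in RHS]mxE; ring.
  rewrite mxE [X in _ + X]mxE (le_trans (ler_normD _ _))// lerD2r.
  by rewrite [leRHS]ger0_norm ?enorm_ge0// coord_le_enorm.
Qed.

End truncation.
Section energy.
Context {R : realType} {n : nat}.
Variables (Om : set 'rV[R]_n.+1) (p : R).
Hypotheses (oOm : open Om) (bOm : bounded_set Om) (p1 : 1 < p).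
Local Notation leb := (@lebesgue_rV R n.+1).
Local Notation pint := (pint Om p).

Variables (C : 'rV[R]_n.+1 -> R) (sg s : R).
Hypotheses (sC : smooth C) (sg2 : sg * sg = 1) (s01 : 0 < s <= 1).

Let s01' : 0 <= s <= 1. Proof. by have [/ltW -> ->] := andP s01. Qed.
Let mOm : measurable Om. Proof. exact: open_measurable_rV. Qed.
Let fOm : (leb Om < +oo)%E. Proof. exact: bounded_lebesgue_rV_lty. Qed.

(** The truncated approximations of [u] approximate its truncation, and by [trunc_le] they are
    nowhere farther from [F] on the boundary than the original ones. *)
Lemma has_trace_trunc u F :
  (forall x, boundary Om x -> 0 <= sg * (C x - F x)) ->
  has_trace p Om u F -> has_trace p Om (trunc C sg s u) F.
Proof.
move=> CF [G [phi [uG sphi cphi tphi]]].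
have [c1 c2] := (sobolev_norm_cvg0P Om p1 _ _).1 cphi.
exists (trunc_grad C sg s u G), (fun k => trunc C sg s (phi k)); split.
- exact: (sobolev_grad_trunc sC sg2 s01' oOm bOm p1 uG sphi c1 c2 uG).
- by move=> k; exact: smooth_trunc.
- apply/(sobolev_norm_cvg0P Om p1); split.
    exact: (pint_trunc_cvg sC sg2 s01' oOm p1 uG sphi c1).
  exact: (pint_trunc_grad_cvg sC sg2 s01' oOm bOm p1 uG sphi c1 c2).
- apply: (@cvge0_le R 1 _ _ _ _ tphi) => k.
    apply: integral_raw_ge0; first exact: hausdorff_set0.
    by move=> x _; rewrite lee_fin powR_ge0.
  rewrite mul1e; apply: le_integral_raw; first exact: hausdorff_set0.
    by move=> x _; rewrite lee_fin powR_ge0.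
  move=> x bx; rewrite lee_fin ge0_ler_powR ?nnegrE//.
    by rewrite (le_trans ler01)// ltW.
  exact: (trunc_le sg2 s01' _ (CF _ bx)).
Qed.

(* Compare the energy of u with that of its truncation, whose gradient is a
   convex combination of G and grad C. *)
Lemma energy_above u F Psi (b : R) : 0 <= b ->
  (forall x, boundary Om x -> 0 <= sg * (C x - F x)) ->
  {ae leb, forall x, Om x -> 0 < sg * (u x - C x) -> enorm (grad C x) <= b} ->
  {ae leb, forall x, Om x -> Psi x <= trunc C sg s u x} ->
  obstacle_minimizer Om F Psi p u ->
  exists2 G, sobolev_grad p Om u G &
    (\int[leb]_(x in Om) (dramp (sg * (u x - C x)) * enorm (G x) `^ p)%:E <=
     (b `^ p)%:E * leb Om)%E.
Proof.
move=> b0 CF Cb CPsi [G [uG tu _] Gmin]; exists G; first exact: uG.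
have [s0 s1] := andP s01.
have [Lu LG _] := uG.
have mu := in_Lp_measurable Lu.
pose th x := dramp (sg * (u x - C x)).
have mth : measurable_fun Om th := measurable_dramp_gap sg sC mu.
have adm : admissible Om F Psi p (trunc C sg s u) (trunc_grad C sg s u G).
  split; last exact: CPsi; last exact: has_trace_trunc CF tu.
  have [G' [phi [uG' sphi cphi _]]] := tu.
  have [c1 c2] := (sobolev_norm_cvg0P Om p1 _ _).1 cphi.
  exact: (sobolev_grad_trunc sC sg2 s01' oOm bOm p1 uG' sphi c1 c2 uG).
have := Gmin _ _ adm; rewrite /dirichlet_energy.
have mG : measurable_fun Om (fun x => enorm (G x)).
  by apply: measurable_enorm => i; exact: in_Lp_measurable (LG i).
have mGp : measurable_fun Om (fun x => enorm (G x) `^ p).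
  exact: (measurableT_comp (measurable_powR p)).
have LGe := in_Lp_enorm oOm p1 LG.
have th01 x : 0 <= s * th x <= 1 := sdramp01 s01' _.
have p0 : 0 <= p by rewrite (le_trans ler01)// ltW.
(* The energy of [u] is [s Y + X], and by convexity that of the competitor is at most
   [X + s b^p |Om|]. Minimality, after cancelling the finite [X] and the positive [s], leaves a
   bound on [Y] that does not involve [s]. *)
pose X := (\int[leb]_(x in Om) ((1 - s * th x) * enorm (G x) `^ p)%:E)%E.
pose Y := (\int[leb]_(x in Om) (th x * enorm (G x) `^ p)%:E)%E.
have mX : measurable_fun Om (fun x => ((1 - s * th x) * enorm (G x) `^ p)%:E).
  apply/measurable_EFinP; apply: measurable_funM => //.
  by apply: measurable_funB => //; exact: measurable_funM.
have mY : measurable_fun Om (fun x => (th x * enorm (G x) `^ p)%:E).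
  by apply/measurable_EFinP; exact: measurable_funM.
have X0 x : (0 <= ((1 - s * th x) * enorm (G x) `^ p)%:E)%E.
  by rewrite lee_fin mulr_ge0 ?powR_ge0//; have := th01 x; lra.
have Y0 x : (0 <= (th x * enorm (G x) `^ p)%:E)%E.
  by rewrite lee_fin mulr_ge0 ?powR_ge0// dramp_ge0.
have EG : (\int[leb]_(x in Om) (enorm (G x) `^ p)%:E = s%:E * Y + X)%E.
  rewrite /Y -ge0_integralZl//; last by rewrite lee_fin ltW.
  rewrite -ge0_integralD//; last 2 first.
  - by move=> x _; rewrite mule_ge0// lee_fin ltW.
  - exact: measurable_funeM.
  by apply: eq_integral => x _; rewrite -EFinM -EFinD; congr EFin; ring.
have Xfin : X \is a fin_num.
  rewrite ge0_fin_numE; last exact: integral_ge0.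
  apply: (@le_lt_trans _ _ (pint (fun x => enorm (G x)))); last first.
    by have [_ h] := (in_LpP Om p _).1 LGe; exact: h.
  rewrite -dirichlet_energyE /dirichlet_energy EG leeDr// mule_ge0 ?lee_fin ?(ltW s0)//.
  exact: integral_ge0.
have EH : (\int[leb]_(x in Om) (enorm (trunc_grad C sg s u G x) `^ p)%:E <=
    X + (s * b `^ p)%:E * leb Om)%E.
  rewrite -integral_cst// -ge0_integralD//; last first.
    by move=> x _; rewrite lee_fin mulr_ge0 ?powR_ge0// ltW.
  apply: ae_ge0_le_integral => //.
  - by move=> x _; rewrite lee_fin powR_ge0.
  - apply/measurable_EFinP; apply: (measurableT_comp (measurable_powR p)).
    apply: measurable_enorm => i.
    exact: in_Lp_measurable (in_Lp_trunc_grad sg sC s01' oOm bOm p1 mu LG i).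
  - by move=> x _; rewrite adde_ge0// lee_fin mulr_ge0 ?powR_ge0// ltW.
  - by apply: emeasurable_funD.
  apply: filterS Cb => x Cb Ox; rewrite -EFinD lee_fin.
  apply: le_trans (convex_enorm_powR _ _ (ltW p1) (th01 x)) _.
  rewrite lerD2l -/(th x).
  have [g0|g0] := ltP 0 (sg * (u x - C x)); last first.
    by rewrite /th dramp_npos// mulr0 mul0r mulr_ge0 ?powR_ge0// ltW.
  rewrite -mulrA ler_wpM2l ?(ltW s0)// -[leRHS]mul1r.
  apply: ler_pM; rewrite ?powR_ge0 ?dramp_ge0 ?dramp_le1//.
  by rewrite ge0_ler_powR ?nnegrE ?enorm_ge0// Cb.
rewrite EG => /le_trans/(_ EH); rewrite (addeC _ X) leeD2lE// EFinM -muleA.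
by rewrite lee_pmul2l ?lte_fin.
Qed.

End energy.

(** * Averages along segments *)

Section bump.
Context {R : realType} {n : nat}.
Implicit Types (x y c h : 'rV[R]_n.+1) (r t : R).

(** The standard mollifier [exp(-1/(r^2 - |y - c|^2))], not normalised. Being symmetric in [y] and
    [c], it can be differentiated in its centre instead of its variable. *)
Definition bump r c y : R := flat 0 (r ^+ 2 - enorm (y - c) ^+ 2).

Lemma bump_ge0 r c y : 0 <= bump r c y.
Proof. exact: flat_ge0. Qed.

Lemma bump_le1 r c y : bump r c y <= 1.
Proof. exact: (flat_ub 0). Qed.

Lemma bump_out r c y : 0 <= r -> r <= enorm (y - c) -> bump r c y = 0.
Proof.
by move=> r0 ry; rewrite /bump flat_npos// subr_le0 lerXn2r ?nnegrE ?enorm_ge0.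
Qed.

Lemma bump_gt0 r c y : enorm (y - c) < r -> 0 < bump r c y.
Proof.
by move=> yr; rewrite flat_gt0// subr_gt0 ltrXn2r ?nnegrE ?enorm_ge0.
Qed.

Lemma smooth_bump r c : smooth (bump r c).
Proof. by apply: smooth_flat; apply: smoothB; [exact: smooth_cst|exact: smooth_sqr_enorm]. Qed.

Lemma test_function_bump Om r c : 0 <= r -> eball c r `<=` Om ->
  test_function Om (bump r c).
Proof.
move=> r0 cO.
have sub : closure [set y | bump r c y != 0] `<=` eball c r.
  rewrite [X in _ `<=` X](closure_id _).1; last exact: eball_closed.
  apply: closure_subset => y /=; rewrite /eball/= leNgt; apply: contra => yr.
  by rewrite bump_out// ltW.
split; first exact: smooth_bump.
  by apply: subclosed_compact sub; [exact: closed_closure|exact: eball_compact].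
exact: subset_trans sub cO.
Qed.

(** The derivative of the bump as its centre moves in the direction [h], which is minus its
    derivative in [y] along [h]; it can therefore be integrated by parts. *)
Definition dbump r c h y : R :=
  2 * (flat 2 (r ^+ 2 - enorm (y - c) ^+ 2) * \sum_i (y ord0 i - c ord0 i) * h ord0 i).

Lemma bumpC r c y : bump r c y = bump r y c.
Proof. by rewrite /bump enormB. Qed.

Lemma is_derive_bump r c y h : is_derive y h (bump r c) (- dbump r c h y).
Proof.
have d1 := is_deriveB (is_derive_cst (r ^+ 2) y h) (is_derive_sqr_enorm c y h).
have := is_derive_comp_line (is_derive_flat 0 _) d1.
rewrite mul0r subr0 sub0r mulrN /dbump.
rewrite -[((cst (r ^+ 2) - fun z => enorm (z - c) ^+ 2)) y]/(r ^+ 2 - enorm (y - c) ^+ 2).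
by rewrite mulrCA.
Qed.

Lemma derive_bump r c y i : 'D_'e_i (bump r c) y = - dbump r c 'e_i y.
Proof. by have [] := is_derive_bump r c y 'e_i. Qed.

Lemma dbumpE r c h y : dbump r c h y = - \sum_i h ord0 i * 'D_'e_i (bump r c) y.
Proof.
rewrite {1}/dbump mulr_sumr mulr_sumr -sumrN; apply: eq_bigr => i _.
rewrite derive_bump /dbump.
rewrite (bigD1 i)//= big1 ?addr0; last first.
  by move=> j ji; rewrite mxE eqxx/= (negPf ji) mulr0.
by rewrite mxE !eqxx/=; ring.
Qed.

Lemma is_derive_bump_line r c h y t :
  is_derive t (1 : R) (fun s : R => bump r (c + s *: h) y) (dbump r (c + t *: h) h y).
Proof.
have -> : (fun s : R => bump r (c + s *: h) y) =
    (fun s : R => bump r y (s *: h + c)).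
  by apply/funext => s; rewrite bumpC addrC.
have := is_derive_bump r y (t *: h + c) h => /is_derive_line hd.
have -> : dbump r (c + t *: h) h y = 1 * - dbump r y h (t *: h + c).
  rewrite mul1r /dbump enormB [c + _]addrC -[RHS]mulrN -[X in _ = _ * X]mulrN.
  congr (2 * (flat 2 (r ^+ 2 - enorm (t *: h + c - y) ^+ 2) * _)).
  by rewrite -sumrN; apply: eq_bigr => i _; rewrite -mulNr opprB.
have E : (fun s : R => bump r y (s *: h + c)) =
    (fun s : R => bump r y (s *: h + (t *: h + c))) \o (shift (- t)).
  by apply/funext => s /=; rewrite addrA -scalerDl subrK.
have ds : is_derive t (1 : R) (shift (- t)) 1 := is_derive_shift t 1 (- t).
rewrite E mulrC; apply: is_derive1_comp.
by rewrite /= subrr.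
Qed.

(** Outside the ball the factor [flat 2] vanishes; inside it is at most [2! = 2], and Cauchy-Schwarz
    bounds the sum by [r |h|]. *)
Lemma dbump_le r c h y : 0 <= r -> `|dbump r c h y| <= 4 * r * enorm h.
Proof.
move=> r0; rewrite /dbump normrM (ger0_norm (ler0n _ 2)).
have [yr|/ltW yr] := leP r (enorm (y - c)).
  rewrite flat_npos ?mul0r ?normr0 ?mulr0 ?mulr_ge0 ?enorm_ge0//.
  by rewrite subr_le0 lerXn2r ?nnegrE ?enorm_ge0.
rewrite normrM (ger0_norm (flat_ge0 _ _)).
have h2 := @flat_ub R 2 (r ^+ 2 - enorm (y - c) ^+ 2).
have h3 : `|\sum_i (y ord0 i - c ord0 i) * h ord0 i| <= r * enorm h.
  apply: (@le_trans _ _ (enorm (y - c) * enorm h)); last by rewrite ler_wpM2r ?enorm_ge0.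
  apply: le_trans (cauchy_schwarz _ _).
  rewrite le_eqVlt; apply/orP; left; apply/eqP; congr `|_|.
  by apply: eq_bigr => i _; rewrite !mxE.
have -> : 4 * r * enorm h = 2 * (2 * (r * enorm h)) by ring.
by rewrite ler_wpM2l// ler_pM ?flat_ge0.
Qed.

End bump.

Section kernel.
Context {R : realType} {n : nat}.
Variables (Om : set 'rV[R]_n.+1) (p : R).
Hypotheses (oOm : open Om) (bOm : bounded_set Om) (p1 : 1 < p).
Local Notation leb := (@lebesgue_rV R n.+1).
Implicit Types (u th : 'rV[R]_n.+1 -> R) (c h y : 'rV[R]_n.+1) (r t : R).

Let mOm : measurable Om. Proof. exact: open_measurable_rV. Qed.
Let fOm : (leb Om < +oo)%E. Proof. exact: bounded_lebesgue_rV_lty. Qed.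

Lemma in_Lp_bumpM u r c : in_Lp p Om u -> in_Lp p Om (fun y => bump r c y * u y).
Proof.
move=> Lu; apply: (in_LpM mOm p1 (c := 1) Lu).
  exact: smooth_measurable (smooth_bump r c).
by move=> y _; rewrite ger0_norm ?bump_ge0 ?bump_le1.
Qed.

Lemma is_derive_kernel u r c h t : 0 <= r -> in_Lp p Om u ->
  is_derive t (1 : R)
    (fun s : R => \int[leb]_(y in Om) (bump r (c + s *: h) y * u y))
    (\int[leb]_(y in Om) (dbump r (c + t *: h) h y * u y)).
Proof.
move=> r0 Lu.
pose f (s : R) y := bump r (c + s *: h) y * u y.
have df (s : R) y : is_derive s (1 : R) (f ^~ y) (dbump r (c + s *: h) h y * u y).
  have := is_deriveM (is_derive_bump_line r c h y s) (is_derive_cst (u y) s 1).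
  by rewrite scaler0 add0r /GRing.scale/= [_ * dbump _ _ _ _]mulrC.
have dfE (s : R) y : partial1of2 f s y = dbump r (c + s *: h) h y * u y.
  by rewrite partial1of2E; have [_ ->] := df s y.
pose G y := 4 * r * enorm h * `|u y|.
have tI : (`]t - 1, t + 1[%classic : set R) t.
  by rewrite /= in_itv/= ltrBlDr ltrDl ltr01.
have intf (s : R) : (`]t - 1, t + 1[%classic : set R) s ->
    leb.-integrable Om (EFin \o f s).
  move=> _; exact: (in_Lp_integrable mOm fOm p1 (in_Lp_bumpM r (c + s *: h) Lu)).
have derf (s : R) y : (`]t - 1, t + 1[%classic : set R) s -> Om y ->
    derivable (f ^~ y) s 1.
  by move=> _ _; have [] := df s y.
have G0 y : 0 <= G y by rewrite !mulr_ge0 ?enorm_ge0.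
have LG : in_Lp p Om G.
  apply: (in_Lp_le mOm p1 (c := 4 * r * enorm h) _ Lu).
  - by rewrite !mulr_ge0 ?enorm_ge0.
  - apply: measurable_funM => //; apply: measurableT_comp => //.
    exact: in_Lp_measurable Lu.
  - by move=> y _; rewrite ger0_norm.
have intG := in_Lp_integrable mOm fOm p1 LG.
have Gub (s : R) y : (`]t - 1, t + 1[%classic : set R) s -> Om y ->
    `|partial1of2 f s y| <= G y.
  by move=> _ _; rewrite dfE normrM ler_wpM2r// dbump_le.
have := differentiation_under_integral mOm tI intf derf G0 intG Gub.
have := derivable_under_integral mOm tI intf derf G0 intG Gub.
rewrite derive1E => dF E; apply: DeriveDef => //.
by rewrite E; apply: eq_Rintegral => y _; rewrite dfE.
Qed.

(** The bump is itself a test function as long as its ball stays in [Om]. *)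
Lemma kernel_weak_gradient u G r c h : 0 <= r -> eball c r `<=` Om ->
  sobolev_grad p Om u G ->
  \int[leb]_(y in Om) (dbump r c h y * u y) =
  \int[leb]_(y in Om) (bump r c y * \sum_i h ord0 i * G y ord0 i).
Proof.
move=> r0 cO [Lu LG wG].
have tb := test_function_bump r0 cO.
have d0 := (weak_gradientE oOm bOm p1 Lu LG).1 wG _ tb.
have Ib i := integrable_defect oOm bOm p1 i Lu LG tb.
apply/eqP; rewrite -subr_eq0; apply/eqP.
have L1 : in_Lp p Om (fun y => dbump r c h y * u y).
  apply: (in_LpM mOm p1 (c := 4 * r * enorm h) Lu); last first.
    by move=> y _; exact: dbump_le.
  rewrite (_ : dbump r c h = fun y => - \sum_i h ord0 i * 'D_'e_i (bump r c) y).
    2: by apply/funext => y; exact: dbumpE.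
  apply: measurable_funN; apply: measurable_sum => i; apply: measurable_funM => //.
  exact: smooth_measurable (smooth_derive i (smooth_bump r c)).
have L2 : in_Lp p Om (fun y => bump r c y * \sum_i h ord0 i * G y ord0 i).
  apply: in_Lp_bumpM; apply: (in_Lp_sum oOm p1) => i.
  apply: (in_LpM mOm p1 (c := `|h ord0 i|) (LG i)) => //.
have I1 := in_Lp_integrable mOm fOm p1 L1; have I2 := in_Lp_integrable mOm fOm p1 L2.
rewrite -(RintegralB mOm I1 I2).
pose Z i y := h ord0 i * (u y * 'D_'e_i (bump r c) y + G y ord0 i * bump r c y).
have IZ i : leb.-integrable Om (EFin \o Z i).
  rewrite (_ : EFin \o Z i = fun y => ((h ord0 i)%:E * (EFin \o
    (fun y => (u y * 'D_'e_i (bump r c) y + G y ord0 i * bump r c y)%R)) y)%E); last first.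
    by apply/funext => y.
  exact: integrableZl (Ib i).
have Z0 i : \int[leb]_(y in Om) Z i y = 0.
  by rewrite (RintegralZl _ mOm (Ib i)) -/(weak_defect _ _ _ _ _) d0 mulr0.
transitivity (\int[leb]_(y in Om) - \sum_i Z i y).
  apply: eq_Rintegral => y _; rewrite dbumpE mulNr mulr_suml mulr_sumr -opprD -big_split/=.
  by congr (- _); apply: eq_bigr => i _; rewrite /Z; ring.
rewrite -[LHS]opprK; apply/eqP; rewrite oppr_eq0; apply/eqP.
have /(_ (index_enum _))[IS S0] : forall s : seq 'I_n.+1,
    leb.-integrable Om (EFin \o (fun y => \sum_(i <- s) Z i y)) /\
    \int[leb]_(y in Om) \sum_(i <- s) Z i y = 0.
  elim=> [|i s [IH1 IH2]].
    under eq_fun do rewrite big_nil.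
    split; last by rewrite Rintegral_cst// mul0r.
    exact: integrable0.
  under eq_fun do rewrite big_cons.
  split; first exact: (integrableD mOm (IZ i) IH1).
  by rewrite (RintegralD mOm (IZ i) IH1) IH2 Z0 addr0.
have := RintegralZl (-1) mOm IS; rewrite S0 mulr0 => E0.
by rewrite -[RHS]oppr0 -[in RHS]E0; congr (- _); apply: eq_Rintegral => y _; rewrite mulN1r.
Qed.

Definition bump_mass r c : R := \int[leb]_(y in Om) bump r c y.

(** The mass is the average of the constant 1, whose gradient is 0, so the formula for the
    derivative of averages shows that it does not change along the segment. *)
Lemma bump_mass_line r c h t : 0 <= r -> 0 <= t ->
  (forall s : R, 0 <= s <= t -> eball (c + s *: h) r `<=` Om) ->
  bump_mass r (c + t *: h) = bump_mass r c.
Proof.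
move=> r0; rewrite le_eqVlt => /predU1P[<- _|t0 tube]; first by rewrite scale0r addr0.
have L1 : in_Lp p Om (fun=> 1) := in_Lp_smooth oOm bOm p1 (smooth_cst 1).
have E0 (i : 'I_n.+1) x : 'D_'e_i (fun=> 1 : R) x = 0 by rewrite derive_cst.
have G1 : sobolev_grad p Om (fun=> 1) (grad (fun=> 1)).
  split=> [|i|]; first exact: L1.
    under eq_fun do rewrite mxE E0.
    exact: (in_Lp0 Om p1).
  exact: (weak_gradient_smooth oOm bOm p1 (smooth_cst 1)).
have d (s : R) := is_derive_kernel c h s r0 L1.
have [|s + E] := MVT t0 (fun s _ => d s).
  by apply: continuous_subspaceT; exact: is_derive_continuous d.
rewrite in_itv/= => /andP[/ltW s0 /ltW st].
have s0t : 0 <= s <= t by rewrite s0 st.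
move: E; rewrite (kernel_weak_gradient h r0 (tube s s0t) G1).
rewrite [X in X * _](_ : _ = 0); last first.
  transitivity (\int[leb]_(y in Om) (0 : R)); last by rewrite Rintegral_cst// mul0r.
  apply: eq_Rintegral => y _; rewrite big1 ?mulr0// => i _.
  by rewrite mxE E0 mulr0.
move=> /eqP; rewrite mul0r subr_eq0 => /eqP E; rewrite /bump_mass.
transitivity (\int[leb]_(y in Om) (bump r (c + t *: h) y * 1)).
  by apply: eq_Rintegral => y _; rewrite mulr1.
rewrite E; apply: eq_Rintegral => y _; by rewrite scale0r addr0 mulr1.
Qed.

Lemma bump_average u r c (a M : R) : 0 <= r -> 0 <= M -> in_Lp p Om u ->
  {ae leb, forall y, Om y -> enorm (y - c) <= r -> `|u y - a| <= M} ->
  `|\int[leb]_(y in Om) (bump r c y * u y) - bump_mass r c * a| <=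
  bump_mass r c * M.
Proof.
move=> r0 M0 Lu uM.
have La : in_Lp p Om (fun=> a) := in_Lp_smooth oOm bOm p1 (smooth_cst a).
have LM : in_Lp p Om (fun=> M) := in_Lp_smooth oOm bOm p1 (smooth_cst M).
have Lb : in_Lp p Om (bump r c) := in_Lp_smooth oOm bOm p1 (smooth_bump r c).
have Ib := in_Lp_integrable mOm fOm p1 Lb.
have Iu := in_Lp_integrable mOm fOm p1 (in_Lp_bumpM r c Lu).
have Ia := in_Lp_integrable mOm fOm p1 (in_Lp_bumpM r c La).
have Lua := in_Lp_bumpM r c (in_LpB mOm p1 Lu La).
have Iua := in_Lp_integrable mOm fOm p1 Lua.
rewrite /bump_mass -(RintegralZr _ mOm Ib) -(RintegralB mOm Iu Ia).
rewrite (_ : \int[leb]_(y in Om) (_ - _) =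
  \int[leb]_(y in Om) (bump r c y * (u y - a))); last first.
  by apply: eq_Rintegral => y _; rewrite mulrBr.
apply: le_trans (le_normr_Rintegral mOm Iua) _.
rewrite -(RintegralZr _ mOm Ib) -lee_fin -(Rintegral_normE oOm bOm p1 Lua).
rewrite /Rintegral fineK; last first.
  by rewrite integrable_fin_num// (in_Lp_integrable mOm fOm p1 (in_Lp_bumpM r c LM)).
apply: ae_ge0_le_integral => //.
- by apply: measurable_norm_EFin; exact: in_Lp_measurable Lua.
- by move=> y _; rewrite lee_fin mulr_ge0 ?bump_ge0.
- by apply/measurable_EFinP; exact: in_Lp_measurable (in_Lp_bumpM r c LM).
apply: filterS uM => y uM Oy; rewrite lee_fin normrM ger0_norm ?bump_ge0//.
have [yr|/ltW yr] := leP (enorm (y - c)) r; last by rewrite bump_out// !mul0r.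
by rewrite ler_wpM2l ?bump_ge0// uM.
Qed.

Lemma ae_exists (P : set 'rV[R]_n.+1) (B : set 'rV[R]_n.+1) :
  {ae leb, forall y, P y} -> open B -> B !=set0 -> exists2 y, B y & P y.
Proof.
move=> [N [mN N0 PN]] oB B0; apply: contrapT => h.
have := open_lebesgue_rV_gt0 oB B0; rewrite ltNge => /negP; apply.
rewrite -N0; apply: le_measure; rewrite ?inE//; first exact: open_measurable_rV.
by move=> y By; apply: PN => Py; apply: h; exists y.
Qed.

(** A nonnegative function of integral 0 vanishes almost everywhere, but the bump is positive on an
    open ball, which has positive measure. *)
Lemma bump_mass_gt0 r c : 0 < r -> eball c r `<=` Om -> 0 < bump_mass r c.
Proof.
move=> r0 cO.
have Lb : in_Lp p Om (bump r c) := in_Lp_smooth oOm bOm p1 (smooth_bump r c).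
have Ib := in_Lp_integrable mOm fOm p1 Lb.
rewrite lt_def; apply/andP; split; last first.
  by apply: Rintegral_ge0 => y _; exact: bump_ge0.
apply/eqP => E.
have E0 : (\int[leb]_(y in Om) `|(bump r c y)%:E| = 0)%E.
  under eq_integral => y _ do rewrite gee0_abs ?lee_fin ?bump_ge0//.
  by rewrite -[LHS]fineK ?integrable_fin_num// [X in X%:E](E).
have mb : measurable_fun Om (EFin \o bump r c).
  by apply/measurable_EFinP; exact: in_Lp_measurable Lb.
have b0 : {ae leb, forall y, Om y -> (bump r c y)%:E = 0%E}.
  exact: (ae_eq_integral_abs leb mOm mb).1 E0.
have oB : open [set y : 'rV[R]_n.+1 | enorm (y - c) < r].
  apply: (@open_comp _ _ (fun y : 'rV[R]_n.+1 => enorm (y - c)) [set t : R | t < r]).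
    by move=> y _; exact: continuous_dist.
  exact: open_lt.
have [|y /= yr Py] := ae_exists b0 oB.
  by exists c; rewrite /= subrr enorm0.
have [Py0] := Py (cO _ (ltW yr)).
by have := bump_gt0 yr; rewrite Py0 ltxx.
Qed.

(* Wherever the cut-off th is bounded below, its energy bound controls the
   oscillation of the averages of u along a segment. *)
Lemma kernel_lipschitz u G th r c h (c0 B l : R) : 0 <= r -> 0 < c0 -> 0 < l ->
  sobolev_grad p Om u G -> measurable_fun Om th ->
  (forall y, 0 <= th y) ->
  (forall s : R, 0 <= s <= 1 -> eball (c + s *: h) r `<=` Om) ->
  {ae leb, forall y, forall s : R, 0 <= s <= 1 -> enorm (y - (c + s *: h)) <= r ->
    c0 <= th y} ->
  (\int[leb]_(y in Om) (th y * enorm (G y) `^ p)%:E <= B%:E)%E ->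
  `|\int[leb]_(y in Om) (bump r (c + h) y * u y) -
    \int[leb]_(y in Om) (bump r c y * u y)| <=
  enorm h * (l * bump_mass r c + l `^ (1 - p) * (c0^-1 * B)).
Proof.
move=> r0 c00 l0 uG mth th0 tube thc thB.
have [Lu LG wG] := uG.
have d (s : R) := is_derive_kernel c h s r0 Lu.
(* The mean value theorem in the position of the centre replaces the difference of averages by one
   average of [G] in the direction [h], about the point [c + s h]. *)
have [|s + E] := MVT ltr01 (fun s _ => d s).
  by apply: continuous_subspaceT; exact: is_derive_continuous d.
rewrite in_itv/= => /andP[/ltW s0 /ltW s1].
move: E; rewrite scale1r scale0r addr0 => ->; rewrite subr0 mulr1.
have s01 : 0 <= s <= 1 by rewrite s0 s1.
rewrite (kernel_weak_gradient h r0 (tube s s01) uG).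
have LGe := in_Lp_enorm oOm p1 LG.
have LS : in_Lp p Om (fun y => \sum_i h ord0 i * G y ord0 i).
  apply: (in_Lp_sum oOm p1) => i.
  exact: (in_LpM mOm p1 (c := `|h ord0 i|) (LG i)).
set cs := c + s *: h.
have I1 := in_Lp_integrable mOm fOm p1 (in_Lp_bumpM r cs LS).
have I2 := in_Lp_integrable mOm fOm p1 (in_Lp_bumpM r cs LGe).
apply: le_trans (le_normr_Rintegral mOm I1) _.
apply: (@le_trans _ _ (\int[leb]_(y in Om) (enorm h * (bump r cs y * enorm (G y))))).
  apply: le_Rintegral => //.
  - exact: integrable_norm I1.
  - exact: integrableZl I2.
  - move=> y _; rewrite normrM ger0_norm ?bump_ge0// mulrCA ler_wpM2l ?bump_ge0//.
    exact: cauchy_schwarz.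
rewrite (RintegralZl _ mOm I2) ler_wpM2l ?enorm_ge0//.
have Lb : in_Lp p Om (bump r cs) := in_Lp_smooth oOm bOm p1 (smooth_bump r cs).
have Ib := in_Lp_integrable mOm fOm p1 Lb.
rewrite -(@bump_mass_line r c h s r0 s0); last first.
  by move=> t /andP[t0 ts]; apply: tube; rewrite t0 (le_trans ts).
rewrite -/cs -lee_fin /Rintegral /bump_mass.
rewrite fineK; last by rewrite integrable_fin_num.
rewrite EFinD EFinM fineK; last by rewrite integrable_fin_num.
have mG : measurable_fun Om (fun y => enorm (G y) `^ p).
  apply: (measurableT_comp (measurable_powR p)); exact: in_Lp_measurable LGe.
have mT : measurable_fun Om (fun y => (th y * enorm (G y) `^ p)%:E).
  by apply/measurable_EFinP; exact: measurable_funM.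
have T0 y : (0 <= (th y * enorm (G y) `^ p)%:E)%E by rewrite lee_fin mulr_ge0 ?powR_ge0.
have k0 : 0 <= l `^ (1 - p) * c0^-1 by rewrite mulr_ge0 ?powR_ge0// invr_ge0 ltW.
have mb : measurable_fun Om (fun y => (bump r cs y)%:E).
  by apply/measurable_EFinP; exact: in_Lp_measurable Lb.
apply: (@le_trans _ _ (l%:E * (\int[leb]_(y in Om) (bump r cs y)%:E) +
   (l `^ (1 - p) * c0^-1)%:E *
   \int[leb]_(y in Om) (th y * enorm (G y) `^ p)%:E)%E); last first.
  by rewrite mulrA (EFinM _ B); apply: leeD => //; apply: lee_wpmul2l.
have b0 y : (0 <= (bump r cs y)%:E)%E by rewrite lee_fin bump_ge0.
rewrite -ge0_integralZl//; last by rewrite lee_fin ltW.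
rewrite -ge0_integralZl//.
rewrite -ge0_integralD//; last 4 first.
- by move=> y _; rewrite mule_ge0// lee_fin ltW.
- exact: measurable_funeM.
- by move=> y _; rewrite mule_ge0// lee_fin.
- exact: measurable_funeM.
apply: ae_ge0_le_integral => //.
- by move=> y _; rewrite lee_fin mulr_ge0 ?bump_ge0 ?enorm_ge0.
- by apply/measurable_EFinP; exact: in_Lp_measurable (in_Lp_bumpM r cs LGe).
- by move=> y _; rewrite adde_ge0// mule_ge0// lee_fin// ltW.
- by apply: emeasurable_funD; exact: measurable_funeM.
apply: filterS thc => y thc Oy; rewrite -!EFinM -EFinD lee_fin.
have [yr|yr] := leP (enorm (y - cs)) r; last first.
  rewrite bump_out ?(ltW yr)// mul0r mulr0 add0r.
  by rewrite mulr_ge0// mulr_ge0 ?powR_ge0.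
have c0th := thc s s01 yr.
(* Young's inequality at level [l]: the linear part yields the slope [l], and the p-th power part is
   absorbed by the weighted energy because [bump <= 1 <= th / c0] here. *)
apply: (@le_trans _ _ (bump r cs y * (l + l `^ (1 - p) * enorm (G y) `^ p))).
  by rewrite ler_wpM2l ?bump_ge0// young ?enorm_ge0.
rewrite mulrDr [bump _ _ _ * l]mulrC lerD2l mulrCA -[leRHS]mulrA.
rewrite ler_wpM2l ?powR_ge0// mulrA ler_wpM2r ?powR_ge0//.
rewrite ler_pdivlMl// (le_trans _ c0th)// ler_piMr ?bump_le1// ltW//.
Qed.

End kernel.

(** * Comparison of the limits with cones *)

Section smooth_cone.
Context {R : realType} {n : nat}.
Implicit Types (x y : 'rV[R]_n.+1).

(* A cone of slope b with its vertex smoothed at scale d, made steep outside the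
   ball of radius r without changing it inside. *)
Definition cone (sg a b d K r : R) x y : R :=
  sg * (a + b * (d ^+ 2 + enorm (y - x) ^+ 2) `^ 2^-1 +
        K * flat 0 (enorm (y - x) ^+ 2 - r ^+ 2)).

Variables (sg a b d K r : R) (x : 'rV[R]_n.+1).
Hypotheses (sg2 : sg * sg = 1) (b0 : 0 <= b) (d0 : 0 < d) (r0 : 0 <= r).
Hypothesis K0 : 0 <= K.
Local Notation C := (cone sg a b d K r x).

Let q y := d ^+ 2 + enorm (y - x) ^+ 2.
Let q0 y : 0 < q y. Proof. by rewrite ltr_wpDr ?sqr_ge0// exprn_gt0. Qed.

Let sqrt_q_ge y : enorm (y - x) <= q y `^ 2^-1.
Proof.
rewrite powR12_sqrt ?(ltW (q0 y))// -[leLHS]ger0_norm ?enorm_ge0// -sqrtr_sqr.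
by rewrite ler_sqrt ?(ltW (q0 y))// lerDr sqr_ge0.
Qed.

Let sqrt_q_le y : q y `^ 2^-1 <= enorm (y - x) + d.
Proof.
have e0 := enorm_ge0 (y - x).
rewrite powR12_sqrt ?(ltW (q0 y))// -[leRHS]ger0_norm; last by rewrite addr_ge0// ltW.
rewrite -sqrtr_sqr ler_sqrt ?sqr_ge0// /q; have := mulr_ge0 e0 (ltW d0); nra.
Qed.

Lemma smooth_cone : smooth C.
Proof.
apply: smoothZ; apply: smoothD.
  apply: smoothD; first exact: smooth_cst.
  apply: smoothZ; apply: smooth_powR => //.
  by apply: smoothD; [exact: smooth_cst|exact: smooth_sqr_enorm].
apply: smoothZ; apply: smooth_flat.
by apply: smoothB; [exact: smooth_sqr_enorm|exact: smooth_cst].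
Qed.

Lemma cone_ge y : a + b * enorm (y - x) + K * flat 0 (enorm (y - x) ^+ 2 - r ^+ 2) <= sg * C y.
Proof.
by rewrite mulrA sg2 mul1r lerD2r lerD2l ler_wpM2l//; exact: sqrt_q_ge.
Qed.

Lemma cone_le y : enorm (y - x) <= r -> sg * C y <= a + b * (enorm (y - x) + d).
Proof.
move=> yr; rewrite mulrA sg2 mul1r flat_npos.
  by rewrite mulr0 addr0 lerD2l ler_wpM2l//; exact: sqrt_q_le.
by rewrite subr_le0 lerXn2r ?nnegrE ?enorm_ge0.
Qed.

(** Inside the ball the steep term vanishes together with its derivative, and what remains is
    [b (y - x) / sqrt(d^2 + |y - x|^2)] up to sign. *)
Lemma grad_cone_le y : enorm (y - x) <= r -> enorm (grad C y) <= b.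
Proof.
move=> yr.
have -> : grad C y = (sg * b * q y `^ (- 2^-1)) *: (y - x).
  apply/rowP => i; rewrite !mxE.
  have d1 := is_derive_sqr_enorm x y 'e_i.
  have d2 := is_deriveD (is_derive_cst (d ^+ 2) y 'e_i) d1.
  have d3 := is_derive_comp_line (is_derive1_powR 2^-1 (q0 y)) d2.
  have d4 := is_deriveB d1 (is_derive_cst (r ^+ 2) y 'e_i).
  have d5 := is_derive_comp_line (is_derive_flat 0 _) d4.
  have d6 := is_deriveM (is_derive_cst K y 'e_i) d5.
  have d7 := is_deriveM (is_derive_cst b y 'e_i) d3.
  have d8 := is_deriveD (is_deriveD (is_derive_cst a y 'e_i) d7) d6.
  have d9 := is_deriveM (is_derive_cst sg y 'e_i) d8.
  have [_ E] := d9; apply: etrans (E : 'D_'e_i C y = _) _.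
  have f0 k : flat k (enorm (y - x) ^+ 2 - r ^+ 2) = 0.
    by rewrite flat_npos// subr_le0 lerXn2r ?nnegrE ?enorm_ge0.
  rewrite (_ : \sum_(_ < _) _ = y ord0 i - x ord0 i); last first.
    rewrite (bigD1 i)//= big1 ?addr0; last by move=> j ji; rewrite mxE eqxx/= (negPf ji) mulr0.
    by rewrite mxE !eqxx/= mulr1.
  set T := ((_ - cst (r ^+ 2)) y); rewrite !(f0 : forall k, flat k T = 0).
  rewrite !scaler0 /GRing.scale/=.
  rewrite (_ : 2^-1 - 1 = - 2^-1 :> R); last by field.
  by field.
rewrite enormZ -mulrA norm_sg// normrM (ger0_norm (powR_ge0 _ _)) (ger0_norm b0).
rewrite -mulrA ler_piMr// powRN ler_pdivrMl ?powR_gt0// mulr1.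
exact: sqrt_q_ge.
Qed.

End smooth_cone.

(** * Uniformity on compact sets *)

Section compact_uniformity.
Context {R : realType} {n : nat}.
Implicit Types (A : set 'rV[R]_n.+1) (f g : 'rV[R]_n.+1 -> R).

Lemma within_continuous_dist A f (x : 'rV[R]_n.+1) (e : R) : {within A, continuous f} ->
  A x -> 0 < e -> \forall y \near x, A y -> `|f x - f y| <= e.
Proof.
move=> cf Ax e0; have /cvgrPdist_le/(_ _ e0) := cf x.
by have -> : nbhs (x : subspace A) = within A (nbhs x) by rewrite [RHS]nbhs_subspace_in.
Qed.

Lemma dist_within_continuous A f :
  (forall x (e : R), A x -> 0 < e -> \forall y \near x, A y -> `|f x - f y| <= e) ->
  {within A, continuous f}.
Proof.
move=> h; apply/subspace_continuousP => x Ax; apply/cvgrPdist_le => e e0.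
exact: h.
Qed.

Lemma within_continuousD A f g : {within A, continuous f} ->
  {within A, continuous g} -> {within A, continuous (fun x => f x + g x)}.
Proof.
move=> cf cg; apply: dist_within_continuous => x e Ax e0.
have e2 : 0 < e / 2 by rewrite divr_gt0.
apply: filterS2 (within_continuous_dist cf Ax e2) (within_continuous_dist cg Ax e2).
move=> y hf hg Ay; rewrite opprD addrACA; apply: le_trans (ler_normD _ _) _.
by rewrite [e]splitr lerD ?hf ?hg.
Qed.

Lemma within_continuousN A f : {within A, continuous f} ->
  {within A, continuous (fun x => - f x)}.
Proof.
move=> cf; apply: dist_within_continuous => x e Ax e0.
apply: filterS (within_continuous_dist cf Ax e0) => y hf Ay.
by rewrite -opprD normrN hf.
Qed.

(** Lebesgue's number lemma for a relation that holds locally. Only [y] has to lie in [A], so that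
    it gives both uniform continuity and a uniform distance to the complement of an open set. *)
Lemma compact_lebesgue_number A (P : 'rV[R]_n.+1 -> 'rV[R]_n.+1 -> Prop) : compact A ->
  (forall x, A x -> exists2 r : R, 0 < r & forall y z, ball x r y -> ball x r z -> P y z) ->
  exists2 d : R, 0 < d & forall y z, A y -> enorm (y - z) <= d -> P y z.
Proof.
move=> /compact_near_coveringP cA hP.
have H (x : 'rV[R]_n.+1) : A x -> \forall y \near x & d \near 0^'+,
    forall z, enorm (y - z) <= d -> P y z.
  move=> Ax; have [r r0 hr] := hP x Ax; have r2 : 0 < r / 2 by rewrite divr_gt0.
  exists (ball x (r / 2), [set d : R | d < r / 2]) => /=.
    by split; [exact: nbhsx_ballx|exact: nbhs_right_lt].
  move=> [y d] /= [xy dr] z yz; apply: hr; first by apply: le_ball xy; lra.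
  move: xy; rewrite -!ball_normE/= => xy; rewrite -(subrK y x) -addrA [r]splitr.
  rewrite (le_lt_trans (ler_normD _ _))// ltrD// (le_lt_trans (norm_le_enorm _))//.
  exact: le_lt_trans yz dr.
have dH := cA R (0^'+) _ (at_right_proper_filter 0) H.
near (0 : R)^'+ => d; exists d; first by near: d; exact: nbhs_right_gt.
have hd : A `<=` (fun y => forall z, enorm (y - z) <= d -> P y z) by near: d; exact: dH.
by move=> y z Ay; exact: hd.
Unshelve. all: by end_near. Qed.

Lemma compact_uniformly_continuous A f (e : R) : compact A ->
  {within A, continuous f} -> 0 < e ->
  exists2 d : R, 0 < d & forall y z, A y -> A z -> enorm (y - z) <= d ->
    `|f y - f z| <= e.
Proof.
move=> cA cf e0; have e2 : 0 < e / 2 by rewrite divr_gt0.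
have [x Ax|d d0 hd] := @compact_lebesgue_number A
    (fun y z => A y -> A z -> `|f y - f z| <= e) cA.
  have /nbhs_ballP[r /= r0 hr] := within_continuous_dist cf Ax e2.
  exists r => // y z xy xz Ay Az; apply: le_trans (ler_distD (f x) _ _) _.
  by rewrite [e]splitr lerD//; [rewrite distrC|]; exact: hr.
by exists d => // y z Ay Az yz; exact: (hd y z Ay yz).
Qed.

Lemma compact_eball_subset A (K : set 'rV[R]_n.+1) : compact A -> open K -> A `<=` K ->
  exists2 r : R, 0 < r & forall x, A x -> eball x r `<=` K.
Proof.
move=> cA oK AK.
have [x Ax|d d0 hd] := @compact_lebesgue_number A (fun _ z => K z) cA.
  have /nbhs_ballP[r /= r0 hr] := oK _ (AK _ Ax).
  by exists r => // _ z _; exact: hr.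
by exists d => // x Ax z xz; apply: (hd x z Ax); rewrite enormB.
Qed.

Lemma compact_uniform_cvg A (w : nat -> 'rV[R]_n.+1 -> R) f (e : R) : compact A ->
  locally_uniform_cvg A w f -> 0 < e ->
  \forall j \near \oo, forall x, A x -> `|w j x - f x| <= e.
Proof.
move=> /compact_near_coveringP cA wf e0.
have H (x : 'rV[R]_n.+1) : A x -> \forall x' \near x & j \near \oo,
    A x' -> `|w j x' - f x'| <= e.
  move=> Ax; have [N xN wN] := wf x Ax.
  pose P : set {uniform` N `&` A -> R} :=
    [set h | forall y, (N `&` A) y -> `|f y - h y| <= e].
  have nP : nbhs (f : {uniform` N `&` A -> R}) P.
    apply/uniform_nbhs; exists [set z : R * R | `|z.1 - z.2| < e]; split => /=.
      by rewrite -entourage_ballE; exists e.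
    by move=> h /= hE y Ny; exact/ltW/hE.
  have := wN P nP; rewrite nbhs_simpl => /= wNe.
  exists (N, [set j | P (w j)]) => //= -[y j] /= [Ny Pj] Ay.
  by rewrite distrC; exact: Pj.
have FF : Filter (\oo : set_system nat) by exact _.
have wH := cA nat \oo _ FF H.
by apply: filterS wH => j hj x Ax; exact: hj.
Qed.

End compact_uniformity.

(** * Bounded domains and their boundary data *)

Section domain.
Context {R : realType} {n : nat}.
Variables (Om : set 'rV[R]_n.+1) (F : 'rV[R]_n.+1 -> R).
Hypothesis bOm : bounded_set Om.
Implicit Types (x y : 'rV[R]_n.+1).

Lemma bounded_closure_compact : compact (closure Om).
Proof.
apply: bounded_closed_compact; last exact: closed_closure.
have [M0 [_ hM]] := bOm; exists (`|M0| + 1); split; first by rewrite num_real.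
move=> M MM x cx; apply: contrapT => /negP; rewrite -ltNge => Mx.
have [|y [Oy]] := cx (ball x (`|x| - M)).
  by apply: nbhsx_ballx; rewrite subr_gt0.
rewrite -ball_normE/= => xy.
have := hM (`|M0| + 1) _ _ Oy; rewrite (le_lt_trans (ler_norm M0)) ?ltrDl// => /(_ isT) /= yM.
have := ler_normD (x - y) y; rewrite subrK; move: xy Mx; lra.
Qed.

Lemma boundary_closure : boundary Om `<=` closure Om.
Proof. by move=> x []. Qed.

Lemma boundary_out x : open Om -> boundary Om x -> ~ Om x.
Proof. by move=> oOm [_ nx] Ox; apply: nx; exact: oOm. Qed.

Lemma closure_boundary x : open Om -> closure Om x -> ~ Om x -> boundary Om x.
Proof. by move=> oOm cx nx; split=> // ix; apply: nx; exact: interior_subset. Qed.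

Lemma lipschitz_boundary : [lipschitz F x | x in boundary Om] ->
  exists2 L : R, 0 <= L & forall x y, boundary Om x -> boundary Om y ->
    `|F x - F y| <= L * `|x - y|.
Proof.
move=> [M0 [_ hM]]; exists (`|M0| + 1); first by rewrite addr_ge0.
move=> x y bx by_; have := hM (`|M0| + 1).
rewrite (le_lt_trans (ler_norm M0)) ?ltrDl// => /(_ isT) h.
exact: (h (x, y)).
Qed.

Lemma boundary_closed : closed (boundary Om).
Proof. by apply: closedI; [exact: closed_closure|exact/open_closedC/open_interior]. Qed.

Lemma boundary_within_continuous : [lipschitz F x | x in boundary Om] ->
  {within boundary Om, continuous F}.
Proof.
move=> /lipschitz_boundary[L L0 hL].
apply: dist_within_continuous => x e bx e0; apply/nbhs_ballP.
have L1 : 0 < L + 1 by rewrite ltr_wpDl.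
exists (e / (L + 1)); first by rewrite /= divr_gt0.
move=> y; rewrite -ball_normE/= ltr_pdivlMr// => xy by_.
apply: le_trans (hL _ _ bx by_) _; apply: le_trans (ltW xy).
by rewrite mulrC ler_wpM2l// lerDl.
Qed.

Lemma lipschitz_boundary_bounded : [lipschitz F x | x in boundary Om] ->
  exists2 M : R, 0 < M & forall x, boundary Om x -> `|F x| <= M.
Proof.
move=> hF; apply: compact_continuous_bounded (boundary_within_continuous hF).
exact: subclosed_compact boundary_closed bounded_closure_compact boundary_closure.
Qed.

End domain.

Lemma le_of_eps {R : realType} (x y c : R) : 0 < c ->
  (forall e : R, 0 < e -> x <= y + e * c) -> x <= y.
Proof.
move=> c0 h; apply/ler_addgt0Pr => e e0.
by have := h (e / c) (divr_gt0 e0 c0); rewrite divfK// gt_eqF.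
Qed.

(** The time [t] is taken within [q] of the supremum of the times at which [g <= e]: beyond that
    supremum [g] exceeds [e], and between the two it can lose at most [e / 2]. *)
Lemma last_crossing {R : realType} (g : R -> R) (q e : R) : 0 < q ->
  (forall t t' : R, 0 <= t <= 1 -> 0 <= t' <= 1 -> `|t - t'| <= q ->
    `|g t - g t'| <= e / 2) -> g 0 <= e -> e < g 1 ->
  exists2 t : R, 0 <= t <= 1 & g t <= e /\ forall t', t <= t' <= 1 -> e / 2 <= g t'.
Proof.
move=> q0 gq g0 eg1; pose T := [set t : R | 0 <= t <= 1 /\ g t <= e].
have supT : has_sup T.
  split; last by exists 1 => t [/andP[_ ?] _].
  by exists 0; split=> //; rewrite lexx ler01.
have [t [/andP[t0 t1] gt] tsup] := sup_adherent q0 supT.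
exists t; [by rewrite t0|split=> // t' /andP[tt' t'1]].
have t'0 : 0 <= t' := le_trans t0 tt'.
(* Either [t2] is beyond the supremum or it equals 1; in both cases [g t2 > e], and [t2] is within
   [q] of [t']. *)
pose t2 := Num.min (t' + q) 1.
have t20 : 0 <= t2 by rewrite le_min ler01 addr_ge0// ltW.
have t21 : t2 <= 1 by rewrite ge_min lexx orbT.
have gt2 : e < g t2.
  rewrite ltNge; apply/negP => gt2.
  have t2T : T t2 by split; [rewrite t20 t21|].
  have := ub_le_sup supT.2 t2T; rewrite /t2 /Num.min; case: ifPn => [_ h|].
    by move: (lt_le_trans tsup tt'); rewrite ltrBlDr ltNge h.
  rewrite -leNgt => t2q _; move: gt2; rewrite /t2.
  by rewrite /Num.min ltNge t2q/= leNgt eg1.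
have := gq t' t2; rewrite t'0 t'1 t20 t21 => /(_ isT isT).
have -> : `|t' - t2| <= q.
  rewrite distrC ger0_norm; last by rewrite subr_ge0 le_min t'1 lerDl ltW.
  by rewrite lerBlDl ge_min lexx.
move=> /(_ isT); rewrite ler_norml => /andP[ge2 _]; lra.
Qed.

(** The quantity is [l (b / l)^p], which decays geometrically in [p]. The threshold [P] results from
    taking logarithms; the case [b = 0] is immediate. *)
Lemma powR_ratio_small {R : realType} (b l e : R) : 0 <= b -> b < l -> 0 < e ->
  exists2 P : R, 0 < P & forall p, P <= p -> l `^ (1 - p) * b `^ p <= e.
Proof.
rewrite le_eqVlt => /predU1P[<-|b0] bl e0.
  by exists 1 => // p p1; rewrite powR0 ?mulr0 ?(ltW e0)// gt_eqF// (lt_le_trans ltr01).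
have l0 : 0 < l by exact: lt_trans bl.
have D0 : 0 < ln l - ln b by rewrite subr_gt0 ltr_ln ?posrE.
exists (`|(ln l - ln e) / (ln l - ln b)| + 1); first by rewrite ltr_wpDl.
move=> p Pp; rewrite /powR !gt_eqF// -expRD -[leRHS]lnK ?posrE// ler_expR.
have : (ln l - ln e) / (ln l - ln b) <= p.
  by rewrite (le_trans _ Pp)// (le_trans (ler_norm _))// lerDl.
rewrite ler_pdivrMr//; lra.
Qed.

Section subsequential_limit.
Context {R : realType} {n : nat}.
Variables (Om : set 'rV[R]_n.+1) (F Psi : 'rV[R]_n.+1 -> R).
Variables (u : R -> 'rV[R]_n.+1 -> R) (U : 'rV[R]_n.+1 -> R).
Variables (p_ : nat -> R) (w_ : nat -> 'rV[R]_n.+1 -> R).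
Local Notation leb := (@lebesgue_rV R n.+1).
Hypotheses (oOm : open Om) (bOm : bounded_set Om).
Hypothesis hF : [lipschitz F x | x in boundary Om].
Hypothesis hPsi : {within closure Om, continuous Psi}.
Hypothesis hu : forall p : R, 1 < p -> obstacle_minimizer Om F Psi p (u p).
Hypothesis p1 : forall j, 1 < p_ j.
Hypothesis poo : p_ j @[j --> \oo] --> +oo.
Hypothesis wu : forall j, {ae leb, forall x, Om x -> w_ j x = u (p_ j) x}.
Hypothesis cw : \forall j \near \oo, {within closure Om, continuous (w_ j)}.
Hypothesis wU : locally_uniform_cvg (closure Om) w_ U.
Implicit Types (x y h : 'rV[R]_n.+1).

Let cO : compact (closure Om). Proof. exact: bounded_closure_compact. Qed.
Let OcO : Om `<=` closure Om. Proof. exact: subset_closure. Qed.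
Let mOm : measurable Om. Proof. exact: open_measurable_rV. Qed.
Let fOm : (leb Om < +oo)%E. Proof. exact: bounded_lebesgue_rV_lty. Qed.

Let unif (e : R) : 0 < e ->
  \forall j \near \oo, forall x, closure Om x -> `|w_ j x - U x| <= e.
Proof. by move=> e0; exact: compact_uniform_cvg. Qed.

Lemma limit_continuous : {within closure Om, continuous U}.
Proof.
apply: dist_within_continuous => x e cx e0.
have e3 : 0 < e / 3 by rewrite divr_gt0.
near \oo => j.
have cj : {within closure Om, continuous (w_ j)} by near: j; exact: cw.
have uj : forall x, closure Om x -> `|w_ j x - U x| <= e / 3 by near: j; exact: unif.
apply: filterS (within_continuous_dist cj cx e3) => y hy cy.
have := hy cy; have := uj _ cx; have := uj _ cy.
rewrite !ler_norml; lra.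
Unshelve. all: by end_near. Qed.

Lemma limit_bounded : exists2 M : R, 0 < M & forall x, closure Om x -> `|U x| <= M.
Proof. exact: compact_continuous_bounded limit_continuous. Qed.

Let minimizer_ge j : {ae leb, forall x, Om x -> Psi x <= u (p_ j) x}.
Proof. by have [G [_ _ h] _] := hu (p1 j). Qed.

Lemma limit_ge_obstacle x : Om x -> Psi x <= U x.
Proof.
move=> Ox; rewrite leNgt; apply/negP => UP.
pose d := (Psi x - U x) / 4; have d0 : 0 < d by rewrite divr_gt0// subr_gt0.
near \oo => j.
have uj : forall y, closure Om y -> `|w_ j y - U y| <= d by near: j; exact: unif.
have : \forall y \near x, [/\ Om y, U y <= U x + d & Psi x - d <= Psi y].
  near=> y; have Oy : Om y by near: y; exact: oOm.
  split=> //.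
    have : Om y -> `|U x - U y| <= d.
      move=> /OcO; near: y; exact: (within_continuous_dist limit_continuous (OcO Ox) d0).
    by move=> /(_ Oy); rewrite ler_norml; lra.
  have : Om y -> `|Psi x - Psi y| <= d.
    move=> /OcO; near: y; exact: (within_continuous_dist hPsi (OcO Ox) d0).
  by move=> /(_ Oy); rewrite ler_norml; lra.
move=> /nbhs_ballP[r /= r0 hB].
have [|y By] := ae_exists (filterI (wu j) (minimizer_ge j)) (ball_open x r).
  by exists x; exact: ballxx.
have [Oy Uy Py] := hB _ By; move=> [/(_ Oy) wuy /(_ Oy)].
have := uj _ (OcO Oy); rewrite -wuy ler_norml; move: Uy Py; rewrite /d; lra.
Unshelve. all: by end_near. Qed.

(** The only place where the energies are used as [p] tends to infinity. A gap of at least [eta]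
    along the segment bounds the weight [dramp] from below on a tube about it, so the weighted
    energy bound controls the averages of [u_p] there; the averages are then compared with point
    values of [U]. *)
Lemma limit_lipschitz (sg b s eta r : R) C c h :
  smooth C -> sg * sg = 1 -> 0 <= b -> 0 < s <= 1 -> 0 < eta -> 0 < r ->
  (forall y, boundary Om y -> 0 <= sg * (C y - F y)) ->
  (\forall j \near \oo, {ae leb, forall y, Om y ->
     0 < sg * (u (p_ j) y - C y) -> enorm (grad C y) <= b}) ->
  (\forall j \near \oo, {ae leb, forall y, Om y -> Psi y <= trunc C sg s (u (p_ j)) y}) ->
  (forall t : R, 0 <= t <= 1 -> eball (c + t *: h) r `<=` Om) ->
  (forall t : R, 0 <= t <= 1 -> eta <= sg * (U (c + t *: h) - C (c + t *: h))) ->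
  `|U (c + h) - U c| <= b * enorm h.
Proof.
move=> sC sg2 b0 s01 eta0 r0 CF Cb CPsi tube gap.
have arith (d eta' a a' a'' c' c'' : R) : d <= eta' / 4 -> eta' <= a - c' ->
    - d <= a' - a'' <= d -> - (eta' / 4) <= c'' - c' <= eta' / 4 ->
    - d <= a'' - a <= d -> eta' / 4 <= a' - c'' by lra.
have arith3 (i1 i0 a1 a0 c1 c2 : R) : `|i1 - a1| <= c1 -> `|i0 - a0| <= c1 ->
    `|i1 - i0| <= c2 -> `|a1 - a0| <= c1 + c2 + c1.
  rewrite !ler_norml; lra.
have h0 := enorm_ge0 h.
(* Each of the two averages differs from the point value by [2 e], which makes 4; the choice
   [l = b + e] and the remainder of Young's inequality add [e] each to the slope, which makes
   [2 enorm h]. *)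
apply: (@le_of_eps _ _ _ (4 + 2 * enorm h)) => [|e e0]; first by rewrite ltr_wpDr ?mulr_ge0.
pose l := b + e; have bl : b < l by rewrite ltrDl.
have l0 : 0 < l by exact: le_lt_trans bl.
pose d := Num.min e (eta / 4).
have d0 : 0 < d by rewrite lt_min e0 divr_gt0.
have de : d <= e by rewrite ge_min lexx.
have deta : d <= eta / 4 by rewrite ge_min lexx orbT.
(* On balls of radius [rho] the function [U] varies by at most [d <= eta / 4] and [C] by at most
   [eta / 4]; with the error [d] of [u_p] this leaves a gap of at least [eta / 4] throughout the
   tube. *)
have [rU rU0 hU] := compact_uniformly_continuous cO limit_continuous d0.
have eta4 : 0 < eta / 4 by rewrite divr_gt0.
have cC : {within closure Om, continuous C}.
  by apply: continuous_subspaceT; exact: smooth_continuous.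
have [rC rC0 hC] := compact_uniformly_continuous cO cC eta4.
pose rho := Num.min r (Num.min rU rC).
have rho0 : 0 < rho by rewrite !lt_min r0 rU0.
have rhor : rho <= r by rewrite ge_min lexx.
have rhoU : rho <= rU by rewrite !ge_min lexx orbT.
have rhoC : rho <= rC by rewrite !ge_min lexx !orbT.
have tube' t : 0 <= t <= 1 -> eball (c + t *: h) rho `<=` Om.
  by move=> t01 y yr; apply: (tube t t01); exact: le_trans rhor.
have i0 : 0 <= (0 : R) <= 1 by rewrite lexx ler01.
have i1 : 0 <= (1 : R) <= 1 by rewrite lexx ler01.
have tube0 : eball c rho `<=` Om by have := tube' 0 i0; rewrite scale0r addr0.
have tube1 : eball (c + h) rho `<=` Om by have := tube' 1 i1; rewrite scale1r.
have m2 : 1 < 2 :> R by rewrite ltr1n.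
have [N NE] : exists N, N = bump_mass Om rho c by exists (bump_mass Om rho c).
have N0 : 0 < N by rewrite NE; exact: (bump_mass_gt0 oOm bOm m2 rho0 tube0).
have N1 : bump_mass Om rho (c + h) = N.
  have := @bump_mass_line _ _ Om 2 oOm bOm m2 rho c h 1 (ltW rho0) ler01 tube'.
  by rewrite scale1r NE.
pose c0 := expR (- (eta / 4)^-1); have c00 : 0 < c0 by exact: expR_gt0.
have [V VE] : exists V, V = fine (leb Om) by exists (fine (leb Om)).
have V0 : 0 <= V by rewrite VE; exact: fine_ge0.
(* Chosen so that the remainder [l^(1-p) b^p V / c0] is at most [N e]; the [+ 1] covers [V = 0]. *)
have e' : 0 < e * N * c0 / (V + 1) by rewrite divr_gt0 ?mulr_gt0// ltr_wpDl.
have [P P0 hP] := powR_ratio_small b0 bl e'.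
near \oo => j.
have uj : forall x, closure Om x -> `|w_ j x - U x| <= d by near: j; exact: unif.
have Cbj : {ae leb, forall y, Om y ->
   0 < sg * (u (p_ j) y - C y) -> enorm (grad C y) <= b} by near: j; exact: Cb.
have CPj : {ae leb, forall y, Om y -> Psi y <= trunc C sg s (u (p_ j)) y}.
  by near: j; exact: CPsi.
have Pj : P <= p_ j.
  by near: j; move/cvgryPge: poo; exact.
have [G uG GE] := energy_above oOm bOm (p1 j) sC sg2 s01 b0 CF Cbj CPj (hu (p1 j)).
have [Lu LG _] := uG.
have th0 y : 0 <= dramp (sg * (u (p_ j) y - C y)) by exact: dramp_ge0.
have mth := measurable_dramp_gap sg sC (in_Lp_measurable Lu).
have thc : {ae leb, forall y, forall t : R, 0 <= t <= 1 ->
    enorm (y - (c + t *: h)) <= rho -> c0 <= dramp (sg * (u (p_ j) y - C y))}.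
  apply: filterS (wu j) => y wuy t t01 yt; apply: dramp_gt0 => //.
  have Oy : Om y by exact: (tube' t t01).
  have Oc : Om (c + t *: h).
    by apply: (tube' t t01); exact/eball_center/ltW.
  rewrite -wuy//.
  have := hU _ _ (OcO Oy) (OcO Oc) (le_trans yt rhoU).
  have := hC _ _ (OcO Oy) (OcO Oc) (le_trans yt rhoC).
  have := uj _ (OcO Oy); have := gap t t01.
  have E z := esym (norm_sg z sg2).
  rewrite [`|w_ j y - _|]E [`|C y - _|]E [`|U y - _|]E !mulrBr !ler_norml.
  exact: arith deta.
have GE' : (\int[leb]_(x in Om) (dramp (sg * (u (p_ j) x - C x)) * enorm (G x) `^ (p_ j))%:E
    <= (b `^ p_ j * V)%:E)%E.
  by rewrite EFinM VE fineK// ge0_fin_numE.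
have := kernel_lipschitz oOm bOm (p1 j) (ltW rho0) c00 l0 uG mth th0 tube' thc GE'.
rewrite -NE.
have avg (z : 'rV[R]_n.+1) : eball z rho `<=` Om -> bump_mass Om rho z = N ->
    `|\int[leb]_(y in Om) (bump rho z y * u (p_ j) y) - N * U z| <= N * (2 * e).
  move=> zO zN; rewrite -zN.
  apply: (bump_average oOm bOm (p1 j) (ltW rho0)) => //; first by rewrite mulr_ge0// ltW.
  apply: filterS (wu j) => y wuy Oy yr; rewrite -wuy//.
  have Oz : Om z by apply: zO; exact/eball_center/ltW.
  have := hU _ _ (OcO Oy) (OcO Oz) (le_trans yr rhoU).
  move=> UU; rewrite -(subrK (U y) (w_ j y)) -addrA (le_trans (ler_normD _ _))//.
  by rewrite mulrDl mul1r lerD// (le_trans _ de)//; exact: uj (OcO Oy).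
have := avg _ tube0 (esym NE); have := avg _ tube1 N1.
move=> a1 a0 aI.
have X0 : l `^ (1 - p_ j) * (c0^-1 * (b `^ p_ j * V)) <= N * e.
  rewrite (_ : _ * _ = (l `^ (1 - p_ j) * b `^ p_ j) * (V / c0)); last by ring.
  apply: (@le_trans _ _ (e * N * c0 / (V + 1) * (V / c0))).
    by rewrite ler_wpM2r ?divr_ge0 ?(ltW c00)//; exact: hP.
  rewrite (_ : _ * _ = N * e * (V / (V + 1))); last first.
    by field; rewrite !gt_eqF// ltr_wpDl.
  rewrite ler_piMr ?mulr_ge0 ?(ltW N0) ?(ltW e0)// ler_pdivrMr ?ltr_wpDl//.
  by rewrite mul1r lerDl.
have /(le_trans aI) aI' : enorm h * (l * N + l `^ (1 - p_ j) * (c0^-1 * (b `^ p_ j * V))) <=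
    enorm h * (N * (l + e)).
  by rewrite ler_wpM2l// mulrDr lerD// mulrC.
rewrite -(ler_pM2l N0) -[X in X * _](gtr0_norm N0) -normrM.
have -> : N * (b * enorm h + e * (4 + 2 * enorm h)) =
    N * (2 * e) + enorm h * (N * (l + e)) + N * (2 * e) by rewrite /l; ring.
by rewrite mulrBr; exact: arith3 a1 a0 aI'.
Unshelve. all: by end_near. Qed.

Lemma limit_above_obstacle x (r : R) : eball x r `<=` Om -> 0 <= r ->
  (forall y, eball x r y -> Psi y < U y) ->
  exists2 c : R, 0 < c & forall y, eball x r y -> Psi y + c <= U y.
Proof.
move=> xrO r0 PU.
have cf : {within eball x r, continuous (fun y => U y - Psi y)}.
  apply: (continuous_subspaceW (subset_trans xrO OcO)).
  exact: within_continuousD limit_continuous (within_continuousN hPsi).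
have xr0 : eball x r !=set0 by exists x; exact: eball_center.
have [y yxr ymin] := compact_EVT_min xr0 (@eball_compact _ _ x r) cf.
rewrite inE in yxr.
exists (U y - Psi y) => [|z xrz]; first by rewrite subr_gt0 PU.
by have := ymin z; rewrite inE => /(_ xrz); lra.
Qed.

(* Truncating at a cone and letting p -> oo, U cannot leave its vertex with a
   slope steeper than the cone. *)
Lemma limit_cone_strict (sg b r r' : R) x : sg * sg = 1 -> 0 < b -> 0 < r' -> r' < r ->
  eball x r `<=` Om ->
  (sg = -1 \/ forall y, eball x r y -> Psi y < U y) ->
  (forall y, eball x r y -> sg * U y <= sg * U x + b * r') ->
  forall w, enorm (w - x) <= r' -> sg * U w <= sg * U x + b * enorm (w - x).
Proof.
move=> sg2 b0 r'0 r'r xrO obst Ur w wr'; rewrite leNgt; apply/negP => Uw.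
have ar1 (P c U' w' z : R) : P + c <= U' -> - (c / 2) <= w' - U' -> `|z| <= c / 2 ->
    P <= w' - z by rewrite ler_norml; lra.
have ar2 (M' A' c sU sw sC e' bL : R) : `|sU| <= M' -> 0 < c -> 0 < e' -> 0 <= bL ->
    `|sw - sU| <= c / 2 -> A' + e' + bL <= sC -> sw - sC <= M' + `|A'| + c.
  have := ler_norm (- A'); rewrite normrN !ler_norml; lra.
have ar3 (D' e' A' bL bl sUw sUc sCw sCc gt' : R) : 0 < e' -> D' = 8 * e' ->
    D' = sUw - (A' + bL) -> `|sUw - sUc| <= bL - bl -> sUc - sCc <= e' ->
    sCc <= A' + e' + bl + e' -> A' + e' + bL <= sCw -> False.
  rewrite ler_norml; lra.
have r0 : 0 < r by exact: lt_trans r'r.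
set A := sg * U x; set L := enorm (w - x).
pose D := sg * U w - (A + b * L); have D0 : 0 < D by rewrite subr_gt0.
(* The excess [D] is spent in units of [e]. The final estimate loses three: one for raising the cone
   at its vertex, one for smoothing it, and one for the gap at the starting point of the segment. *)
pose e := D / 8; have e0 : 0 < e by rewrite divr_gt0.
(* Smoothing the vertex at scale [d] raises the cone by at most [b d = e]. *)
pose d := e / b; have d0 : 0 < d by rewrite divr_gt0.
have bd : b * d = e by rewrite mulrC divfK// gt_eqF.
have [M M0 hM] := limit_bounded.
have [MF MF0 hMF] := lipschitz_boundary_bounded bOm hF.
have f0 : 0 < flat 0 (r ^+ 2 - r' ^+ 2).
  by rewrite flat_gt0// subr_gt0 ltrXn2r ?nnegrE// ltW.
(* With this constant the cone exceeds [M + MF] at distances greater than [r]: it dominates the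
   boundary data there, and also [u_p] for large [p]. *)
pose K := (2 * M + MF) / flat 0 (r ^+ 2 - r' ^+ 2).
have K0 : 0 <= K by rewrite divr_ge0 ?(ltW f0)// addr_ge0 ?mulr_ge0 ?(ltW M0) ?(ltW MF0).
have Ox : Om x by apply: xrO; exact/eball_center/ltW.
have AM : `|A| <= M by rewrite norm_sg// hM//; exact: OcO.
pose C := cone sg (A + e) b d K r' x.
have sC : smooth C := smooth_cone sg (A + e) b K r' x d0.
have Cge y : A + e + b * enorm (y - x) <= sg * C y.
  apply: le_trans (cone_ge (A + e) K r' x sg2 (ltW b0) d0 y).
  by rewrite lerDl mulr_ge0// flat_ge0.
have Cfar y : r < enorm (y - x) -> M + MF + e <= sg * C y.
  move=> ry; apply: le_trans (cone_ge (A + e) K r' x sg2 (ltW b0) d0 y).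
  have : K * flat 0 (r ^+ 2 - r' ^+ 2) <= K * flat 0 (enorm (y - x) ^+ 2 - r' ^+ 2).
    rewrite ler_wpM2l// flat0_le// lerD2r lerXn2r ?nnegrE ?enorm_ge0 ?(ltW ry)// ltW//.
  rewrite {1}/K divfK ?gt_eqF//.
  have := mulr_ge0 (ltW b0) (enorm_ge0 (y - x)).
  move: AM; rewrite ler_norml; lra.
have Cle y : enorm (y - x) <= r' -> sg * C y <= A + e + b * enorm (y - x) + e.
  move=> yr; apply: le_trans (cone_le _ _ sg2 (ltW b0) d0 (ltW r'0) yr) _.
  by rewrite mulrDr bd addrA.
have CF y : boundary Om y -> 0 <= sg * (C y - F y).
  move=> by_; have ry : r < enorm (y - x).
    by rewrite ltNge; apply/negP => yr; exact: boundary_out by_ (xrO _ yr).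
  have := Cfar _ ry; have := hMF _ by_; rewrite -(norm_sg _ sg2) mulrBr ler_norml.
  move: (ltW M0) (ltW e0); lra.
(* Between the radii [r'] and [r] the hypothesis on [U] gives [sg U <= sg C - e], and beyond [r] the
   steep term does more. So [u_p] can pass the cone only inside the ball of radius [r'], where the
   slope is at most [b]. *)
have near_in : \forall j \near \oo, forall y, Om y -> 0 < sg * (w_ j y - C y) ->
    enorm (y - x) <= r'.
  apply: filterS (unif e0) => j uj y Oy; rewrite leNgt; move=> gap; apply/negP => yr'.
  have := uj _ (OcO Oy); rewrite -(norm_sg _ sg2) mulrBr ler_norml => /andP[_ wU'].
  have [yr|ry] := leP (enorm (y - x)) r.
    have := Ur _ yr; have := Cge y.
    have : b * r' <= b * enorm (y - x) by rewrite ler_wpM2l ?(ltW b0)// ltW.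
    move: gap wU'; rewrite mulrBr -/A; lra.
  have := Cfar _ ry; have := hM _ (OcO Oy); rewrite -(norm_sg _ sg2) ler_norml.
  move: gap wU' MF0; rewrite mulrBr; lra.
have Cb : \forall j \near \oo, {ae leb, forall y, Om y ->
    0 < sg * (u (p_ j) y - C y) -> enorm (grad C y) <= b}.
  apply: filterS near_in => j hj; apply: filterS (wu j) => y wuy Oy.
  rewrite -wuy// => /(hj _ Oy) yr.
  exact: (grad_cone_le (A + e) K sg2 (ltW b0) d0 (ltW r'0) yr).
clearbody C; have De : D = 8 * e by rewrite /e mulrC divfK.
(* Raising keeps the obstacle condition even with [s = 1]. When lowering, [u_p] is at least [c / 2]
   above the obstacle on the ball for large [p]; since the gap is at most [T] there, [s = c / (2 T)]
   removes no more than [c / 2]. *)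
have [s s01 CPsi] : exists2 s : R, 0 < s <= 1 &
    \forall j \near \oo, {ae leb, forall y, Om y -> Psi y <= trunc C sg s (u (p_ j)) y}.
  case: obst => [sgN|PU].
    exists 1; first by rewrite ltr01 lexx.
    apply: nearW => j; apply: filterS (minimizer_ge j) => y h Oy.
    apply: le_trans (h Oy) _.
    by rewrite /trunc sgN mulN1r opprK lerDl mul1r ramp_ge0.
  have [c c0 hc] := limit_above_obstacle xrO (ltW r0) PU.
  pose T := M + `|A| + c.
  have T0 : 0 < T by rewrite /T; have := normr_ge0 A; lra.
  have s0 : 0 < Num.min 1 (c / 2 / T) by rewrite lt_min ltr01 !divr_gt0.
  exists (Num.min 1 (c / 2 / T)); first by rewrite s0 ge_min lexx.
  have c2 : 0 < c / 2 by rewrite divr_gt0.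
  near=> j.
  have uj : forall y, closure Om y -> `|w_ j y - U y| <= c / 2 by near: j; exact: unif.
  have ij : forall y, Om y -> 0 < sg * (w_ j y - C y) -> enorm (y - x) <= r'.
    by near: j; exact: near_in.
  apply: filterS2 (wu j) (minimizer_ge j) => y wuy Py Oy.
  have {}Py := Py Oy; rewrite /trunc -(wuy Oy).
  have [g0|g0] := leP (sg * (w_ j y - C y)) 0.
    by rewrite ramp_npos// !mulr0 subr0 (wuy Oy).
  have yr := le_trans (ij y Oy g0) (ltW r'r).
  have Pc := hc y yr; have wUy := uj _ (OcO Oy).
  have wl : - (c / 2) <= w_ j y - U y by move: wUy; rewrite ler_norml => /andP[].
  set g := sg * (w_ j y - C y).
  suff sr : `|sg * (Num.min 1 (c / 2 / T) * ramp g)| <= c / 2.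
    exact: ar1 Pc wl sr.
  rewrite norm_sg// normrM (gtr0_norm s0) (ger0_norm (ramp_ge0 _)).
  apply: (@le_trans _ _ (c / 2 / T * T)); last by rewrite divfK// gt_eqF.
  apply: ler_pM; rewrite ?ramp_ge0 ?(ltW s0)//; first by rewrite ge_min lexx orbT.
  apply: le_trans (ramp_le (ltW g0)) _; rewrite /g mulrBr.
  apply: (ar2 M A c (sg * U y) _ _ e (b * enorm (y - x))) => //.
  - by rewrite norm_sg// hM//; exact: OcO.
  - by rewrite mulr_ge0 ?enorm_ge0// ltW.
  - by rewrite -mulrBr norm_sg.
have Ox' (t : R) : 0 <= t <= 1 -> enorm (x + t *: (w - x) - x) = t * L.
  by move=> /andP[t0 _]; rewrite addrAC subrr add0r enormZ ger0_norm.
pose g t := sg * (U (x + t *: (w - x)) - C (x + t *: (w - x))).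
have L0 : 0 <= L := enorm_ge0 _.
have tr' (t : R) : 0 <= t <= 1 -> enorm (x + t *: (w - x) - x) <= r'.
  by move=> t01; rewrite Ox'// (le_trans _ wr')// ler_piMl//; case/andP: t01.
have tO (t : R) : 0 <= t <= 1 -> Om (x + t *: (w - x)).
  by move=> t01; apply: xrO; apply: le_trans (tr' t t01) (ltW r'r).
have [q q0 gq] : exists2 q : R, 0 < q & forall t t' : R, 0 <= t <= 1 -> 0 <= t' <= 1 ->
    `|t - t'| <= q -> `|g t - g t'| <= e / 2.
  have cUC : {within closure Om, continuous (fun y => U y - C y)}.
    apply: within_continuousD limit_continuous (within_continuousN _).
    by apply: continuous_subspaceT; exact: smooth_continuous.
  have e2 : 0 < e / 2 by rewrite divr_gt0.
  have [rg rg0 hg] := compact_uniformly_continuous cO cUC e2.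
  exists (rg / (L + 1)); first by rewrite divr_gt0// ltr_wpDl.
  move=> t t' t01 t'01; rewrite ler_pdivlMr ?ltr_wpDl// => tt'.
  rewrite /g -mulrBr norm_sg//; apply: (hg _ _ (OcO (tO _ t01)) (OcO (tO _ t'01))).
  rewrite opprD addrACA subrr add0r -scalerBl enormZ (le_trans _ tt')//.
  by rewrite ler_wpM2l// lerDl.
have g0 : g 0 <= 0.
  rewrite /g scale0r addr0 mulrBr subr_le0; apply: le_trans (Cge x).
  by rewrite subrr enorm0 mulr0 addr0 lerDl ltW.
have wE : x + 1 *: (w - x) = w by rewrite scale1r addrC subrK.
have g1 : D - e - e <= g 1.
  rewrite /g wE mulrBr; have := Cle w wr'; rewrite -/L /D; lra.
have eg1 : e < g 1 by apply: lt_le_trans g1; rewrite /e; move: D0; lra.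
(* The gap to the cone is at most 0 at [x] and exceeds [e] at [w]. After the last near-crossing it
   stays above [e / 2], so the slope bound [b] holds from there to [w]; but the cone itself gains
   [b] per unit length, so an excess of [8 e] cannot build up. *)
have [t t01 [gt gap]] := last_crossing q0 gq (le_trans g0 (ltW e0)) eg1.
have [t0 t1] := andP t01.
pose c := x + t *: (w - x); pose h := (1 - t) *: (w - x).
have cE (s' : R) : c + s' *: h = x + (t + s' * (1 - t)) *: (w - x).
  by rewrite /c /h scalerA -addrA -scalerDl.
have ts (s' : R) : 0 <= s' <= 1 -> t <= t + s' * (1 - t) <= 1.
  move=> /andP[s'0 s'1]; rewrite lerDl mulr_ge0 ?subr_ge0//=.
  by rewrite -lerBrDl ler_piMl// subr_ge0.
have rr' : 0 < r - r' by rewrite subr_gt0.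
have e20 : 0 < e / 2 by rewrite divr_gt0.
have chw : c + h = w by have := cE 1; rewrite scale1r mul1r subrKC wE.
have := limit_lipschitz sC sg2 (ltW b0) s01 e20 rr' CF Cb CPsi (c := c) (h := h).
have tubec (s' : R) : 0 <= s' <= 1 -> eball (c + s' *: h) (r - r') `<=` Om.
  move=> s'01 y; rewrite cE /eball/= => yr; apply: xrO.
  have /andP[k0 k1] := ts s' s'01.
  rewrite /eball/= -(subrK (x + (t + s' * (1 - t)) *: (w - x)) y) -addrA.
  apply: le_trans (ler_enormD _ _) _; rewrite -[leRHS](subrK r').
  by apply: lerD => //; apply: tr'; rewrite k1 (le_trans t0).
have gapc (s' : R) : 0 <= s' <= 1 -> e / 2 <= sg * (U (c + s' *: h) - C (c + s' *: h)).
  by move=> s'01; rewrite cE; exact: gap (ts s' s'01).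
rewrite chw => /(_ tubec gapc).
have hE : b * enorm h = b * L - b * (t * L).
  rewrite /h enormZ ger0_norm ?subr_ge0//; rewrite -/L; ring.
rewrite hE -(norm_sg _ sg2) mulrBr => UUc.
have Ccle := Cle c (tr' t t01); rewrite {2}/c (Ox' t t01) in Ccle.
have gtc : sg * U c - sg * C c <= e by rewrite -mulrBr.
have DE : D = sg * U w - (A + b * L) by [].
exact: (ar3 D e A (b * L) (b * (t * L)) _ _ _ _ 0 e0 De DE UUc gtc Ccle (Cge w)).
Unshelve. all: by end_near. Qed.

(** The bound [S] on the ball is compared with cones of slope slightly larger than
    [(S - sg * U x) / r], and the excess slope [e] then tends to 0. *)
Lemma limit_cone (sg S r : R) x : sg * sg = 1 -> 0 < r -> eball x r `<=` Om ->
  (sg = -1 \/ forall y, eball x r y -> Psi y < U y) ->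
  (forall y, eball x r y -> sg * U y <= S) ->
  forall w, eball x r w -> sg * U w <= sg * U x + (S - sg * U x) * (enorm (w - x) / r).
Proof.
move=> sg2 r0 xrO obst US w wr; rewrite /eball/= in wr.
have AS : 0 <= S - sg * U x by rewrite subr_ge0 US//; exact/eball_center/ltW.
have L0 := enorm_ge0 (w - x).
have [Lr|Lr] := ltP (enorm (w - x)) r; last first.
  have -> : enorm (w - x) = r by apply/eqP; rewrite eq_le wr.
  by rewrite divff ?gt_eqF// mulr1 subrKC US.
apply: (@le_of_eps _ _ _ r) => // e e0.
pose b := (S - sg * U x) / r + e.
have b0 : 0 < b by rewrite ltr_wpDl// divr_ge0// ltW.
have br : S - sg * U x < b * r by rewrite mulrDl divfK ?gt_eqF// ltrDl mulr_gt0.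
(* The radius must contain [w], stay below [r], and satisfy [b r' >= S - sg * U x]; the excess slope
   makes these conditions compatible. *)
pose r' := Num.max ((enorm (w - x) + r) / 2) ((S - sg * U x) / b).
have r'0 : 0 < r' by rewrite lt_max; apply/orP; left; lra.
have r'r : r' < r.
  by rewrite gt_max [X in _ && X]ltr_pdivrMr// [r * b]mulrC br andbT; lra.
have wr' : enorm (w - x) <= r' by rewrite le_max; apply/orP; left; lra.
have Ub y : eball x r y -> sg * U y <= sg * U x + b * r'.
  move=> /US yS; rewrite -lerBlDl (le_trans (_ : _ <= S - sg * U x)) ?lerD2r//.
  by rewrite [leRHS]mulrC -ler_pdivrMr// le_max lexx orbT.
apply: le_trans (limit_cone_strict sg2 b0 r'0 r'r xrO obst Ub wr') _.
rewrite -addrA lerD2l /b mulrDl mulrAC mulrA lerD2l ler_wpM2l ?(ltW e0)//.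
Qed.

End subsequential_limit.

(** * Traces of continuous Sobolev functions *)

Section hausdorff_projection.
Context {R : realType} {n : nat}.
Local Open Scope ereal_scope.

(* Dropping a coordinate does not increase distances: a set of small Hausdorff
   measure is projected into countably many cubes of small total volume. *)
Lemma hausdorff_small_projection (i : 'I_n.+1) (A : set 'rV[R]_n.+1) (eta : R) :
  hausdorff n A < eta%:E ->
  exists Z : set 'rV[R]_n, [/\ measurable Z,
    lebesgue_rV Z <= (2 ^+ n * eta)%:E & forall x, A x -> Z (col' i x)].
Proof.
move=> Aeta.
(* Covers at scale 1 suffice: the scale serves only to make the diameters finite. *)
have : hausdorff_content n 1 A < eta%:E.
  apply: le_lt_trans Aeta; apply: ereal_sup_ubound; exists 1%R => //=.
move=> /ereal_inf_lt[_ [U [Ud AU] <-] Ueta].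
have Ufin (m : nat) : U m !=set0 -> ediam (U m) \is a fin_num.
  by move=> U0; rewrite ge0_fin_numE ?ediam_ge0// (le_lt_trans (Ud m))// ltry.
pose d m : R := fine (ediam (U m)).
pose z m : 'rV[R]_n := col' i (get (U m)).
(* A cube centred at the projection of a chosen point of [U m], with half-side the diameter; its
   side is twice the diameter, whence the factor [2 ^+ n]. *)
pose Z m : set 'rV[R]_n := if U m == set0 then set0 else
  rect (fun k => `[(z m ord0 k - d m)%R, (z m ord0 k + d m)%R]%classic).
have mZ m : measurable (Z m).
  by rewrite /Z; case: ifP => // _; apply: measurable_rect => k; exact: measurable_itv.
have leZ m : lebesgue_rV (Z m) <= (2 ^+ n)%:E * hausdorff_gauge n (U m).
  rewrite /Z /hausdorff_gauge; case: ifPn => [_|/set0P U0]; first by rewrite measure0 mule0.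
  rewrite lebesgue_rV_rect; last by move=> k; exact: measurable_itv.
  rewrite -(fineK (Ufin m U0)) -/(d m).
  have d0 : (0 <= d m)%R by rewrite fine_ge0// ediam_ge0.
  rewrite -EFin_expe -EFinM -exprMn.
  rewrite (eq_bigr (fun=> (2 * d m)%:E)); last first.
    move=> k _; rewrite lebesgue_measure_itv/= lte_fin.
    by case: ltP => h; rewrite -?EFinD; congr (_%:E)%E; move: h d0; lra.
  by rewrite prodEFin prodr_const card_ord.
exists (\bigcup_m Z m); split.
- exact: bigcup_measurable.
- apply: (@le_trans _ _ (\sum_(m <oo) lebesgue_rV (Z m))).
    by apply: measure_sigma_subadditive => //; exact: bigcup_measurable.
  apply: (@le_trans _ _ (\sum_(m <oo) (2 ^+ n)%:E * hausdorff_gauge n (U m))).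
    by apply: lee_nneseries => // m _; exact: leZ.
  rewrite nneseriesZl; last by move=> m _; exact: hausdorff_gauge_ge0.
  by rewrite EFinM lee_wpmul2l ?lee_fin ?exprn_ge0// ltW.
- move=> x Ax; have [m _ Ux] := AU x Ax; exists m => //.
  have U0 : U m !=set0 by exists x.
  rewrite /Z ifF; last by apply/negbTE/set0P.
  move=> k /=; rewrite in_itv/= -ler_distlC !mxE.
  have gU : U m (get (U m)) by exact: (getPex U0).
  apply: (@le_trans _ _ (enorm (get (U m) - x))).
    by have := coord_le_enorm (get (U m) - x) (lift i k); rewrite !mxE.
  rewrite -lee_fin fineK ?Ufin//; apply: ereal_sup_ubound.
  by exists (get (U m), x).
Qed.

End hausdorff_projection.
Section collar.
Context {R : realType}.
Local Notation leb1 := (@lebesgue_measure R).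

Lemma increment_le_integral (h dh : R -> R) (t T : R) :
  (forall s : R, is_derive s 1 h (dh s)) -> continuous dh -> 0 < t -> t < T ->
  (`|h t - h 0|%:E <= \int[leb1]_(s in `]0%R, T[%classic) `|dh s|%:E)%E.
Proof.
move=> hdh cdh t0 tT; have ch := is_derive_continuous hdh.
have mdh : measurable_fun setT (fun s => `|dh s|%:E).
  by apply: measurable_norm_EFin; exact: continuous_measurable_fun.
have E : (\int[leb1]_(s in `[0%R, t]%classic) (dh s)%:E = (h t)%:E - (h 0)%:E)%E.
  apply: (@continuous_FTC2 _ dh h) => //.
  - exact: continuous_subspaceT.
  - split.
    + by move=> s _; have [] := hdh s.
    + by apply: cvg_at_right_filter; exact: ch.
    + by apply: cvg_at_left_filter; exact: ch.
  - by move=> s _; rewrite derive1E; have [_ ->] := hdh s.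
rewrite -[(`|_|)%:E]/(`|(h t - h 0)%:E|)%E EFinB -E.
apply: (@le_trans _ _ (\int[leb1]_(s in `[0%R, t]%classic) `|(dh s)%:E|)%E).
  apply: le_abse_integral => //; apply: measurable_funTS; apply/measurable_EFinP.
  exact: continuous_measurable_fun.
rewrite -integral_itv_obnd_cbnd; last exact: measurable_funTS.
apply: ge0_subset_integral => //; first exact: measurable_funTS.
move=> s; rewrite /= !in_itv/= => /andP[-> st]; exact: le_lt_trans tT.
Qed.

(** At each height either [f] is large or [h] has moved away from [h 0], and the latter is paid for
    by the integral of [|dh|]. Integration over the heights produces the factor [T] in front of
    it. *)
Lemma collar_line (f h dh : R -> R) (a T : R) : 0 <= a -> 0 < T ->
  (forall s : R, is_derive s 1 h (dh s)) -> continuous dh ->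
  measurable_fun `]0%R, T[%classic f -> (forall s, 0 <= f s) ->
  (forall t, 0 < t < T -> a <= f t + `|h t - h 0|) ->
  ((a * T)%:E <= \int[leb1]_(t in `]0%R, T[%classic) (f t + T * `|dh t|)%:E)%E.
Proof.
move=> a0 T0 hdh cdh mf f0 fh.
have mdh : measurable_fun `]0%R, T[%classic (fun s => `|dh s|%:E).
  apply: measurable_funTS; apply: measurable_norm_EFin.
  exact: continuous_measurable_fun.
have mf' : measurable_fun `]0%R, T[%classic (fun s => (f s)%:E) by exact/measurable_EFinP.
pose J := (\int[leb1]_(s in `]0%R, T[%classic) `|dh s|%:E)%E.
have J0 : (0 <= J)%E by exact: integral_ge0.
have Icst (c : \bar R) : (\int[leb1]_(t in `]0%R, T[%classic) c = c * T%:E)%E.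
  by rewrite integral_cst//= lebesgue_measure_itv/= lte_fin T0 sube0.
have -> : (\int[leb1]_(t in `]0%R, T[%classic) (f t + T * `|dh t|)%:E =
    \int[leb1]_(t in `]0%R, T[%classic) ((f t)%:E + J))%E.
  rewrite ge0_integralD//; last by move=> s _; rewrite lee_fin.
  rewrite Icst.
  transitivity (\int[leb1]_(t in `]0%R, T[%classic) ((f t)%:E + T%:E * `|dh t|%:E))%E.
    by apply: eq_integral => t _; rewrite -EFinM -EFinD.
  rewrite ge0_integralD//; last 3 first.
  - by move=> s _; rewrite lee_fin.
  - by move=> s _; rewrite mule_ge0// lee_fin ltW.
  - exact: measurable_funeM.
  by rewrite ge0_integralZl// 1?muleC// lee_fin ltW.
rewrite EFinM -Icst; apply: ge0_le_integral => //.
- by apply: emeasurable_funD.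
- move=> t; rewrite /= in_itv/= => /[dup] t0T /andP[t0 tT].
  apply: (@le_trans _ _ (f t + `|h t - h 0|)%:E); first by rewrite lee_fin fh.
  by rewrite EFinD leeD2l// increment_le_integral.
Qed.

End collar.

(** * Collars above a graph *)

Section graph_collar.
Context {R : realType} {n : nat}.
Variables (i : 'I_n.+1) (b : bool) (gamma : 'rV[R]_n -> R).
Hypothesis mgamma : measurable_fun setT gamma.
Variables (B : set 'rV[R]_n) (T : R).
Hypotheses (mB : measurable B) (T0 : 0 < T).
Local Notation leb := (@lebesgue_rV R n.+1).
Local Notation theta := (graph_chart i b gamma).

Definition collar : set 'rV[R]_n.+1 :=
  [set x | B (col' i x) /\ 0 < (-1) ^+ b * x ord0 i - gamma (col' i x) < T].

Lemma graph_chart_height y (t : R) :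
  (-1) ^+ b * theta (y, t) ord0 i - gamma (col' i (theta (y, t))) = t.
Proof.
rewrite graph_chart_coord col'_graph_chart/= mulrA -expr2 sqrr_sign mul1r.
by rewrite addrAC subrr add0r.
Qed.

Lemma collar_graph_chart y (t : R) : collar (theta (y, t)) <-> B y /\ 0 < t < T.
Proof. by rewrite /collar/= graph_chart_height col'_graph_chart. Qed.

Lemma graph_chartK x :
  theta (col' i x, (-1) ^+ b * x ord0 i - gamma (col' i x)) = x.
Proof.
apply/rowP => j; have [k ->|->] := unliftP i j.
  by rewrite graph_chart_lift mxE.
by rewrite graph_chart_coord/= subrKC mulrA -expr2 sqrr_sign mul1r.
Qed.

Lemma measurable_col' : measurable_fun setT (fun x : 'rV[R]_n.+1 => col' i x).
Proof.
apply/measurable_fun_rVP => k.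
apply: (eq_measurable_fun (fun x : 'rV[R]_n.+1 => x ord0 (lift i k))).
  by move=> x _; rewrite mxE.
exact: measurable_coord_rV.
Qed.

Lemma measurable_collar : measurable collar.
Proof.
have m1 : measurable_fun setT
    (fun x : 'rV[R]_n.+1 => (-1) ^+ b * x ord0 i - gamma (col' i x)).
  apply: measurable_funB; last exact: (measurableT_comp mgamma measurable_col').
  by apply: measurable_funM => //; exact: measurable_coord_rV.
rewrite (_ : collar = (fun x => col' i x) @^-1` B `&`
   (fun x : 'rV[R]_n.+1 => (-1) ^+ b * x ord0 i - gamma (col' i x)) @^-1`
      `]0, T[%classic).
  apply: measurableI.
    by rewrite -[X in measurable X]setTI; exact: measurable_col'.
  by rewrite -[X in measurable X]setTI; exact: m1.
by apply/seteqP; split => x /=; rewrite in_itv.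
Qed.

Lemma lebesgue_collar : leb collar = (lebesgue_rV B * T%:E)%E.
Proof.
rewrite (@lebesgue_rV_graph_chart _ _ i b gamma mgamma _ measurable_collar).
rewrite (_ : theta @^-1` collar = B `*` `]0, T[%classic).
  rewrite product_measure1E//.
  by rewrite /= lebesgue_measure_itv/= lte_fin T0 sube0.
apply/seteqP; split => [[y t]|[y t]] /=.
  by move/collar_graph_chart; rewrite in_itv.
by rewrite in_itv/= => h; apply/collar_graph_chart.
Qed.

Let theta_line y (s t : R) : theta (y, t) = ((-1) ^+ b * (t - s)) *: 'e_i + theta (y, s).
Proof.
apply/rowP => j; have [k ->|->] := unliftP i j.
  rewrite [LHS]graph_chart_lift [RHS]mxE graph_chart_lift mxE.
  by rewrite mxE eqxx/= eq_sym (negPf (neq_lift i k)) mulr0 add0r.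
by rewrite [LHS]graph_chart_coord [RHS]mxE graph_chart_coord 2!mxE !eqxx/=; ring.
Qed.

Lemma is_derive_graph_chart phi y (s : R) : smooth phi ->
  is_derive s (1 : R) (fun t : R => phi (theta (y, t)))
    ((-1) ^+ b * 'D_'e_i phi (theta (y, s))).
Proof.
move=> sphi.
have /is_derive_line d0 := smooth_is_derive (theta (y, s)) i sphi.
have d1 : is_derive s (1 : R) (fun t : R => (-1) ^+ b * (t - s)) ((-1) ^+ b).
  have := is_deriveM (is_derive_cst ((-1) ^+ b : R) s 1) (is_derive_shift s 1 (- s)).
  by rewrite scaler0 addr0 /GRing.scale/= mulr1.
have -> : (fun t : R => phi (theta (y, t))) =
    (fun h : R => phi (h *: 'e_i + theta (y, s))) \o (fun t : R => (-1) ^+ b * (t - s)).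
  by apply/funext => t /=; rewrite -theta_line.
rewrite mulrC; apply: is_derive1_comp.
by rewrite /= subrr mulr0.
Qed.

(* On each fibre over P, w - phi is large or phi varies; integrate over P. *)
Lemma collar_estimate (w phi : 'rV[R]_n.+1 -> R) (P : set 'rV[R]_n) (a : R) :
  measurable P -> P `<=` B ->
  measurable_fun collar w -> smooth phi -> 0 <= a ->
  (forall y (t : R), P y -> 0 < t < T -> a <= `|w (theta (y, t)) - phi (theta (y, 0))|) ->
  ((a * T)%:E * lebesgue_rV P <=
   \int[leb]_(x in collar) (`|w x - phi x| + T * `|'D_'e_i phi x|)%:E)%E.
Proof.
move=> mP PB mw sphi a0 wphi.
have mphi := smooth_measurable (Om := collar) sphi.
pose f (x : 'rV[R]_n.+1) : R := `|w x - phi x|.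
pose g (x : 'rV[R]_n.+1) : \bar R := (f x + T * `|'D_'e_i phi x|)%:E.
have mf : measurable_fun collar f.
  by apply: measurableT_comp => //; exact: measurable_funB.
have mg : measurable_fun collar g.
  apply/measurable_EFinP; apply: measurable_funD => //.
  apply: measurable_funM => //; apply: measurableT_comp => //.
  exact: smooth_measurable (smooth_derive i sphi).
have g0 x : (0 <= g x)%E.
  by rewrite /g lee_fin /f addr_ge0// pmulr_rge0.
have mgC : measurable_fun setT (g \_ collar).
  by apply/(measurable_restrictT _ measurable_collar).
have gC0 x : (0 <= (g \_ collar) x)%E by apply: erestrict_ge0.
rewrite integral_mkcond (@ge0_integral_graph_chart _ _ i b gamma mgamma _ mgC gC0).
rewrite -integral_cst//.
apply: (@le_trans _ _ (\int[@lebesgue_rV R n]_(y in P)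
   \int[@lebesgue_measure R]_t (g \_ collar) (theta (y, t)))%E).
  apply: ge0_le_integral => //.
  - by move=> y _; rewrite lee_fin mulr_ge0// ltW.
  - apply: measurable_funTS.
    apply: (@measurable_fun_fubini_tonelli_F _ _ _ _ _ (@lebesgue_measure R)
      ((g \_ collar) \o theta)).
      exact: (measurableT_comp mgC (measurable_graph_chart _ _ mgamma)).
    by move=> z; exact: gC0.
  move=> y Py.
  have -> : (\int[@lebesgue_measure R]_t (g \_ collar) (theta (y, t)) =
      \int[@lebesgue_measure R]_(t in `]0%R, T[%classic) g (theta (y, t)))%E.
    rewrite [RHS]integral_mkcond; apply: eq_integral => t _; rewrite !patchE.
    have By := PB _ Py.
    case: ifPn => tc; case: ifPn => tT //.
      move: tc tT; rewrite inE => /collar_graph_chart[_ tT].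
      by rewrite notin_setE/= in_itv/= tT.
    move: tc tT; rewrite notin_setE inE/= in_itv/= => tc tT; exfalso; apply: tc.
    exact/collar_graph_chart.
  pose dh (s : R) : R := (-1) ^+ b * 'D_'e_i phi (theta (y, s)).
  have -> : (\int[@lebesgue_measure R]_(t in `]0%R, T[%classic) g (theta (y, t)) =
    \int[@lebesgue_measure R]_(t in `]0%R, T[%classic) (f (theta (y, t)) + T * `|dh t|)%:E)%E.
    by apply: eq_integral => t _; rewrite /g /dh normrM normr_sign mul1r.
  apply: (@collar_line R (fun t => f (theta (y, t))) (fun t => phi (theta (y, t))) dh) => //.
  - by move=> s; exact: is_derive_graph_chart.
  - have cD := is_derive_continuous
      (fun s => is_derive_graph_chart y s (smooth_derive i sphi)).
    by move=> s; apply: cvgM; [exact: cvg_cst|exact: cD].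
  - apply: (measurable_comp measurable_collar _ mf) => [_ [t /= tT <-]|].
      apply/collar_graph_chart; split; first exact: PB.
      by move: tT; rewrite in_itv.
    apply: measurable_funTS.
    exact: (measurableT_comp (measurable_graph_chart _ _ mgamma) (pair1_measurable y)).
  - by move=> s; exact: normr_ge0.
  - move=> t tT; apply: le_trans (wphi y t Py tT) _; exact: ler_distD.
apply: ge0_subset_integral => //.
  apply: (@measurable_fun_fubini_tonelli_F _ _ _ _ _ (@lebesgue_measure R)
      ((g \_ collar) \o theta)).
    exact: (measurableT_comp mgC (measurable_graph_chart _ _ mgamma)).
  by move=> z; exact: gC0.
by move=> y _; apply: integral_ge0.
Qed.

End graph_collar.

(** * Boundary charts *)

Section boundary_chart.
Context {R : realType} {n : nat}.
Variables (Om : set 'rV[R]_n.+1) (x0 : 'rV[R]_n.+1) (r : R) (i : 'I_n.+1) (b : bool).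
Variable gamma : 'rV[R]_n -> R.
Hypotheses (oOm : open Om) (bx0 : boundary Om x0) (r0 : 0 < r) (sgamma : smooth gamma).
Hypothesis chart : forall x, ball x0 r x ->
  (Om x <-> gamma (col' i x) < (-1) ^+ b * x ord0 i).
Local Notation theta := (graph_chart i b gamma).

Let cgamma : continuous gamma. Proof. exact: smooth_continuous. Qed.

Let gamma_near (y : 'rV[R]_n) (e : R) : 0 < e ->
  exists2 d : R, 0 < d & forall z, ball y d z -> `|gamma y - gamma z| < e.
Proof.
move=> e0; have /cvgrPdist_lt/(_ _ e0)/nbhs_ballP[d /= d0 h] := @cgamma y.
by exists d.
Qed.

Let ball_col' (x y : 'rV[R]_n.+1) (d : R) :
  0 < d -> ball x d y -> ball (col' i x) d (col' i y).
Proof.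
by move=> d0 /(ball_rV _ _ d0) h; apply/ball_rV => // k; rewrite !mxE.
Qed.

(** Above the graph, [x0] would lie in the open set [Om]; below it, by continuity of [gamma], a
    whole neighbourhood would miss [Om]. *)
Lemma boundary_graph : (-1) ^+ b * x0 ord0 i = gamma (col' i x0).
Proof.
apply/eqP; rewrite eq_le; apply/andP; split.
  rewrite leNgt; apply/negP => h; apply: (boundary_out oOm bx0).
  by apply/chart => //; exact: ballxx.
rewrite leNgt; apply/negP => h.
pose e := (gamma (col' i x0) - (-1) ^+ b * x0 ord0 i) / 2.
have e0 : 0 < e by rewrite divr_gt0// subr_gt0.
have [d d0 hd] := gamma_near (col' i x0) e0.
pose m := Num.min r (Num.min d e).
have m0 : 0 < m by rewrite !lt_min r0 d0.
have [y [Oy xy]] := (boundary_closure bx0) (ball x0 m) (nbhsx_ballx _ _ m0).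
have yr : ball x0 r y by apply: le_ball xy; rewrite ge_min lexx.
have yd : ball x0 d y by apply: le_ball xy; rewrite !ge_min lexx orbT.
have ye : ball x0 e y by apply: le_ball xy; rewrite !ge_min lexx !orbT.
have := (chart yr).1 Oy; have := hd _ (ball_col' d0 yd).
have /ball_rV/(_ i) := ye => /(_ e0).
rewrite -(norm_sg _ (_ : (-1) ^+ b * (-1) ^+ b = 1)); last by rewrite -expr2 sqrr_sign.
rewrite mulrBr !ltr_norml /e; lra.
Qed.

Lemma graph_chart_near (rho : R) : 0 < rho ->
  exists d T : R, [/\ 0 < d, 0 < T & forall y (t : R), ball (col' i x0) d y -> `|t| <= T ->
    ball x0 rho (theta (y, t))].
Proof.
move=> rho0; have rho2 : 0 < rho / 2 by rewrite divr_gt0.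
have [d d0 hd] := gamma_near (col' i x0) rho2.
exists (Num.min d rho), (rho / 2); split => //; first by rewrite lt_min d0.
move=> y t yd tT.
have yd1 : ball (col' i x0) d y by apply: le_ball yd; rewrite ge_min lexx.
have yd2 : ball (col' i x0) rho y by apply: le_ball yd; rewrite ge_min lexx orbT.
apply/ball_rV => // j; have [k ->|->] := unliftP i j.
  rewrite graph_chart_lift; have /ball_rV/(_ k) := yd2 => /(_ rho0).
  by rewrite mxE.
rewrite graph_chart_coord.
rewrite -(norm_sg _ (_ : (-1) ^+ b * (-1) ^+ b = 1)); last by rewrite -expr2 sqrr_sign.
rewrite mulrBr mulrA -expr2 sqrr_sign mul1r boundary_graph/= opprD addrA.
apply: le_lt_trans (ler_normB _ _) _; rewrite [rho]splitr ltr_leD//.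
exact: hd.
Qed.

Lemma graph_chart_domain (d T : R) : 0 < T ->
  (forall y (t : R), ball (col' i x0) d y -> `|t| <= T -> ball x0 r (theta (y, t))) ->
  forall y, ball (col' i x0) d y ->
  (forall t, 0 < t <= T -> Om (theta (y, t))) /\ boundary Om (theta (y, 0)).
Proof.
move=> T0 hr y yd.
have inO (t : R) : 0 < t <= T -> Om (theta (y, t)).
  move=> /andP[t0 tT]; apply/chart; first by apply: hr => //; rewrite gtr0_norm.
  rewrite graph_chart_coord col'_graph_chart mulrA -expr2 sqrr_sign mul1r/=.
  by rewrite ltrDl.
split=> //; split.
  move=> A /nbhs_ballP[e /= e0 eA].
  pose t := Num.min T (e / 2).
  have t0 : 0 < t by rewrite lt_min T0 divr_gt0.
  exists (theta (y, t)); split; first by apply: inO; rewrite t0 ge_min lexx.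
  apply: eA; apply/ball_rV => // j; have [k ->|->] := unliftP i j.
    by rewrite !graph_chart_lift/= subrr normr0.
  rewrite !graph_chart_coord -mulrBr norm_sg; last by rewrite -expr2 sqrr_sign.
  rewrite /= addr0 opprD addrA subrr add0r normrN gtr0_norm//.
  by rewrite (@le_lt_trans _ _ (e / 2))// ?ge_min ?lexx ?orbT// ltr_pdivrMr// ltr_pMr// ltr1n.
move=> /interior_subset Ox.
have := (chart (hr y 0 yd _)).1 Ox; rewrite normr0 => /(_ (ltW T0)).
by rewrite graph_chart_coord col'_graph_chart mulrA -expr2 sqrr_sign mul1r/= addr0 ltxx.
Qed.

End boundary_chart.
Section trace.
Context {R : realType} {n : nat}.
Variables (Om : set 'rV[R]_n.+1) (F : 'rV[R]_n.+1 -> R) (p : R).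
Hypotheses (oOm : open Om) (bOm : bounded_set Om) (sOm : smooth_boundary Om).
Hypothesis hF : [lipschitz F x | x in boundary Om].
Hypothesis p1 : 1 < p.
Local Notation leb := (@lebesgue_rV R n.+1).

Let mOm : measurable Om. Proof. exact: open_measurable_rV. Qed.
Let fOm : (leb Om < +oo)%E. Proof. exact: bounded_lebesgue_rV_lty. Qed.

Lemma measurable_boundary_gap phi (c : R) : smooth phi ->
  measurable [set y | boundary Om y /\ c <= `|phi y - F y|].
Proof.
move=> sphi; have mb := closed_measurable_rV (@boundary_closed _ _ Om).
have cpF : {within boundary Om, continuous (fun y => `|phi y - F y|)}.
  apply: dist_within_continuous => y e by_ e0.
  have cB : {within boundary Om, continuous (fun y => phi y - F y)}.
    apply: within_continuousD (within_continuousN (boundary_within_continuous hF)).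
    by apply: continuous_subspaceT; exact: smooth_continuous.
  apply: filterS (within_continuous_dist cB by_ e0) => z h bz.
  exact: le_trans (ler_dist_dist _ _) (h bz).
have := continuous_measurable_rV mb cpF mb (measurable_itv `[c, +oo[).
by congr measurable; apply/seteqP; split => y /=; rewrite in_itv/= andbT.
Qed.

(** Since [1 - p < 0], a large [l] works; the witness is solved from [l^(p-1) = (G + 1) / k]. *)
Lemma powR_neg_small (G k : R) : 0 <= G -> 0 < k ->
  exists2 l : R, 0 < l & l `^ (1 - p) * G <= k.
Proof.
move=> G0 k0; have p10 : 0 < p - 1 by rewrite subr_gt0.
have q0 : 0 < (G + 1) / k by rewrite divr_gt0// ltr_wpDl.
exists (((G + 1) / k) `^ (p - 1)^-1); first by rewrite powR_gt0.
rewrite -powRrM (_ : _ * (1 - p) = -1); last by field; rewrite gt_eqF.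
rewrite powR_inv1 ?(ltW q0)// invf_div mulrAC ler_pdivrMr ?ltr_wpDl//.
by rewrite ler_wpM2l ?(ltW k0)// lerDl.
Qed.

(* If w and F differed at a boundary point, then on a thin collar the smooth
   approximations phi_k of w would differ from w, or else oscillate in the
   normal direction, on a set of non-small measure. *)
Lemma trace_boundary v w x0 : {within closure Om, continuous w} ->
  {ae leb, forall x, Om x -> w x = v x} -> has_trace p Om v F ->
  boundary Om x0 -> w x0 = F x0.
Proof.
have arith (z z1 z2 z3 z4 z5 z6 : R) : z1 <= z / 8 -> z2 <= z / 8 -> z3 < z / 4 ->
    z4 <= z3 + z2 -> z5 <= z6 + z4 -> z <= z1 + z5 -> z / 2 <= z6 by lra.
move=> cw wv [G [phi [vG sphi cphi tphi]]] bx0.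
apply/eqP; rewrite -subr_eq0 -normr_eq0; apply: contraT; rewrite -normr_gt0 normr_id.
set a := `|w x0 - F x0| => a0.
have [Lv LG _] := vG.
have [c1 c2] := (sobolev_norm_cvg0P Om p1 _ _).1 cphi.
have [r [i [b [gamma [r0 sgamma chart]]]]] := sOm bx0.
pose theta := graph_chart i b gamma.
have a8 : 0 < a / 8 by rewrite divr_gt0.
have /nbhs_ballP[rw /= rw0 hw] := within_continuous_dist cw (boundary_closure bx0) a8.
have /nbhs_ballP[rF /= rF0 hFa] :=
  within_continuous_dist (boundary_within_continuous hF) bx0 a8.
pose rho := Num.min r (Num.min rw rF).
have rho0 : 0 < rho by rewrite !lt_min r0 rw0.
have [d [T1 [d0 T10 hth]]] := graph_chart_near oOm bx0 r0 sgamma chart rho0.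
have hthr y (t : R) : ball (col' i x0) d y -> `|t| <= T1 -> ball x0 r (theta (y, t)).
  by move=> yd tT; apply: le_ball (hth _ _ yd tT); rewrite ge_min lexx.
have dom := graph_chart_domain chart T10 hthr.
pose B : set 'rV[R]_n := ball (col' i x0) d.
have oB : open B := ball_open _ _.
have mB : measurable B := open_measurable_rV oB.
have B0 : (0 < lebesgue_rV B)%E.
  by apply: open_lebesgue_rV_gt0 => //; exists (col' i x0); exact: ballxx.
have Boo : (lebesgue_rV B < +oo)%E.
  apply: bounded_lebesgue_rV_lty => //; exists (`|col' i x0| + d).
  split=> [|M dM y]; first by rewrite num_real.
  rewrite /B -ball_normE/= => yd; rewrite -(subKr (col' i x0) y).
  by rewrite (le_trans (ler_normB _ _))// (le_trans _ (ltW dM))// lerD2l ltW.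
have [V VE] : exists V : R, lebesgue_rV B = V%:E.
  by exists (fine (lebesgue_rV B)); rewrite fineK// ge0_fin_numE// ltW.
have V0 : 0 < V by rewrite -lte_fin -VE.
have mgamma : measurable_fun setT gamma.
  apply: continuous_measurable_rV => //.
  exact/continuous_subspaceT/smooth_continuous.
have [Ga GaE] : exists Ga : R, pint Om p (fun x => G x ord0 i) = Ga%:E.
  exists (fine (pint Om p (fun x => G x ord0 i))); rewrite fineK// ge0_fin_numE ?pint_ge0//.
  by have [_ h] := (in_LpP Om p _).1 (LG i); exact: h.
have Ga0 : 0 <= Ga by rewrite -lee_fin -GaE pint_ge0.
(* The collar integral will be at most [4 T k = T a V / 8], while fibres over half of the base force
   at least [(a / 2) T (V / 2) = T a V / 4]. *)
pose k := a * V / 32; have k0 : 0 < k by rewrite divr_gt0 ?mulr_gt0.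
(* The order matters: a large [l] makes the p-th power part of the integral of [|G|] at most [k],
   and then a thin collar makes the part [l V T] at most [k]. Both are fixed before the
   approximation index [j]. *)
have [l l0 hl] := powR_neg_small Ga0 k0.
pose T := Num.min T1 (k / (l * V)).
have T0 : 0 < T by rewrite lt_min T10 divr_gt0// mulr_gt0.
have TT1 : T <= T1 by rewrite ge_min lexx.
have lTV : l * (V * T) <= k.
  rewrite mulrA mulrC -ler_pdivlMr ?mulr_gt0// ge_min lexx orbT//.
pose S := collar i b gamma B T.
have mS : measurable S := measurable_collar i b mgamma T mB.
have SO : S `<=` Om.
  move=> x [Bx /andP[t0 tT]]; rewrite -(graph_chartK i b gamma x).
  by apply: (dom _ Bx).1; rewrite t0 (le_trans (ltW tT)).
have Ld j : in_Lp p Om (fun x => phi j x - v x).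
  exact: (in_LpB mOm p1 (in_Lp_smooth oOm bOm p1 (sphi j)) Lv).
have Lg j : in_Lp p Om (fun x => 'D_'e_i (phi j) x - G x ord0 i).
  exact: (in_LpB mOm p1 (in_Lp_smooth oOm bOm p1 (smooth_derive i (sphi j))) (LG i)).
have c3 : pint Om p (fun x => 'D_'e_i (phi j) x - G x ord0 i) @[j --> \oo] --> 0%E.
  apply: (cvge0_le _ _ c2) => j; first exact: pint_ge0.
  have Lgj m : in_Lp p Om (fun x => (grad (phi j) x - G x) ord0 m).
    under eq_fun do rewrite mxE [X in _ + X]mxE.
    apply: (in_LpB mOm p1 _ (LG m)); under eq_fun do rewrite mxE.
    exact: (in_Lp_smooth oOm bOm p1 (smooth_derive m (sphi j))).
  apply: (pint_le mOm p1 ler01).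
  - exact: in_Lp_measurable (in_Lp_enorm oOm p1 Lgj).
  - exact: in_Lp_measurable (Lg j).
  - move=> x _; rewrite mul1r [leRHS]ger0_norm ?enorm_ge0//.
    by have := coord_le_enorm (grad (phi j) x - G x) i; rewrite mxE [X in _ + X]mxE mxE.
(* Discarded fibres then have total measure at most [2^n eta = V / 2]. The half inside [e3] turns
   the bound from Markov's inequality into the strict [hausdorff n E < eta]. *)
pose eta := V / 2 / 2 ^+ n; have eta0 : 0 < eta by rewrite !divr_gt0// exprn_gt0.
have a4 : 0 < a / 4 by rewrite divr_gt0.
pose e3 := (a / 4) `^ p * (eta / 2).
have e30 : 0 < e3 by rewrite mulr_gt0 ?powR_gt0// divr_gt0.
near \oo => j.
have k1 : \int[leb]_(x in Om) `|phi j x - v x| <= T * k.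
  near: j; apply: (Rintegral_norm_cvg0 oOm bOm p1 Ld c1); exact: mulr_gt0.
have k2 : \int[leb]_(x in Om) `|'D_'e_i (phi j) x - G x ord0 i| <= k.
  by near: j; exact: (Rintegral_norm_cvg0 oOm bOm p1 Lg c3).
have k3 : (\int[hausdorff n]_(x in boundary Om) (`|phi j x - F x| `^ p)%:E <= e3%:E)%E.
  near: j; apply: ((cvge0P _).1 tphi _ e30) => j.
  apply: integral_raw_ge0; first exact: hausdorff_set0.
  by move=> x _; rewrite lee_fin powR_ge0.
pose E := [set y | boundary Om y /\ a / 4 <= `|phi j y - F y|].
have mE : measurable E := measurable_boundary_gap (a / 4) (sphi j).
have HE : (hausdorff n E < eta%:E)%E.
  have a4p : 0 < (a / 4) `^ p by rewrite powR_gt0.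
  have := @markov_raw _ _ _ (@hausdorff R n.+1 n) (hausdorff_set0 n) _ E _
    (fun x => (`|phi j x - F x| `^ p)%:E) mE (fun x => @proj1 _ _) a4p.
  move=> /(_ (fun x _ => powR_ge0 _ _)) hE.
  have {}hE := le_trans (hE _) k3.
  rewrite /e3 EFinM lee_pmul2l// in hE.
  apply: le_lt_trans (hE _) _; last by rewrite lte_fin ltr_pdivrMr// ltr_pMr// ltr1n.
  move=> x [_ ax]; rewrite lee_fin ge0_ler_powR ?nnegrE ?(ltW a4)//.
  by rewrite (le_trans ler01)// ltW.
have [Z [mZ Zeta EZ]] := hausdorff_small_projection i HE.
have ZV : (lebesgue_rV Z <= (V / 2)%:E)%E.
  by apply: le_trans Zeta _; rewrite lee_fin mulrC divfK// gt_eqF// exprn_gt0.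
pose P := B `\` Z.
have mP : measurable P by exact: measurableD.
have PV : ((V / 2)%:E <= lebesgue_rV P)%E.
  have : (lebesgue_rV B <= lebesgue_rV P + lebesgue_rV Z)%E.
    apply: (@le_trans _ _ (lebesgue_rV (P `|` Z))); last exact: measureU2.
    apply: le_measure; rewrite ?inE//; first exact: measurableU.
    by move=> y By; have [Zy|nZ] := pselect (Z y); [right|left].
  move=> /le_trans/(_ (leeD2l _ ZV)); rewrite VE -leeBlDr// -EFinB.
  by rewrite [X in X%:E](_ : _ = V / 2)//; lra.
(* Of the distance [a], the variation of [w] and of [F] near [x0] takes [a / 8] each, and the
   boundary error of [phi j] off the discarded fibres less than [a / 4]. *)
have gap y (t : R) : P y -> 0 < t < T -> a / 2 <= `|w (theta (y, t)) - phi j (theta (y, 0))|.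
  move=> [By nZ] /andP[t0 tT].
  have TT : `|t| <= T1 by rewrite gtr0_norm// (le_trans (ltW tT)).
  have i0 : `|0 : R| <= T1 by rewrite normr0 ltW.
  have [inO bd] := dom y By.
  have Ot : Om (theta (y, t)) by apply: inO; rewrite t0 (le_trans (ltW tT)).
  have bt : ball x0 rw (theta (y, t)).
    by apply: le_ball (hth y t By TT); rewrite !ge_min lexx orbT.
  have b0 : ball x0 rF (theta (y, 0)).
    by apply: le_ball (hth y 0 By i0); rewrite !ge_min lexx !orbT.
  have w1 := hw _ bt (subset_closure Ot); have f1 := hFa _ b0 bd.
  have p2 : `|phi j (theta (y, 0)) - F (theta (y, 0))| < a / 4.
    rewrite ltNge; apply/negP => h; apply: nZ.
    by have := EZ _ (conj bd h); rewrite col'_graph_chart.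
  have := ler_distD (w (theta (y, t))) (w x0) (F x0); rewrite -/a.
  have := ler_distD (phi j (theta (y, 0))) (w (theta (y, t))) (F x0).
  have := ler_distD (F (theta (y, 0))) (phi j (theta (y, 0))) (F x0).
  by move: w1 f1 p2; rewrite [`|F (theta _) - F x0|]distrC; exact: arith.
have mw : measurable_fun Om w.
  apply: continuous_measurable_rV => //.
  exact: continuous_subspaceW (@subset_closure _ Om) cw.
have := collar_estimate mgamma mB T0 mP (@subDsetl _ B Z)
  (measurable_funS mOm SO mw) (sphi j) (ltW (divr_gt0 a0 (ltr0n _ 2))) gap.
rewrite -/theta -/S => HS.
have mphi := smooth_measurable (Om := S) (sphi j).
have mDphi := smooth_measurable (Om := S) (smooth_derive i (sphi j)).
have mwS : measurable_fun S w := measurable_funS mOm SO mw.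
have mGO := in_Lp_measurable (LG i).
have mGS : measurable_fun S (fun x => G x ord0 i) := measurable_funS mOm SO mGO.
have A1 : (\int[leb]_(x in S) `|w x - phi j x|%:E <= (T * k)%:E)%E.
  apply: (@le_trans _ _ (\int[leb]_(x in Om) `|w x - phi j x|%:E)%E).
    apply: ge0_subset_integral => //.
    apply: measurable_norm_EFin.
    by apply: measurable_funB => //; exact: smooth_measurable (sphi j).
  apply: (@le_trans _ _ (\int[leb]_(x in Om) `|phi j x - v x|%:E)%E).
    apply: ae_ge0_le_integral => //.
    - apply: measurable_norm_EFin.
      by apply: measurable_funB => //; exact: smooth_measurable (sphi j).
    - by apply: measurable_norm_EFin; exact: in_Lp_measurable (Ld j).
    - by apply: filterS wv => x wx Ox; rewrite wx// distrC.
  by rewrite (Rintegral_normE oOm bOm p1 (Ld j)) lee_fin.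
have A2 : (\int[leb]_(x in S) `|'D_'e_i (phi j) x - G x ord0 i|%:E <= k%:E)%E.
  apply: (@le_trans _ _ (\int[leb]_(x in Om) `|'D_'e_i (phi j) x - G x ord0 i|%:E)%E).
    apply: ge0_subset_integral => //.
    by apply: measurable_norm_EFin; exact: in_Lp_measurable (Lg j).
  by rewrite (Rintegral_normE oOm bOm p1 (Lg j)) lee_fin.
have A3 : (\int[leb]_(x in S) `|G x ord0 i|%:E <= (k + k)%:E)%E.
  apply: le_trans (integral_norm_le mS p1 l0 mGS) _.
  rewrite EFinD; apply: leeD.
    rewrite (lebesgue_collar i b mgamma mB T0).
    by rewrite VE; exact: lTV.
  apply: (@le_trans _ _ ((l `^ (1 - p))%:E * Ga%:E)%E); last by rewrite -EFinM lee_fin.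
  rewrite lee_wpmul2l ?lee_fin ?powR_ge0// -GaE; apply: ge0_subset_integral => //.
  exact: measurable_pow_norm.
have mN1 : measurable_fun S (fun x => `|w x - phi j x|%:E).
  by apply: measurable_norm_EFin; exact: measurable_funB.
have mN2 : measurable_fun S (fun x => `|'D_'e_i (phi j) x|%:E).
  exact: measurable_norm_EFin.
have mN3 : measurable_fun S (fun x => `|'D_'e_i (phi j) x - G x ord0 i|%:E).
  by apply: measurable_norm_EFin; exact: measurable_funB.
have mN4 : measurable_fun S (fun x => `|G x ord0 i|%:E).
  exact: measurable_norm_EFin.
have A4 : (\int[leb]_(x in S) `|'D_'e_i (phi j) x|%:E <= (k + (k + k))%:E)%E.
  apply: (@le_trans _ _ (\int[leb]_(x in S)
      (`|'D_'e_i (phi j) x - G x ord0 i|%:E + `|G x ord0 i|%:E))%E).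
    apply: ge0_le_integral => //; first exact: emeasurable_funD.
    move=> x _; rewrite -EFinD lee_fin.
    by rewrite -{1}(subrK (G x ord0 i) ('D_'e_i (phi j) x)) ler_normD.
  by rewrite ge0_integralD// EFinD leeD.
have UB : (\int[leb]_(x in S) (`|w x - phi j x| + T * `|'D_'e_i (phi j) x|)%:E <=
    (T * k + T * (k + (k + k)))%:E)%E.
  rewrite (_ : \int[leb]_(x in S) _ = \int[leb]_(x in S) (`|w x - phi j x|%:E +
      T%:E * `|'D_'e_i (phi j) x|%:E))%E; last by apply: eq_integral.
  rewrite ge0_integralD//; last 2 first.
  - by move=> x _; rewrite mule_ge0// lee_fin ltW.
  - exact: measurable_funeM.
  rewrite ge0_integralZl//; last by rewrite lee_fin ltW.
  rewrite EFinD leeD// EFinM lee_wpmul2l// lee_fin ltW//.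
have aT : 0 < a / 2 * T by rewrite mulr_gt0// divr_gt0.
have aT0 : (0 <= (a / 2 * T)%:E)%E by rewrite lee_fin ltW.
have := le_trans (le_trans (lee_wpmul2l aT0 PV) HS) UB.
rewrite -EFinM lee_fin leNgt => /negP[].
have aTV : 0 < T * (a * V) by rewrite !mulr_gt0.
have -> : T * k + T * (k + (k + k)) = T * (a * V) / 8 by rewrite /k; field.
have -> : a / 2 * T * (V / 2) = T * (a * V) / 4 by field.
by rewrite ltr_pM2l// ltf_pV2 ?posrE// ltr_nat.
Unshelve. all: by end_near. Qed.

End trace.

(** * Uniqueness *)

Section compact_tools.
Context {R : realType} {n : nat}.
Implicit Types (A K : set 'rV[R]_n.+1) (f : 'rV[R]_n.+1 -> R).

Lemma compact_superlevel A f (c : R) : compact A -> {within A, continuous f} ->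
  compact [set x | A x /\ c <= f x].
Proof.
move=> cA cf; apply: (subclosed_compact _ cA) => [|x []//].
have clA : closed A := compact_closed (@norm_hausdorff _ _) cA.
move=> x cx; have Ax : A x by apply: clA; apply: closure_subset cx => y [].
split=> //; rewrite leNgt; apply/negP => fx.
have e0 : 0 < (c - f x) / 2 by rewrite divr_gt0// subr_gt0.
have [y [[Ay cy] /(_ Ay)]] := cx _ (within_continuous_dist cf Ax e0).
rewrite ler_norml; lra.
Qed.

(** The set of maximum points is returned as a compact superlevel set, so that another function can
    be maximised on it; [comparison] does this repeatedly. *)
Lemma compact_argmax A f : compact A -> A !=set0 -> {within A, continuous f} ->
  exists m : R, [/\ compact [set x | A x /\ m <= f x],
    [set x | A x /\ m <= f x] !=set0 & forall x, A x -> f x <= m].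
Proof.
move=> cA A0 cf; have [y yA ymax] := compact_EVT_max A0 cA cf.
rewrite inE in yA; exists (f y); split; first exact: compact_superlevel.
  by exists y.
by move=> x Ax; apply: ymax; rewrite inE.
Qed.

(** The upper envelope [u^e] at scale [e]; applied to [-v] it is minus the lower envelope [v_e]. *)
Definition ball_sup (e : R) f (x : 'rV[R]_n.+1) : R := sup [set f y | y in eball x e].

Lemma ball_supP (e : R) K f x : 0 <= e -> {within K, continuous f} -> eball x e `<=` K ->
  (exists2 y, eball x e y & ball_sup e f x = f y) /\
  forall y, eball x e y -> f y <= ball_sup e f x.
Proof.
move=> e0 cf xK.
have cfx : {within eball x e, continuous f} := continuous_subspaceW xK cf.
have x0 : eball x e !=set0 by exists x; exact: eball_center.
have [y yx ymax] := compact_EVT_max x0 (@eball_compact _ _ x e) cfx.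
rewrite inE in yx.
have ub z : eball x e z -> f z <= f y by move=> zx; apply: ymax; rewrite inE.
suff E : ball_sup e f x = f y by split; [exists y|rewrite E].
apply/eqP; rewrite eq_le; apply/andP; split.
  by apply: ge_sup => [|_ [z zx <-]]; [exists (f y); exists y|exact: ub].
apply: ub_le_sup; last by exists y.
by exists (f y) => _ [z zx <-]; exact: ub.
Qed.

(** Translation carries one ball onto another of the same radius, so the supremum inherits the
    modulus of continuity of [f]. *)
Lemma ball_sup_continuous (e : R) A K f : 0 <= e -> compact K ->
  {within K, continuous f} -> (forall x, A x -> eball x e `<=` K) ->
  {within A, continuous (ball_sup e f)}.
Proof.
move=> e0 cK cf AK; apply: dist_within_continuous => x d Ax d0.
have [r r0 hr] := compact_uniformly_continuous cK cf d0.
have half (x' x'' : 'rV[R]_n.+1) : A x' -> A x'' -> enorm (x' - x'') <= r ->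
    ball_sup e f x' <= ball_sup e f x'' + d.
  move=> Ax' Ax'' xr.
  have [[y yx ->] _] := ball_supP e0 cf (AK _ Ax').
  have [_ h] := ball_supP e0 cf (AK _ Ax'').
  have yx'' : eball x'' e (y - (x' - x'')).
    by move: yx; rewrite /eball/= opprB addrCA [_ - x'']addrC addKr.
  have := h _ yx''.
  have := hr _ _ (AK _ Ax' _ yx) (AK _ Ax'' _ yx'').
  rewrite subKr => /(_ xr); rewrite ler_norml; lra.
apply: filterS (@nbhsx_ballx _ _ x (r / n.+1%:R) _) => [y|]; last by rewrite divr_gt0.
rewrite -ball_normE/= ltr_pdivlMr// => xy Ay.
have xyr : enorm (x - y) <= r.
  by apply: le_trans (enorm_le_norm _) _; rewrite mulrC ltW.
have := half _ _ Ax Ay xyr; rewrite enormB in xyr.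
have := half _ _ Ay Ax xyr; rewrite ler_norml; lra.
Qed.

End compact_tools.
Section comparison.
Context {R : realType} {n : nat}.
Variables (Om : set 'rV[R]_n.+1) (Psi u v : 'rV[R]_n.+1 -> R).
Implicit Types (x y w : 'rV[R]_n.+1) (r S : R).
Hypotheses (oOm : open Om) (bOm : bounded_set Om).
Hypothesis cPsi : {within closure Om, continuous Psi}.
Hypothesis cu : {within closure Om, continuous u}.
Hypothesis cv : {within closure Om, continuous v}.
Hypothesis uv_boundary : forall x, boundary Om x -> u x = v x.
Hypothesis Psi_v : forall x, Om x -> Psi x <= v x.
Hypothesis cone_u : forall x r S, 0 < r -> eball x r `<=` Om ->
  (forall y, eball x r y -> Psi y < u y) -> (forall y, eball x r y -> u y <= S) ->
  forall w, eball x r w -> u w <= u x + (S - u x) * (enorm (w - x) / r).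
Hypothesis cone_v : forall x r S, 0 < r -> eball x r `<=` Om ->
  (forall y, eball x r y -> - v y <= S) ->
  forall w, eball x r w -> - v w <= - v x + (S + v x) * (enorm (w - x) / r).

Let cO : compact (closure Om). Proof. exact: bounded_closure_compact. Qed.
Let OcO : Om `<=` closure Om. Proof. exact: subset_closure. Qed.

Let cNv : {within closure Om, continuous (fun x => - v x)}.
Proof. exact: within_continuousN. Qed.

Let eball_mid x (e : R) y : 0 < e -> eball x (2 * e) y ->
  eball x e (x + 2^-1 *: (y - x)) /\ eball (x + 2^-1 *: (y - x)) e y.
Proof.
move=> e0; rewrite /eball/= => yx.
have h : 2^-1 * enorm (y - x) <= e by rewrite mulrC ler_pdivrMr// mulrC.
split; first by rewrite addrAC subrr add0r enormZ ger0_norm.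
suff -> : y - (x + 2^-1 *: (y - x)) = 2^-1 *: (y - x) by rewrite enormZ ger0_norm.
rewrite opprD addrA -[X in X - _](scale1r (y - x)) -scalerBl; congr (_ *: _).
by field.
Qed.

(* The discrete argument of Armstrong and Smart: comparing suprema over balls,
   cone comparison makes u^e and - v_e sub-harmonious at scale e, and a point
   where u^e - v_e and then u^e are maximal cannot be extremal for its first
   coordinate. *)
Lemma comparison x : closure Om x -> u x <= v x.
Proof.
have ar1 (K a a' a0 c c' c0 : R) : `|a - a'| <= K / 16 -> `|c - c'| <= K / 16 ->
    `|a0 - a'| <= K / 16 -> `|c0 - c'| <= K / 16 -> 0 < K -> K <= a0 - c0 ->
    K / 2 <= a - c by rewrite !ler_norml; lra.
have ar2 (K a a' c q q' : R) : `|a - a'| <= K / 16 -> `|q - q'| <= K / 16 ->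
    q' <= c -> K / 2 <= a' - c -> 0 < K -> q < a by rewrite !ler_norml; lra.
have ar3 (S S' W f g f1 g1 a c : R) : S <= f1 -> c <= g1 -> f1 + g1 < W ->
    a + S' <= W -> 2 * f <= S + a -> 2 * g <= S' + c -> W <= f + g -> False by lra.
have ar4 (S S' W f g f1 g1 a c : R) : S <= f -> a <= f1 -> c <= g1 ->
    a + S' <= W -> 2 * f <= S + a -> 2 * g <= S' + c -> W <= f + g ->
    f + g <= W -> a <= S -> W <= f1 + g1 by lra.
have ar5 (S f f1 a m : R) : S <= f -> a <= f1 -> 2 * f <= S + a -> f <= m -> m <= f ->
    m <= f1 by lra.
move=> cx; rewrite leNgt; apply/negP => vux.
have cuv : {within closure Om, continuous (fun x => u x - v x)}.
  exact: within_continuousD.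
have cO0 : closure Om !=set0 by exists x.
have [M [_ [xM [cxM xMge]] uvM]] := compact_argmax cO cO0 cuv.
have M0 : 0 < M by apply: lt_le_trans (uvM _ cx); rewrite subr_gt0.
(* The level [M / 2] leaves room: [A] stays off the boundary, where [u = v], and balls of radius [e]
   about the maximum point found below remain in [A]. *)
pose A := [set y | closure Om y /\ M / 2 <= u y - v y].
have cA : compact A by exact: compact_superlevel.
have AO : A `<=` Om.
  move=> y [cy My]; apply: contrapT => nOy; move: My.
  by rewrite uv_boundary ?subrr ?leNgt ?divr_gt0//; exact: closure_boundary.
have [r0 r00 hr0] := compact_eball_subset cA oOm AO.
have M16 : 0 < M / 16 by rewrite divr_gt0.
have [ru ru0 hu] := compact_uniformly_continuous cO cu M16.
have [rv rv0 hv] := compact_uniformly_continuous cO cv M16.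
have [rP rP0 hP] := compact_uniformly_continuous cO cPsi M16.
(* Balls of radius [2 e] about points of [A] lie in [Om], and across that distance [u], [v] and
   [Psi] vary by at most [M / 16]. *)
pose e := Num.min (Num.min r0 rP) (Num.min ru rv) / 2.
have ee : 2 * e = Num.min (Num.min r0 rP) (Num.min ru rv) by rewrite mulrC divfK.
have e0 : 0 < e by rewrite divr_gt0// !lt_min r00 rP0 ru0.
have e20 : 0 < 2 * e by rewrite mulr_gt0.
have le2e : e <= 2 * e by rewrite ler_pMl// ler1n.
have er0 : 2 * e <= r0 by rewrite ee !ge_min lexx.
have eP : 2 * e <= rP by rewrite ee !ge_min lexx !orbT.
have eu : 2 * e <= ru by rewrite ee !ge_min lexx !orbT.
have ev : 2 * e <= rv by rewrite ee !ge_min lexx !orbT.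
have sub2 y : A y -> eball y (2 * e) `<=` closure Om.
  by move=> Ay z yz; apply: OcO; apply: (hr0 _ Ay); exact: le_trans yz er0.
have sub1 y : A y -> eball y e `<=` closure Om.
  by move=> Ay z yz; apply: (sub2 _ Ay); exact: le_trans yz le2e.
pose f := ball_sup e u; pose g := ball_sup e (fun x => - v x).
have cf : {within A, continuous f} := ball_sup_continuous (ltW e0) cO cu sub1.
have cg : {within A, continuous g} := ball_sup_continuous (ltW e0) cO cNv sub1.
have fP y Ay := ball_supP (ltW e0) cu (sub1 y Ay).
have gP y Ay := ball_supP (ltW e0) cNv (sub1 y Ay).
have cfg : {within A, continuous (fun x => f x + g x)} := within_continuousD cf cg.
have A0 : A !=set0.
  by exists xM; split=> //; apply: le_trans xMge; rewrite ler_pdivrMr// ler_pMr// ler1n.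
have [W [cE E0 Wmax]] := compact_argmax cA A0 cfg.
set E := [set y | _] in cE E0.
have EA : E `<=` A by move=> y [].
have [m [cE2 E20 mmax]] := compact_argmax cE E0 (continuous_subspaceW EA cf).
set E2 := [set y | _] in cE2 E20.
have cc : {within E2, continuous (fun y => y ord0 ord0)}.
  by apply: continuous_subspaceT; exact: coord_continuous.
(* Three successive maximisations: [f + g], then [f], then the first coordinate. The last rules out
   that the extremal set contains a point shifted from [x0] in that direction. *)
have [l [_ [x0 [[[Ax0 Wx0] mx0] lx0]] lmax]] := compact_argmax cE2 E20 cc.
have x0x0 : eball x0 e x0 by exact/eball_center/ltW.
have MW : M <= W.
  have AxM : A xM by split=> //; apply: le_trans xMge; rewrite ler_pdivrMr// ler_pMr// ler1n.
  apply: le_trans (Wmax _ AxM); apply: le_trans xMge _.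
  by apply: lerD; [apply: (fP _ AxM).2|apply: (gP _ AxM).2]; exact/eball_center/ltW.
have near0 (h : 'rV[R]_n.+1 -> R) y (w : R) : (forall y z, closure Om y -> closure Om z ->
    enorm (y - z) <= w -> `|h y - h z| <= M / 16) -> 2 * e <= w ->
    eball x0 (2 * e) y -> `|h y - h x0| <= M / 16.
  move=> hh ew yx; apply: hh; last exact: le_trans yx ew.
  - exact: (sub2 _ Ax0).
  - by case: Ax0.
have [[y0 y0x fy0] fmax] := fP _ Ax0; have [[z0 z0x gz0] gmax] := gP _ Ax0.
have le2 y : eball x0 e y -> eball x0 (2 * e) y by move=> yx; exact: le_trans yx le2e.
have ballA y : eball x0 e y -> A y.
  move=> yx; split; first exact: (sub1 _ Ax0).
  have nu := near0 u y _ hu eu (le2 _ yx); have nv := near0 v y _ hv ev (le2 _ yx).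
  have nu0 := near0 u y0 _ hu eu (le2 _ y0x); have nv0 := near0 v z0 _ hv ev (le2 _ z0x).
  apply: ar1 nu nv nu0 nv0 M0 _; apply: le_trans MW _.
  by rewrite -fy0 -gz0.
have PsiU y : eball x0 (2 * e) y -> Psi y < u y.
  move=> yx; have [_ Mx0] := Ax0.
  exact: ar2 (near0 u y _ hu eu yx) (near0 Psi y _ hP eP yx) (Psi_v (AO _ Ax0)) Mx0 M0.
have sub0 : eball x0 (2 * e) `<=` Om.
  by move=> z xz; apply: (hr0 _ Ax0); exact: le_trans xz er0.
have [[Y YS uS] uSmax] := ball_supP (ltW e20) cu (sub2 _ Ax0).
have [[Z ZS vS] vSmax] := ball_supP (ltW e20) cNv (sub2 _ Ax0).
set S := ball_sup (2 * e) u x0 in uS uSmax.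
set S' := ball_sup (2 * e) (fun x => - v x) x0 in vS vSmax.
have half_le y : eball x0 e y -> enorm (y - x0) / (2 * e) <= 2^-1.
  rewrite /eball/= => yx; rewrite ler_pdivrMr// mulrA mulVf ?mul1r//.
have half_cone (s q t z : R) : t <= s + (q - s) * z -> s <= q -> z <= 2^-1 -> 2 * t <= q + s.
  move=> ts sq z2; have : (q - s) * z <= (q - s) * 2^-1 by rewrite ler_wpM2l// subr_ge0.
  lra.
have x0x2 : eball x0 (2 * e) x0 := le2 _ x0x0.
(* Cone comparison on the ball of radius [2 e], read at distance at most [e] from the centre, bounds
   the envelope by the mean of the supremum and the central value. *)
have fS : 2 * f x0 <= S + u x0.
  rewrite [f x0]fy0; apply: half_cone (half_le _ y0x); last exact: uSmax.
  by apply: cone_u => //; exact: le2.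
have gS : 2 * g x0 <= S' - v x0.
  rewrite [g x0]gz0; apply: half_cone (half_le _ z0x); last exact: vSmax.
  by rewrite opprK; apply: cone_v => //; exact: le2.
have WE : f x0 + g x0 <= W := Wmax _ Ax0.
have mE : f x0 <= m by apply: mmax.
(* The midpoint between [x0] and a minimum point of [v] on the larger ball is within [e] of both, so
   the maximality of [W] can be tested there. *)
have [x2x x2Z] := eball_mid e0 ZS; set x2 := x0 + _ in x2x x2Z.
have Zsum : u x0 + S' <= W.
  apply: le_trans (Wmax _ (ballA _ x2x)); apply: lerD.
    by apply: (fP _ (ballA _ x2x)).2; rewrite /eball/= enormB.
  by rewrite vS; apply: (gP _ (ballA _ x2x)).2.
have ux0 : u x0 <= S by exact: uSmax.
(* If [S > f x0], the midpoint [x1] towards a maximum point of [u] has a larger [f], so it cannot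
   maximise [f + g], and adding the two mean inequalities gives [2 W < 2 W]. Otherwise
   [S = f x0 = u x0], all inequalities are tight, and the shift of [x0] along the first axis is
   again extremal. *)
have [Sf|fS'] := leP S (f x0); last first.
  have [x1x x1Y] := eball_mid e0 YS; set x1 := x0 + _ in x1x x1Y.
  have Ax1 := ballA _ x1x.
  have f1 : S <= f x1 by rewrite uS; apply: (fP _ Ax1).2.
  have g1 : - v x0 <= g x1 by apply: (gP _ Ax1).2; rewrite /eball/= enormB.
  have W1 : f x1 + g x1 < W.
    rewrite ltNge; apply/negP => W1; have := mmax _ (conj Ax1 W1).
    by rewrite leNgt (le_lt_trans mx0)// (lt_le_trans fS').
  exact: ar3 f1 g1 W1 Zsum fS gS Wx0.
pose x' := x0 + e *: 'e_ord0.
have x'x : eball x0 e x'.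
  rewrite /eball/= addrAC subrr add0r enormZ gtr0_norm// ler_piMr ?(ltW e0)//.
  rewrite /enorm (bigD1 ord0)//= big1 => [|j j0]; last first.
    by rewrite mxE eqxx/= (negPf j0) expr0n.
  by rewrite mxE !eqxx expr1n addr0 sqrtr1.
have Ax' := ballA _ x'x.
have f' : u x0 <= f x' by apply: (fP _ Ax').2; rewrite /eball/= enormB.
have g' : - v x0 <= g x' by apply: (gP _ Ax').2; rewrite /eball/= enormB.
have W' : W <= f x' + g x' by exact: ar4 Sf f' g' Zsum fS gS Wx0 WE ux0.
have m' : m <= f x' by exact: ar5 Sf f' fS mE mx0.
have := lmax _ (conj (conj Ax' W') m').
rewrite leNgt (le_lt_trans lx0)// /x' mxE ltrDl mxE mxE !eqxx mulr1.
exact: e0.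
Qed.

End comparison.
Section uniqueness.
Context {R : realType} {n : nat}.
Variables (Om : set 'rV[R]_n.+1) (F Psi : 'rV[R]_n.+1 -> R).
Variable u : R -> 'rV[R]_n.+1 -> R.
Hypothesis hOm : bounded_smooth_domain Om.
Hypothesis hF : [lipschitz F x | x in boundary Om].
Hypothesis hPsi : {within closure Om, continuous Psi}.
Hypothesis hu : forall p : R, 1 < p -> obstacle_minimizer Om F Psi p (u p).

Lemma limit_boundary U x : subsequential_limit Om u U -> boundary Om x -> U x = F x.
Proof.
have [oOm _ _ bOm sOm] := hOm.
move=> [p_ [w_ [p1 _ [wu cw] wU _]]] bx.
have cO := bounded_closure_compact bOm.
apply/eqP; rewrite -subr_eq0 -normr_le0; apply/ler_addgt0Pr => e e0; rewrite add0r.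
near \oo => j.
have cj : {within closure Om, continuous (w_ j)} by near: j; exact: cw.
have uj : forall x, closure Om x -> `|w_ j x - U x| <= e.
  by near: j; exact: compact_uniform_cvg.
have [G [_ tr _] _] := hu (p1 j).
have := trace_boundary oOm bOm sOm hF (p1 j) cj (wu j) tr bx => <-.
by rewrite distrC; exact: uj (boundary_closure bx).
Unshelve. all: by end_near. Qed.

Lemma subsequential_limit_le u1 u2 x :
  subsequential_limit Om u u1 -> subsequential_limit Om u u2 ->
  closure Om x -> u1 x <= u2 x.
Proof.
move=> hu1 hu2; have [oOm _ _ bOm _] := hOm.
have [p1_ [w1 [p1 p1oo [wu1 cw1] wU1 _]]] := hu1.
have [p2_ [w2 [p2 p2oo [wu2 cw2] wU2 _]]] := hu2.
apply: (@comparison _ _ Om Psi) => //.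
- exact: limit_continuous bOm cw1 wU1.
- exact: limit_continuous bOm cw2 wU2.
- by move=> y by_; rewrite (limit_boundary hu1)// (limit_boundary hu2).
- exact: limit_ge_obstacle oOm bOm hPsi hu p2 wu2 cw2 wU2.
(* Comparison from above for the first limit is the case [sg = 1], available off the contact set;
   comparison from below for the second is [sg = -1], where the competitor is raised. *)
- move=> y r S r0 yr Pu uS w wr.
  have uS1 z : eball y r z -> 1 * u1 z <= S by move=> zr; rewrite mul1r uS.
  have := limit_cone oOm bOm hF hPsi hu p1 p1oo wu1 cw1 wU1 (mulr1 1) r0 yr
    (or_intror Pu) uS1 wr.
  by rewrite !mul1r.
- move=> y r S r0 yr vS w wr.
  have vS1 z : eball y r z -> -1 * u2 z <= S by move=> zr; rewrite mulN1r vS.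
  have sg2 : -1 * -1 = 1 :> R by rewrite mulrNN mulr1.
  have := limit_cone oOm bOm hF hPsi hu p2 p2oo wu2 cw2 wU2 sg2 r0 yr
    (or_introl erefl) vS1 wr.
  by rewrite !mulN1r opprK.
Qed.

End uniqueness.
Unset Implicit Arguments.

Theorem corollary2p2 (R : realType) (n : nat) (Om : set 'rV[R]_n.+1)
    (F Psi : 'rV[R]_n.+1 -> R) (u : R -> 'rV[R]_n.+1 -> R)
    (u1 u2 : 'rV[R]_n.+1 -> R)
    (hOm : bounded_smooth_domain Om)
    (hF : [lipschitz F x | x in boundary Om])
    (hPsi : {within closure Om, continuous Psi})
    (hPsiF : sup (Psi @` boundary Om) < inf (F @` boundary Om))
    (hu : forall p : R, 1 < p -> obstacle_minimizer Om F Psi p (u p))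
    (hu1 : subsequential_limit Om u u1)
    (hu2 : subsequential_limit Om u u2) :
  forall x, closure Om x -> u1 x = u2 x.
Proof.
move=> x cx; apply/eqP; rewrite eq_le.
by rewrite (subsequential_limit_le hOm hF hPsi hu hu1 hu2 cx)
  (subsequential_limit_le hOm hF hPsi hu hu2 hu1 cx).
Qed.
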